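(* Let $i=0,1$. The set $$\widetilde{B}_{\mathcal{L}_i(\mathfrak{gl}_2)}=\left\{h\,b\,:\, h\in B_{\mathrm{H}^-},\ b\in\widetilde{B}_{\mathcal{L}_i(\mathfrak{sl}_2)}\right\}$$ forms a topological basis for $\mathcal{L}_i(\mathfrak{gl}_2)$.
   Context: Double Yangian. Let $I$ be the identity and $P$ the permutation operator on $\mathbb{C}^2\otimes\mathbb{C}^2$, and $R(u)=\frac{1}{1+h/u}\left(I+\frac{h}{u}P\right)$ (here $h$ is the formal parameter). $\mathrm{DY}(\mathfrak{gl}_2)$ is the ($h$-adically completed) associative algebra over $\mathbb{C}[[h]]$ generated by a central element $C$ and $t_{ij}^{(r)}$, $i,j=1,2$, $r\in\mathbb{Z}$, subject to $R_{12}(u-v)T_{13}^{\pm}(u)T_{23}^{\pm}(v)=T_{23}^{\pm}(v)T_{13}^{\pm}(u)R_{12}(u-v)$ and $R_{12}(u-v-hC/2)T_{13}^{+}(u)T_{23}^{-}(v)=T_{23}^{-}(v)T_{13}^{+}(u)R_{12}(u-v+hC/2)$, where $T^{\pm}(u)=\sum_{i,j}e_{ij}\otimes t_{ij}^{\pm}(u)$, $t_{ij}^+(u)=\delta_{ij}-h\sum_{r\geq 0}t_{ij}^{(r)}u^{-r-1}$, $t_{ij}^-(u)=\delta_{ij}+h\sum_{r\geq 1}t_{ij}^{(-r)}u^{r-1}$. Set $k_1^{\pm}(u)=t_{11}^{\pm}(u)$, $k_2^{\pm}(u)=t_{22}^{\pm}(u)-t_{21}^{\pm}(u)t_{11}^{\pm}(u)^{-1}t_{12}^{\pm}(u)$,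 $X^+(u)=t_{11}^+(u-hC/4)^{-1}t_{12}^+(u-hC/4)-t_{11}^-(u+hC/4)^{-1}t_{12}^-(u+hC/4)$, $X^-(u)=t_{21}^+(u+hC/4)t_{11}^+(u+hC/4)^{-1}-t_{21}^-(u-hC/4)t_{11}^-(u-hC/4)^{-1}$, $X_{\pm\alpha}(u)=h^{-1}X^\pm(u)$. Heisenberg subalgebra. Put $K^{\pm}(u)=k_1^{\pm}(u-h/2)k_2^{\pm}(u+h/2)$ and define $\kappa^{(-r)}$, $r\geq1$, by $K^-(u)=1+h\sum_{r\geq1}\kappa^{(-r)}u^{r-1}$. $\mathrm{H}^-$ is the (commutative) subalgebra generated by $1$ and all $\kappa^{(-r)}$, $r\geq 1$, and $B_{\mathrm{H}^-}=\{\kappa^{(-r_n)}\cdots\kappa^{(-r_1)}: n\geq0,\ r_n\geq\cdots\geq r_1\geq1\}$. Fock spaces. Let $\varepsilon_1,\varepsilon_2$ be the basis dual to $e_{11},e_{22}$, with form $(\varepsilon_j,\varepsilon_k)=\delta_{jk}$; $\alpha=\varepsilon_1-\varepsilon_2$, $Q=\mathbb{Z}\alpha$, $\lambda_0=0$, $\lambda_1=\alpha/2$. Let $\widehat{\mathfrak{s}}$ be the Lie algebra generated by central $C$ and $a_j(r)$ ($j=1,2$, $r\in\mathbb{Z}\setminus\{0\}$) with $[a_j(r),a_k(s)]=r\delta_{jk}\delta_{r+s,0}C$, and $\widehat{\mathfrak{s}}^-$ the subalgebra generated by $a_j(r)$, $r<0$. For $i=0,1$ let $\mathcal{F}_i=U(\widehat{\mathfrak{s}}^-)[[h]]\otimes\mathbb{C}[Q][[h]]e^{\lambda_i}$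 ($h$-adically completed), $\boldsymbol{1}=1\otimes1\in\mathcal{F}_0$. On $f\otimes e^\mu$: $C$ acts as $1$; $a_j(r)$ acts by $a_j(r)f\otimes e^\mu$ for $r<0$ and by $[a_j(r),f]\otimes e^\mu$ for $r>0$; $\partial_{\varepsilon_j}(f\otimes e^\mu)=(\varepsilon_j,\mu)f\otimes e^\mu$ ($\partial_\beta$ linear in $\beta$); $e^{\beta}(f\otimes e^\mu)=f\otimes e^{\beta+\mu}$. Put $E^-(u)=\exp\big(\sum_{r>0}\big(-\frac{a_1(-r)}{r}(u-\frac34h)^r+\frac{a_2(-r)}{r}(u+\frac h4)^r\big)\big)$, $E^+(u)=\exp\big(\sum_{r>0}\frac{a_1(r)-a_2(r)}{r}(u+\frac h4)^{-r}\big)$, $\mathcal{E}^-(u)=E^-(0)^{-1}E^-(u)$. Action. Each $\mathcal{F}_i$ is a $\mathrm{DY}(\mathfrak{gl}_2)$-module with $C$ acting as $1$ and $X_\alpha(u)=\mathcal{E}^-(u)E^+(u)e^\alpha u^{\partial_{\alpha/2}}(u+h)^{\partial_{\alpha/2}}$, $X_{-\alpha}(u)=\mathcal{E}^-(u+h/2)^{-1}E^+(u-h/2)^{-1}e^{-\alpha}(u-h/2)^{-\partial_{\alpha/2}}(u+h/2)^{-\partial_{\alpha/2}}$, $k_j^+(u)=\exp\big(-\sum_{r>0}\frac{a_j(r)}{r}((u+\frac h2)^{-r}-(u-\frac h2)^{-r})\big)\,c_j(u)^{\partial_{\alpha/2}}$ with $c_1(u)=\frac{u+h/4}{u+5h/4}$,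 $c_2(u)=\frac{u+h/4}{u-3h/4}$, $k_1^-(u)=\exp\big(\sum_{r>0}\frac{a_2(-r)}{r}((u+h)^r-u^r)\big)$, $k_2^-(u)=\exp\big(\sum_{r>0}\frac{a_1(-r)}{r}(u^r-(u-h)^r)\big)$. Expressions such as $(u+ah)^p$ are expanded in nonnegative powers of $h$. Then $\mathcal{L}_0(\mathfrak{gl}_2)=\mathrm{DY}(\mathfrak{gl}_2)\cdot\boldsymbol{1}\subset\mathcal{F}_0$ and $\mathcal{L}_1(\mathfrak{gl}_2)=\mathrm{DY}(\mathfrak{gl}_2)\cdot e^{\lambda_1}\subset\mathcal{F}_1$, where $e^{\lambda_1}=1\otimes e^{\lambda_1}$. The sets $\widetilde{B}_{\mathcal{L}_i(\mathfrak{sl}_2)}$. Write $\widetilde{X}(u)=\sum_{r\in\mathbb{Z}}\widetilde{x}(r)u^{-r-1}=X_\alpha(u)(1+h/u)^{-\partial_{\alpha/2}}$. Let $\widetilde{B}_{W_0}\subset\mathcal{F}_0$ be the set of all $\widetilde{x}(r_n)\cdots\widetilde{x}(r_1)\boldsymbol{1}$ with $n\geq0$, $r_1\leq-1$, $r_{j+1}\leq r_j-2$ for $j=1,\ldots,n-1$. For $m\in\mathbb{Z}$ put $\widetilde{B}_{\mathcal{L}_i(\mathfrak{sl}_2),m}=\{e^{\lambda_i+m\alpha}b: b\in\widetilde{B}_{W_0}\}$; these sets satisfy $\widetilde{B}_{\mathcal{L}_i(\mathfrak{sl}_2),m}\subset\widetilde{B}_{\mathcal{L}_i(\mathfrak{sl}_2),m-1}$,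 and $\widetilde{B}_{\mathcal{L}_i(\mathfrak{sl}_2)}$ is their direct limit (the union over all $m\in\mathbb{Z}$). A topological basis of an $h$-adically complete $\mathbb{C}[[h]]$-module is a $\mathbb{C}[[h]]$-linearly independent subset whose $\mathbb{C}[[h]]$-span is $h$-adically dense. *)

(* Defs.v *)
From HB Require Import structures.
From mathcomp Require Import all_boot all_order all_algebra.
From mathcomp Require Import finmap.
From mathcomp Require Import boolp classical_sets functions fsbigop reals.
From mathcomp Require Import complex.
From mathcomp Require Import monalg.

Set Implicit Arguments.
Unset Strict Implicit.
Unset Printing Implicit Defensive.

Import GRing.Theory.

Local Open Scope classical_set_scope.
Local Open Scope ring_scope.

Definition j1 : 'I_2 := ord0.
Definition j2 : 'I_2 := ord_max.

Section Yangian.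

Variable K : fieldType. (* meant to be of characteristic 0 *)

(* V[[h]] is nat -> V; the value at k is the coefficient of h^k. A       *)
(* K[[h]]-linear endomorphism of V[[h]] is a series sum_k h^k A_k with   *)
(* A_k in End(V), hence an element of [hop V] whose values are linear.   *)
(* A formal distribution A(u) = sum_n A_n u^n is an element of [fld V]:  *)
(* [A n k] is the coefficient of u^n h^k. Two-variable distributions are *)
(* elements of [fld2 V].                                                 *)
(* Sums over infinite index sets are the finite-support sums of fsbigop, *)
(* taken after evaluating at a vector of V; in all the uses below they   *)
(* have only finitely many nonzero terms.                                *)
Section Formal.

Variable V : lmodType K.

Definition fock := nat -> V.
Definition hop := nat -> V -> V.
Definition fld := int -> hop.
Definition fld2 := int -> int -> hop.

Definition hconst (v : V) : fock := fun k => if k is 0%N then v else 0.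

Definition happ (A : hop) (f : fock) : fock :=
  fun k => \sum_(i < k.+1) A i (f (k - i)%N).

Definition hone : hop := fun k v => if k is 0%N then v else 0.

Definition hcomp (A B : hop) : hop :=
  fun k v => \sum_(i < k.+1) A i (B (k - i)%N v).

Definition hexp (A : hop) (n : nat) : hop := iter n (hcomp A) hone.

Definition hscale (c : K) (A : hop) : hop := fun k v => c *: A k v.

Definition hmulh (A : hop) : hop := fun k v => if k is k'.+1 then A k' v else 0.

(* Division by h of an operator divisible by h. *)
Definition hdivh (A : hop) : hop := fun k v => A k.+1 v.

Definition fone : fld := fun n k v => if n == 0 then hone k v else 0.

Definition fsub (A B : fld) : fld := fun n k v => A n k v - B n k v.

Definition fmul (A B : fld) : fld := fun n k v =>
  \sum_(i < k.+1) \sum_(m \in [set: int]) A (n - m) i (B m (k - i)%N v).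

Definition fpow (A : fld) (m : nat) : fld := iter m (fmul A) fone.

Definition fexp (A : fld) : fld := fun n k v =>
  \sum_(m \in [set: nat]) (m`!%:R : K)^-1 *: fpow A m n k v.

(* Inverse of a distribution A = 1 - N as the geometric series in N. *)
Definition finv (A : fld) : fld := fun n k v =>
  \sum_(m \in [set: nat]) fpow (fsub fone A) m n k v.

Definition fdivh (A : fld) : fld := fun n => hdivh (A n).

(* The value at u = 0, as a distribution constant in u. *)
Definition fev0 (A : fld) : fld := fun n k v => if n == 0 then A 0 k v else 0.

Definition gbin (x : K) (k : nat) : K := (\prod_(j < k) (x - j%:R)) / k`!%:R.

(* Coefficient of u^n h^k in (u + a h)^p. *)
Definition upow (a : K) (p : int) (n : int) (k : nat) : K :=
  if n == p - k%:Z then gbin p%:~R k * a ^+ k else 0.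

(* Coefficient of u^n h^k in (1 + a h / u)^x. *)
Definition onepow (a x : K) (n : int) (k : nat) : K :=
  if n == - k%:Z then gbin x k * a ^+ k else 0.

(* A(u + h c) = sum_n A_n (u + h c)^n, where the operator c commutes with A. *)
Definition fshift (A : fld) (c : hop) : fld := fun n k v =>
  \sum_(l < k.+1)
    gbin (n + l%:Z)%:~R l *: hcomp (A (n + l%:Z)) (hexp c l) (k - l)%N v.

(* Two variables u, v: A(u), A(v), A(u - v) (the latter expanded in      *)
(* nonnegative powers of v), and the product.                            *)
Definition in1 (A : fld) : fld2 := fun p q => if q == 0 then A p else fun _ _ => 0.
Definition in2 (A : fld) : fld2 := fun p q => if p == 0 then A q else fun _ _ => 0.
Definition fdiff (A : fld) : fld2 := fun p q k v =>
  if q is Posz l then (gbin (p + q)%:~R l * (-1) ^+ l) *: A (p + q) k v else 0.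
Definition fmul2 (A B : fld2) : fld2 := fun p q k v =>
  \sum_(i < k.+1) \sum_(m \in [set: int * int])
    A (p - m.1) (q - m.2) i (B m.1 m.2 (k - i)%N v).

Record DYops := MkDYops {
  DYt : 'I_2 -> 'I_2 -> int -> hop;
  DYC : hop
}.

Variable D : DYops.

(* T^+_ij(u) for s = true and T^-_ij(u) for s = false; recall that       *)
(* Negz r is -(r+1).                                                     *)
Definition DYT (s : bool) (i j : 'I_2) : fld := fun n k v =>
  (if i == j then fone n k v else 0) +
  (if s then
     if n is Negz r then - hmulh (DYt D i j r%:Z) k v else 0
   else
     if n is Posz r then hmulh (DYt D i j (Negz r)) k v else 0).

(* Entry ((a, b), (e, f)) of R(x) = (1 + h/x)^-1 (I + (h/x) P). *)
Definition Rmat (a b e f : 'I_2) : fld := fun n k v =>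
  (((a == e) && (b == f))%:R * onepow 1 (-1) n k) *: v +
  (((a == f) && (b == e))%:R *
     (if k is k'.+1 then onepow 1 (-1) (n + 1) k' else 0)) *: v.

(* R_12(u-v+hc) T_13(u) T'_23(v) = T'_23(v) T_13(u) R_12(u-v+hc') *)
Definition RTT (c c' : hop) (T T' : 'I_2 -> 'I_2 -> fld) : Prop :=
  forall (a b a' b' : 'I_2) (p q : int) (k : nat) (v : V),
    \sum_(e < 2) \sum_(f < 2)
      fmul2 (fdiff (fshift (Rmat a b e f) c))
            (fmul2 (in1 (T e a')) (in2 (T' f b'))) p q k v
    = \sum_(e < 2) \sum_(f < 2)
      fmul2 (fmul2 (in2 (T' b f)) (in1 (T a e)))
            (fdiff (fshift (Rmat e f a' b') c')) p q k v.

Definition hzero : hop := fun _ _ => 0.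

Definition DY_module : Prop :=
  [/\ (forall i j r k, linear (DYt D i j r k)) /\ (forall k, linear (DYC D k)),
      forall i j r, hcomp (DYC D) (DYt D i j r) = hcomp (DYt D i j r) (DYC D),
      forall s : bool, RTT hzero hzero (DYT s) (DYT s)
    & RTT (hscale (- 2^-1) (DYC D)) (hscale 2^-1 (DYC D)) (DYT true) (DYT false)].

Definition k1 (s : bool) : fld := DYT s j1 j1.
Definition k2 (s : bool) : fld :=
  fsub (DYT s j2 j2)
       (fmul (DYT s j2 j1) (fmul (finv (DYT s j1 j1)) (DYT s j1 j2))).

(* [shC c A] is A(u + c h C). *)
Definition shC (c : K) (A : fld) : fld := fshift A (hscale c (DYC D)).

Definition Xplus : fld :=
  fsub (fmul (finv (shC (- 4^-1) (DYT true j1 j1))) (shC (- 4^-1) (DYT true j1 j2)))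
       (fmul (finv (shC 4^-1 (DYT false j1 j1))) (shC 4^-1 (DYT false j1 j2))).

Definition Xminus : fld :=
  fsub (fmul (shC 4^-1 (DYT true j2 j1)) (finv (shC 4^-1 (DYT true j1 j1))))
       (fmul (shC (- 4^-1) (DYT false j2 j1)) (finv (shC (- 4^-1) (DYT false j1 j1)))).

(* [sh c A] is A(u + c h). *)
Definition sh (c : K) (A : fld) : fld := fshift A (hscale c hone).

Definition Kminus : fld := fmul (sh (- 2^-1) (k1 false)) (sh 2^-1 (k2 false)).

(* kappa^(-r), for r >= 1 *)
Definition kappa (r : nat) : hop := fdivh (fsub Kminus fone) (Posz r.-1).

(* A sequence s = [:: r_1; ...; r_n] yields kappa^(-r_n) ... kappa^(-r_1). *)
Definition BH : set hop :=
  [set A | exists s : seq nat,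
     [/\ all (leq 1) s, sorted leq s &
         A = foldl (fun B r => hcomp (kappa r) B) hone s]].

(* The h-adically completed free algebra on t_ij^(r) (Some (i, j, r)) and *)
(* C (None) consists of the series sum_k h^k a_k with a_k in the free    *)
(* algebra over K. It maps onto DY(gl_2), so the orbit of a vector of a  *)
(* DY(gl_2)-module under the former is its orbit under the latter.       *)
Definition DYgen := option ('I_2 * 'I_2 * int).
Definition DYfree := nat -> {malg K[{fmonom DYgen}]}.

Definition DYgen_act (g : DYgen) : hop :=
  if g is Some (i, j, r) then DYt D i j r else DYC D.

Definition DYword_act (w : {fmonom DYgen}) : hop :=
  foldr (fun g A => hcomp (DYgen_act g) A) hone (fmonom_val w).

Definition DY_act (a : DYfree) : hop := fun k v =>
  \sum_(i < k.+1) \sum_(w <- msupp (a i)) (a i)@_w *: DYword_act w (k - i)%N v.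

Definition DY_orbit (f : fock) : set fock :=
  [set g | exists a : DYfree, g = happ (DY_act a) f].

End Formal.

Section TopologicalBasis.

Variable V : lmodType K.
Notation F := (fock V).

Definition sscale (c : nat -> K) (f : F) : F :=
  fun k => \sum_(i < k.+1) c i *: f (k - i)%N.

Definition hshift (n : nat) (f : F) : F :=
  fun k => if (k < n)%N then 0 else f (k - n)%N.

Definition lincomb (n : nat) (c : 'I_n -> nat -> K) (b : 'I_n -> F) : F :=
  fun k => \sum_(j < n) sscale (c j) (b j) k.

Definition lin_indep (B : set F) : Prop :=
  forall n (c : 'I_n -> nat -> K) (b : 'I_n -> F),
    injective b -> (forall j, B (b j)) ->
    (forall k, lincomb c b k = 0) -> forall j k, c j k = 0.

Definition hspan (B : set F) : set F :=
  [set f | exists n (c : 'I_n -> nat -> K) (b : 'I_n -> F),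
     (forall j, B (b j)) /\ f = lincomb c b].

(* f - g is in h^n L *)
Definition hcong (L : set F) (n : nat) (f g : F) : Prop :=
  exists2 e, L e & forall k, f k - g k = hshift n e k.

(* Completeness of L for its own h-adic topology; separatedness is      *)
(* automatic inside V[[h]].                                              *)
Definition hcomplete (L : set F) : Prop :=
  forall f : nat -> F, (forall p, L (f p)) ->
    (forall n, exists N, forall p q,
       (N <= p)%N -> (N <= q)%N -> hcong L n (f p) (f q)) ->
    exists2 g, L g & forall n, exists N, forall p, (N <= p)%N -> hcong L n (f p) g.

Definition hdense (L S : set F) : Prop :=
  forall f, L f -> forall n, exists2 g, S g & hcong L n f g.

Definition topological_basis (L B : set F) : Prop :=
  [/\ hcomplete L, B `<=` L, lin_indep B & hdense L (hspan B)].

End TopologicalBasis.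

(* The subalgebra s^- is commutative with basis a_j(-r), r >= 1, so that *)
(* U(s^-) has the monomials in the a_j(-r) as a basis. The variable      *)
(* (j, r) stands for a_j(-(r+1)). The basis element (m, s) of [FV]       *)
(* stands for m tensor e^(s alpha/2); thus FV[[h]] is the direct sum     *)
(* F_0 + F_1, where F_i is spanned by the (m, s) with s = i mod 2.       *)
Definition heis_mon := {cmonom ('I_2 * nat)%type}.
Definition FV := {malg K[(heis_mon * int)%type]}.

Definition weight := 'rV[rat]_2.
Definition eps (j : 'I_2) : weight := delta_mx 0 j.
Definition form (b m : weight) : rat := (b *m m^T) 0 0.
Definition alpha : weight := eps j1 - eps j2.
Definition wt (s : int) : weight := (s%:~R / 2) *: alpha.

Definition lin_ext (phi : heis_mon * int -> FV) (v : FV) : FV :=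
  \sum_(b <- msupp v) v@_b *: phi b.

(* a_j(n), n <> 0. On a monomial m, the commutator [a_j(r), m] with      *)
(* r > 0 is r times the derivative of m with respect to a_j(-r).         *)
Definition heis (j : 'I_2) (n : int) : FV -> FV :=
  lin_ext (fun b =>
    match n with
    | Negz r => << (mulcm b.1 (ucm (j, r)), b.2) >>
    | Posz r => << (r * b.1 (j, r.-1))%:R *g (divcm b.1 (ucm (j, r.-1)), b.2) >>
    end).

(* e^(s alpha/2) *)
Definition ewt (s : int) : FV -> FV := lin_ext (fun b => << (b.1, b.2 + s) >>).

(* g(partial_beta) *)
Definition dfun (beta : weight) (g : rat -> K) : FV -> FV :=
  lin_ext (fun b => << g (form beta (wt b.2)) *g b >>).

Notation fldF := (fld FV).

Definition fconst (A : FV -> FV) : fldF :=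
  fun n k v => if (n == 0) && (k == 0)%N then A v else 0.

(* u^(partial_beta), on weights mu with (beta, mu) an integer *)
Definition upartial (beta : weight) : fldF := fun n k v =>
  if k is 0%N then dfun beta (fun x => (x == n%:~R)%:R) v else 0.

(* (1 + a h/u)^(e partial_(alpha/2)) *)
Definition opartial (a : K) (e : int) : fldF := fun n k =>
  dfun (2^-1 *: alpha) (fun x => onepow a (e%:~R * ratr x) n k).

Definition Eminus : fldF := fexp (fun n k v =>
  \sum_(r \in [set r : nat | (0 < r)%N])
    (- (upow (- (3 / 4)) r n k / r%:R) *: heis j1 (- r%:Z) v
     + (upow (4^-1) r n k / r%:R) *: heis j2 (- r%:Z) v)).

Definition Eplus : fldF := fexp (fun n k v =>
  \sum_(r \in [set r : nat | (0 < r)%N])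
    (upow (4^-1) (- r%:Z) n k / r%:R) *: (heis j1 r v - heis j2 r v)).

Definition calE : fldF := fmul (finv (fev0 Eminus)) Eminus.

(* The half-integral powers u^p (u + h)^p, with p = (alpha/2, mu), are   *)
(* written u^(2p) (1 + h/u)^p, where 2p = (alpha, mu) is an integer.     *)
Definition Xalpha : fldF :=
  fmul calE (fmul Eplus (fmul (fconst (ewt 2))
    (fmul (upartial alpha) (opartial 1 1)))).

Definition Xmalpha : fldF :=
  fmul (finv (sh 2^-1 calE)) (fmul (finv (sh (- 2^-1) Eplus))
    (fmul (fconst (ewt (-2)))
      (fmul (upartial (- alpha))
        (fmul (opartial (- 2^-1) (-1)) (opartial 2^-1 (-1)))))).

Definition kexp_plus (j : 'I_2) : fldF := fexp (fun n k v =>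
  - \sum_(r \in [set r : nat | (0 < r)%N])
      ((upow 2^-1 (- r%:Z) n k - upow (- 2^-1) (- r%:Z) n k) / r%:R) *: heis j r v).

(* c_1(u) = (1 + h/(4u)) / (1 + 5h/(4u)), c_2(u) = (1 + h/(4u)) / (1 - 3h/(4u)) *)
Definition k1plus : fldF :=
  fmul (kexp_plus j1) (fmul (opartial 4^-1 1) (opartial (5 / 4) (-1))).
Definition k2plus : fldF :=
  fmul (kexp_plus j2) (fmul (opartial 4^-1 1) (opartial (- (3 / 4)) (-1))).

Definition k1minus : fldF := fexp (fun n k v =>
  \sum_(r \in [set r : nat | (0 < r)%N])
    ((upow 1 r n k - upow 0 r n k) / r%:R) *: heis j2 (- r%:Z) v).
Definition k2minus : fldF := fexp (fun n k v =>
  \sum_(r \in [set r : nat | (0 < r)%N])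
    ((upow 0 r n k - upow (-1) r n k) / r%:R) *: heis j1 (- r%:Z) v).

Definition level_one (D : DYops FV) : Prop :=
  [/\ DYC D = @hone FV,
      fdivh (Xplus D) = Xalpha /\ fdivh (Xminus D) = Xmalpha,
      k1 D true = k1plus /\ k2 D true = k2plus
    & k1 D false = k1minus /\ k2 D false = k2minus].

(* The vector 1 tensor e^(s alpha/2). *)
Definition evec (s : int) : fock FV := hconst << (onecm _, s) >>.

(* L_i(gl_2); e^(lambda_i) is evec i, as lambda_i = i alpha/2. *)
Definition Lgl (D : DYops FV) (i : 'I_2) : set (fock FV) :=
  DY_orbit D (evec i).

Definition Xtilde : fldF := fmul Xalpha (opartial 1 (-1)).
Definition xtilde (r : int) : hop FV := Xtilde (- r - 1).

(* A sequence s = [:: r_1; ...; r_n] yields x~(r_n) ... x~(r_1) 1. *)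
Definition BW0 : set (fock FV) :=
  [set f | exists s : seq int,
     [/\ (head (-1) s <= -1)%R, sorted (fun r r' : int => (r' <= r - 2)%R) s &
         f = foldl (fun g r => happ (xtilde r) g) (evec 0) s]].

(* e^(lambda_i + m alpha) = e^((i + 2m) alpha/2) *)
Definition BLslm (i : 'I_2) (m : int) : set (fock FV) :=
  [set (fun k => ewt (i%:Z + 2 * m) (b k)) | b in BW0].

Definition BLsl (i : 'I_2) : set (fock FV) := \bigcup_(m in [set: int]) BLslm i m.

Definition BLgl (D : DYops FV) (i : 'I_2) : set (fock FV) :=
  [set happ A b | A in BH D & b in BLsl i].

End Yangian.

(* Main.v *)
From HB Require Import structures.
From mathcomp Require Import all_boot all_order all_algebra.
From mathcomp Require Import finmap boolp classical_sets functions fsbigop reals.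
From mathcomp Require Import complex monalg.
From mathcomp Require Import zify ring.
Require Import Defs.

(** Both the module and the proposed basis are understood one power of [h] at a
    time.  A series of vectors lies in [L_i] exactly when the charges of all its
    coefficients are congruent to [i] modulo two ([orbitE]).  The generators preserve
    the parity of the charge: the entries [t_11] and the quasi-determinant [k_2]
    are given, the entries [t_12] and [t_21] are recovered from the currents, whose two
    terms are told apart by the sign of the power of [u], and [t_22] from [k_2].
    Conversely, modulo [h], the generators [t_11^(-r)] and [t_22^(-r)] act by
    [a_2(-r)] and [a_1(-r)], and the extremal modes of the two currents translate the
    charge by [alpha] and [- alpha]; this reaches every vector modulo [h], and
    successive approximation does the rest.

    By [topological_basis_lift] it remains to see that the constant terms of the
    proposed elements are distinct and form a basis of the vectors of the given parity.
    The constant term of [kappa^(-r)] is [C_r = a_1(-r) + a_2(-r)] ([kappa_h0]).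
    The factor [(1 + h/u)^(- d_(alpha/2))] makes [X~(u) = W(u) e^alpha u^(d_alpha)]
    ([vXtilde_factor]), where [W = calE(u) E+(u)]; a sequence of modes with gaps at
    least two is a partition [la] shifted by a staircase, and since [calE(0) = 1] to all
    orders in [h] ([vcalE_u0]), translation by [e^alpha] is the insertion of a zero
    part ([vbeta_cons0]).  Thus the elements of the direct limit are indexed by a
    partition without zero parts and a charge.

    Modulo [h] put [calE(u) = sum_n H_n u^n]: the [H_n] are the complete symmetric
    functions in the power sums [a_2(-r) - a_1(-r)].  Moving [E+(u)] past
    [sum_n H_n w^n] produces the factor [(1 - w/u)^2] ([Eop_Hop]), so the product of
    modes indexed by [la], applied to the vacuum, is [H_la e^(n alpha)] with [n] the
    length of [la], plus a combination of [H_nu e^(n alpha)] with [nu] strictly above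
    [la] in the dominance order ([vbeta_head]).  The sum of the squares of the parts is
    strictly monotone for dominance ([sumsq_sdom]), hence the proposed elements are
    unitriangular over the vectors [C_mu H_la e^s].  The latter form a basis, because
    the [C_r] and the power sums generate the polynomial algebra freely and Newton's
    identities exchange the power sums for the [H_n] ([coordinates], [Mset_gop]). *)

Set Implicit Arguments.
Unset Strict Implicit.
Unset Printing Implicit Defensive.

Import Order.TTheory GRing.Theory Num.Theory.

Local Open Scope classical_set_scope.
Local Open Scope ring_scope.

(** * Sums of finite support and linear maps *)

Section FiniteSupportSums.
Variables (I : choiceType) (M : zmodType).

Lemma fsum_seq (s : seq I) (f : I -> M) : uniq s ->
  (forall x, x \notin s -> f x = 0) ->
  \sum_(x \in [set: I]) f x = \sum_(x <- s) f x.
Proof.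
move=> us fs; rewrite (fsbigE s) //; last by move=> x _; exact: fs.
by rewrite big_mkcond; apply: eq_bigr => x _; rewrite mem_set.
Qed.

Lemma fsum_single (D : set I) (a : I) (f : I -> M) : D a ->
  (forall x, D x -> x != a -> f x = 0) -> \sum_(x \in D) f x = f a.
Proof.
move=> Da fa; rewrite (fsbigE [:: a]) //=.
- by rewrite big_cons big_nil mem_set // addr0.
- by move=> x; rewrite /= inE => /eqP ->.
- by move=> x Dx; rewrite inE; exact: fa.
Qed.

End FiniteSupportSums.

Section LinearMaps.
Variables (K : fieldType) (V W : lmodType K).
Implicit Types f g : V -> W.

Lemma lin0 f : linear f -> f 0 = 0.
Proof. by move=> h; have := h (-1) 0 0; rewrite scaler0 add0r scaleN1r addNr. Qed.

Lemma linD f : linear f -> {morph f : u v / u + v}.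
Proof. by move=> h u v; have := h 1 u v; rewrite !scale1r. Qed.

Lemma linZ f : linear f -> forall c v, f (c *: v) = c *: f v.
Proof. by move=> h c v; have := h c v 0; rewrite !addr0 (lin0 h) addr0. Qed.

Lemma linN f : linear f -> {morph f : u / - u}.
Proof. by move=> h u; rewrite -scaleN1r (linZ h) scaleN1r. Qed.

Lemma linB f : linear f -> {morph f : u v / u - v}.
Proof. by move=> h u v; rewrite (linD h) (linN h). Qed.

Lemma lin_sum f : linear f -> forall (I : Type) (s : seq I) (P : pred I) F,
  f (\sum_(i <- s | P i) F i) = \sum_(i <- s | P i) f (F i).
Proof. by move=> h I s P F; apply: big_morph; [exact: linD | exact: lin0]. Qed.

Lemma linear_big (I : Type) (s : seq I) (P : pred I) (F : I -> V -> W) :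
  (forall i, linear (F i)) -> linear (fun v => \sum_(i <- s | P i) F i v).
Proof.
move=> h c u v; rewrite scaler_sumr -big_split /=.
by apply: eq_bigr => i _; exact: h.
Qed.

Lemma linear_scale c f : linear f -> linear (fun v => c *: f v).
Proof.
by move=> h a u v; rewrite h scalerDr !scalerA mulrC.
Qed.

Lemma linear_add f g : linear f -> linear g -> linear (fun v => f v + g v).
Proof. by move=> hf hg a u v; rewrite hf hg scalerDr addrACA. Qed.

Lemma linear_opp f : linear f -> linear (fun v => - f v).
Proof. by move=> hf a u v; rewrite hf opprD scalerN. Qed.

Lemma linear_zero : linear (fun _ : V => 0 : W).
Proof. by move=> a u v; rewrite scaler0 addr0. Qed.

(** The support may depend on the vector: the union of the supports at two vectors
    serves for all their combinations. *)
Lemma linear_fsum (I : choiceType) (F : I -> V -> W) :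
  (forall i, linear (F i)) ->
  (forall v, exists s : seq I, forall i, i \notin s -> F i v = 0) ->
  linear (fun v => \sum_(i \in [set: I]) F i v).
Proof.
move=> Fl Fs c u v; have [s hs] := Fs u; have [t ht] := Fs v.
have suppF w : (forall i, i \notin s ++ t -> F i w = 0) ->
    \sum_(i \in [set: I]) F i w = \sum_(i <- undup (s ++ t)) F i w.
  by move=> h; apply: fsum_seq => [|i]; rewrite ?undup_uniq // mem_undup; apply: h.
have hu i : i \notin s ++ t -> F i u = 0.
  by rewrite mem_cat negb_or => /andP[/hs].
have hv i : i \notin s ++ t -> F i v = 0.
  by rewrite mem_cat negb_or => /andP[_ /ht].
rewrite !suppF //.
  by rewrite (linear_big _ _ Fl).
by move=> i hi; rewrite Fl hu // hv // scaler0 addr0.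
Qed.

Lemma linear_fsum_set (I : choiceType) (D : set I) (F : I -> V -> W) :
  (forall i, linear (F i)) ->
  (forall v, exists s : seq I, forall i, D i -> i \notin s -> F i v = 0) ->
  linear (fun v => \sum_(i \in D) F i v).
Proof.
move=> Fl Fs.
have -> : (fun v => \sum_(i \in D) F i v) =
    (fun v => \sum_(i \in [set: I]) if i \in D then F i v else 0).
  by apply/funext => v; rewrite fsbig_mkcond.
apply: linear_fsum => [i|v].
  by case: (i \in D); [exact: Fl | exact: linear_zero].
have [s hs] := Fs v; exists s => i hi; case: ifP => // /set_mem Di; exact: hs.
Qed.

End LinearMaps.

Lemma linear_comp (K : fieldType) (U V W : lmodType K) (f : V -> W) (g : U -> V) :
  linear f -> linear g -> linear (fun u => f (g u)).
Proof. by move=> hf hg c u v; rewrite hg hf. Qed.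

Lemma linear_id (K : fieldType) (V : lmodType K) : linear (fun v : V => v).
Proof. by []. Qed.

(** * Operators intertwined with a fixed map *)

Section Twisted.
Variables (K : fieldType) (V : lmodType K).

(** The finite-support sums of the definitions vanish when the support is
    infinite; a map pulled through them must therefore reflect zero, or kill
    everything. *)
Definition sum_compatible (g : V -> V) : Prop :=
  linear g /\ forall (I : choiceType) (D : set I) (f : I -> V),
    g (\sum_(i \in D) f i) = \sum_(i \in D) g (f i).

Lemma sum_compatible_inj (g : V -> V) : linear g -> injective g -> sum_compatible g.
Proof.
move=> gl gi; split=> // I D f.
have supp : D `&` (g \o f) @^-1` [set~ 0] = D `&` f @^-1` [set~ 0].
  apply/seteqP; split=> i [Di /= ne]; split=> // e; apply: ne => /=.
    by rewrite e lin0.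
  by apply: gi; rewrite lin0.
case: (finite_supportP D (g \o f) 0) => [inf|X XD X0 XE].
  rewrite [RHS]big_nil fsbig_dflt ?lin0 //; rewrite -supp; exact: inf.
rewrite (fsbigE (X : seq I)) //=.
- rewrite (lin_sum gl) big_mkcond [RHS]big_seq [LHS]big_seq.
  by apply: eq_bigr => i iX; rewrite mem_set //; apply: XD.
- move=> i Di iX; apply: gi; rewrite (lin0 gl).
  by have := X0 i Di; apply; apply: contra iX.
Qed.

Lemma sum_compatible_zero : sum_compatible (fun _ => 0).
Proof. by split=> [|I D f]; [exact: linear_zero | rewrite fsbig1]. Qed.

Section Commutation.
Variables (g : V -> V) (gl : linear g).

Definition htwisted (A : hop V) : Prop := forall k v, A k (g v) = g (A k v).

Lemma htwisted_hone : htwisted (@hone K V).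
Proof. by case=> [|k] v //=; rewrite lin0. Qed.

Lemma htwisted_hcomp A B : htwisted A -> htwisted B -> htwisted (hcomp A B).
Proof.
move=> hA hB k v; rewrite /hcomp (lin_sum gl).
by apply: eq_bigr => i _; rewrite hB hA.
Qed.

Lemma htwisted_hexp A n : htwisted A -> htwisted (hexp A n).
Proof.
move=> hA; elim: n => [|n IH]; first exact: htwisted_hone.
by rewrite /hexp iterS; apply: htwisted_hcomp.
Qed.

Lemma htwisted_hscale c A : htwisted A -> htwisted (hscale c A).
Proof. by move=> hA k v; rewrite /hscale hA (linZ gl). Qed.

Lemma htwisted_happ A f : htwisted A ->
  happ A (fun k => g (f k)) = (fun k => g (happ A f k)).
Proof.
move=> hA; apply/funext => k; rewrite /happ (lin_sum gl).
by apply: eq_bigr => i _; rewrite hA.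
Qed.

End Commutation.

Section Intertwine.
Variables (g : V -> V) (gc : sum_compatible g).

Let gl : linear g. Proof. by case: gc. Qed.
Let gS : forall (I : choiceType) (D : set I) (f : I -> V),
  g (\sum_(i \in D) f i) = \sum_(i \in D) g (f i).
Proof. by case: gc. Qed.

(** The displacement [d] is there for conjugation by [e^(d alpha/2)], which multiplies
    the currents by a power of [u]. *)
Definition twisted (d : int) (A : fld V) : Prop :=
  forall n k v, A n k (g v) = g (A (n - d) k v).

Lemma twisted0P A : twisted 0 A <-> forall n, htwisted g (A n).
Proof. by split=> h n k v; rewrite h ?subr0. Qed.

Lemma twisted_fone : twisted 0 (@fone K V).
Proof.
by move=> n k v; rewrite subr0 /fone; case: eqP => _; rewrite ?(htwisted_hone gl) ?lin0.
Qed.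

Lemma twisted_fsub A B d : twisted d A -> twisted d B -> twisted d (fsub A B).
Proof. by move=> hA hB n k v; rewrite /fsub hA hB (linB gl). Qed.

Lemma twisted_fmul A B c d : twisted c A -> twisted d B -> twisted (c + d) (fmul A B).
Proof.
move=> hA hB n k v; rewrite /fmul (lin_sum gl); apply: eq_bigr => i _.
have bij : bijective (fun m : int => m + d).
  by exists (fun m => m - d) => m; rewrite ?addrK ?subrK.
rewrite gS (reindex_fsbigT _ _ bij); apply: eq_fsbigr => m _.
by rewrite hB hA addrK; congr (g (A _ _ _)); ring.
Qed.

Lemma twisted_fpow A m : twisted 0 A -> twisted 0 (fpow A m).
Proof.
move=> hA; elim: m => [|m IH]; first exact: twisted_fone.
by rewrite /fpow iterS -[0]addr0; apply: twisted_fmul.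
Qed.

Lemma twisted_fexp A : twisted 0 A -> twisted 0 (fexp A).
Proof.
move=> hA n k v; rewrite /fexp gS; apply: eq_fsbigr => m _.
by rewrite (twisted_fpow m hA) (linZ gl).
Qed.

Lemma twisted_finv A : twisted 0 A -> twisted 0 (finv A).
Proof.
move=> hA n k v; rewrite /finv gS; apply: eq_fsbigr => m _.
by rewrite (twisted_fpow m (twisted_fsub twisted_fone hA)).
Qed.

Lemma twisted_fdivh A d : twisted d A -> twisted d (fdivh A).
Proof. by move=> hA n k v; rewrite /fdivh /hdivh hA. Qed.

Lemma twisted_fev0 A : twisted 0 A -> twisted 0 (fev0 A).
Proof.
by move=> hA n k v; rewrite subr0 /fev0; case: eqP => _; rewrite ?hA ?subr0 ?lin0.
Qed.

Lemma twisted_fshift A c : twisted 0 A -> htwisted g c -> twisted 0 (fshift A c).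
Proof.
move=> /twisted0P hA hc n k v; rewrite subr0 /fshift (lin_sum gl).
apply: eq_bigr => l _; rewrite (linZ gl); congr (_ *: _).
by apply: htwisted_hcomp => //; apply: htwisted_hexp.
Qed.

Lemma twisted_sh A a : twisted 0 A -> twisted 0 (sh a A).
Proof.
move=> hA; apply: twisted_fshift => //.
by apply: (htwisted_hscale gl); exact: (htwisted_hone gl).
Qed.

End Intertwine.
End Twisted.

(** * Linear distributions and their supports *)

Definition irange (N : nat) : seq int :=
  [seq (j%:Z - N%:Z)%R | j <- iota 0 (N + N).+1].

Lemma mem_irange N (m : int) : (m \in irange N) = (`|m| <= N)%N.
Proof.
apply/mapP/idP => [[j]|hm].
  rewrite mem_iota add0n => /andP[_ hj] ->; lia.
exists `|(m + N%:Z)%R|%N; last by lia.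
by rewrite mem_iota; lia.
Qed.

Section Supports.
Variables (K : fieldType) (V : lmodType K).
Implicit Types A B C : fld V.

Definition flin A : Prop := forall n k, linear (A n k).

(** Used with [e = 1], for series in nonnegative powers of [u], and with [e = -1], for
    series in nonpositive powers. *)
Definition window (e : int) A : Prop :=
  forall n k v, (e * n < 0)%R -> A n k v = 0.

(** Vanishing below weight [r], where [u] and [h] both have weight [e].  Both
    the powers of a distribution of positive weight and the shifts by multiples
    of [h] respect this filtration, so that exponentials and geometric series
    are finite sums in each coefficient. *)
Definition hfilt (e : int) (r : nat) A : Prop :=
  forall n k v, (e * (n + k%:Z) < r%:Z)%R -> A n k v = 0.

(** Products of distributions are in general neither linear nor associative, because a
    sum of infinite support is zero by convention.  Composability of the left factors
    and local finiteness of the last one are what makes them so ([flin_fmul],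
    [fmulA]). *)
Definition composable A B : Prop := forall i j n v,
  exists s : seq int, forall m, m \notin s -> A (n - m) i (B m j v) = 0.

Definition locally_finite A : Prop := forall k v,
  exists N, forall n, (N < `|n|)%N -> A n k v = 0.

(** Operators sending [0] to [0]; finite-support sums of linear operators need
    not be linear, but they have this property. *)
Definition fzero A : Prop := forall n k, A n k 0 = 0.

Lemma flin_fzero A : flin A -> fzero A.
Proof. by move=> lA n k; rewrite lin0. Qed.

Lemma flin_fone : flin (@fone K V).
Proof.
move=> n [|k]; rewrite /fone; case: eqP => _ //=; exact: linear_zero.
Qed.

Lemma flin_fsub A B : flin A -> flin B -> flin (fsub A B).
Proof. by move=> hA hB n k; apply: linear_add => //; apply: linear_opp. Qed.

Lemma linear_hone k : linear (@hone K V k).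
Proof. by case: k => [|k] //=; exact: linear_zero. Qed.

Lemma linear_hcomp (A B : hop V) : (forall k, linear (A k)) ->
  (forall k, linear (B k)) -> forall k, linear (hcomp A B k).
Proof.
by move=> hA hB k; apply: linear_big => i; apply: linear_comp.
Qed.

Lemma linear_hexp (A : hop V) m : (forall k, linear (A k)) ->
  forall k, linear (hexp A m k).
Proof.
move=> hA; elim: m => [|m IH]; first exact: linear_hone.
by rewrite /hexp iterS; apply: linear_hcomp.
Qed.

Lemma hcomp_hone (A : hop V) : (forall k, A k 0 = 0) -> hcomp A (@hone K V) = A.
Proof.
move=> A0; apply/funext => k; apply/funext => v; rewrite /hcomp.
rewrite big_ord_recr /= subnn big1 ?add0r // => i _.
by case: (k - i)%N (subn_gt0 i k) => [|j _] /=; rewrite ?ltn_ord ?A0.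
Qed.

Lemma hone_hcomp (A : hop V) : hcomp (@hone K V) A = A.
Proof.
apply/funext => k; apply/funext => v; rewrite /hcomp.
by rewrite big_ord_recl /= subn0 big1 ?addr0.
Qed.

Lemma flin_fmul A B : flin A -> flin B -> composable A B -> flin (fmul A B).
Proof.
move=> hA hB hAB n k; apply: linear_big => i; apply: linear_fsum => [m|v].
  by apply: linear_comp.
exact: hAB.
Qed.

Lemma flin_fshift A c : flin A -> (forall k, linear (c k)) -> flin (fshift A c).
Proof.
move=> hA hc n k; apply: linear_big => l; apply: linear_scale.
by apply: linear_hcomp => //; apply: linear_hexp.
Qed.

Lemma composable_locally_finite A B :
  flin A -> locally_finite B -> composable A B.
Proof.
move=> hA hB i j n v; have [N hN] := hB j v.
by exists (irange N) => m; rewrite mem_irange -ltnNge => /hN ->; rewrite lin0.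
Qed.

Lemma composable_window e A B : e = 1 \/ e = -1 ->
  flin A -> window e A -> window e B -> composable A B.
Proof.
move=> he hA wA wB i j n v; exists (irange `|n|) => m; rewrite mem_irange => hm.
have [h|h] := ltP (e * m)%R 0%R; first by rewrite wB // lin0.
by apply: wA; case: he hm h => ->; lia.
Qed.

Lemma window_fone e : window e (@fone K V).
Proof. by move=> n k v; rewrite /fone; case: eqP => // ->; rewrite mulr0. Qed.

Lemma window_fsub e A B : window e A -> window e B -> window e (fsub A B).
Proof. by move=> hA hB n k v h; rewrite /fsub hA // hB // subr0. Qed.

Lemma window_fmul e A B : fzero A -> window e A -> window e B -> window e (fmul A B).
Proof.
move=> zA hA hB n k v h; rewrite /fmul big1 // => i _; apply: fsbig1 => m _.
have [hm|hm] := ltP (e * m)%R 0%R; first by rewrite hB // zA.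
by apply: hA; rewrite mulrBr; lia.
Qed.

Lemma hfilt_fone e : hfilt e 0 (@fone K V).
Proof.
move=> n [|k] v; rewrite /fone; case: eqP => // ->; first by rewrite mulr0.
Qed.

Lemma hfilt_fmul e r s A B : flin A ->
  hfilt e r A -> hfilt e s B -> hfilt e (r + s) (fmul A B).
Proof.
move=> lA hA hB n k v h; rewrite /fmul big1 // => i _; apply: fsbig1 => m _.
have [hm|hm] := ltP (e * (m + (k - i)%N%:Z))%R s%:Z; first by rewrite hB // lin0.
apply: hA; have hi : (i <= k)%N by rewrite -ltnS.
have E : (n - m + i%:Z = (n + k%:Z) - (m + (k - i)%N%:Z))%R by lia.
by rewrite E mulrBr; lia.
Qed.

Lemma fpowS A m : fpow A m.+1 = fmul A (fpow A m).
Proof. by []. Qed.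

Lemma fpow0 A : fpow A 0 = @fone K V.
Proof. by []. Qed.

Lemma fmul_fone A : flin A -> fmul A (@fone K V) = A.
Proof.
move=> lA; apply/funext => n; apply/funext => k; apply/funext => v.
rewrite /fmul big_ord_recr /= subnn big1 ?add0r; last first.
  move=> i _; apply: fsbig1 => m _; rewrite /fone; case: eqP => _; last exact: lin0.
  by case: (k - i)%N (subn_gt0 i k) => [|j _] /=; rewrite ?ltn_ord ?lin0.
rewrite (@fsum_single _ _ _ 0) //= ?subr0 // => m _ /negbTE m0.
by rewrite /fone m0 lin0.
Qed.

(** A common form of the exponential and the geometric series. *)
Definition fseries A (a : nat -> K) : fld V := fun n k v =>
  \sum_(m \in [set: nat]) a m *: fpow A m n k v.

Lemma window_fpow e A m : fzero A -> window e A -> window e (fpow A m).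
Proof. by move=> zA wA; elim: m => [|m IH]; [exact: window_fone | exact: window_fmul]. Qed.

Lemma window_fseries e A a : fzero A -> window e A -> window e (fseries A a).
Proof.
by move=> zA wA n k v h; apply: fsbig1 => m _; rewrite (window_fpow m zA wA) // scaler0.
Qed.

(** The distributions whose exponential and geometric series converge
    coefficientwise: those having a weight at least one. *)
Section Nilpotent.
Variables (e : int) (A : fld V).
Hypotheses (e1 : e = 1 \/ e = -1) (lA : flin A) (wA : window e A) (hA : hfilt e 1 A).

Lemma flin_fpow m : flin (fpow A m).
Proof.
elim: m => [|m IH]; first exact: flin_fone.
by apply: flin_fmul => //; apply: (composable_window e1) => //; exact: window_fpow (flin_fzero lA) wA.
Qed.

Lemma hfilt_fpow m : hfilt e m (fpow A m).
Proof.
elim: m => [|m IH]; first exact: hfilt_fone.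
by rewrite -add1n fpowS; apply: hfilt_fmul.
Qed.

Lemma fpow_eq0 m n k v : (e * (n + k%:Z) < m%:Z)%R -> fpow A m n k v = 0.
Proof. exact: hfilt_fpow. Qed.

Lemma fseries_trunc a M n k v : (e * (n + k%:Z) < M%:Z)%R ->
  fseries A a n k v = \sum_(m < M) a m *: fpow A m n k v.
Proof.
move=> h; rewrite /fseries (@fsum_seq _ _ (iota 0 M)) ?iota_uniq //.
  by rewrite -(big_mkord xpredT (fun m => a m *: fpow A m n k v)) /index_iota subn0.
move=> m; rewrite mem_iota /= add0n => hm.
by rewrite fpow_eq0 ?scaler0 //; lia.
Qed.

Lemma flin_fseries a : flin (fseries A a).
Proof.
move=> n k; apply: linear_fsum => [m|v].
  by apply: linear_scale; apply: flin_fpow.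
exists (iota 0 `|(e * (n + k%:Z))%R|.+1) => m; rewrite mem_iota => hm.
by rewrite fpow_eq0 ?scaler0 //; lia.
Qed.

Lemma fseries_const a n k v : (e * (n + k%:Z) < 1)%R ->
  fseries A a n k v = a 0 *: fone n k v.
Proof. by move=> h; rewrite (@fseries_trunc _ 1) // big_ord1. Qed.

End Nilpotent.

Lemma fexpE A : fexp A = fseries A (fun m => m`!%:R^-1).
Proof. by []. Qed.

Lemma finvE A : finv A = fseries (fsub (@fone K V) A) (fun=> 1).
Proof.
apply/funext => n; apply/funext => k; apply/funext => v; rewrite /finv /fseries.
by apply: eq_fsbigr => m _; rewrite scale1r.
Qed.

End Supports.

Lemma uniform_bound (T : eqType) (s : seq T) (P : T -> nat -> Prop) :
  (forall x N M, (N <= M)%N -> P x N -> P x M) ->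
  (forall x, exists N, P x N) -> exists N, forall x, x \in s -> P x N.
Proof.
move=> Pm Pe; elim: s => [|x s [N hN]]; first by exists 0.
have [M hM] := Pe x; exists (maxn N M) => y.
rewrite inE => /predU1P[->|ys].
  by apply: Pm hM; rewrite leq_maxr.
by apply: Pm (hN y ys); rewrite leq_maxl.
Qed.

Section SumExchange.
Variables (I : choiceType) (M : zmodType).

Lemma fsumD (f g : I -> M) :
  (exists s : seq I, forall x, x \notin s -> f x = 0) ->
  (exists s : seq I, forall x, x \notin s -> g x = 0) ->
  \sum_(x \in [set: I]) (f x + g x) =
  \sum_(x \in [set: I]) f x + \sum_(x \in [set: I]) g x.
Proof.
move=> [s hs] [t ht].
have hs' x : x \notin undup (s ++ t) -> f x = 0.
  by rewrite mem_undup mem_cat negb_or => /andP[/hs].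
have ht' x : x \notin undup (s ++ t) -> g x = 0.
  by rewrite mem_undup mem_cat negb_or => /andP[_ /ht].
rewrite !(fsum_seq (undup_uniq (s ++ t))) ?big_split // => x hx.
by rewrite hs' // ht' // addr0.
Qed.

Lemma exchange_fsum_seq (J : Type) (s : seq J) (F : J -> I -> M) :
  (forall j, exists t : seq I, forall x, x \notin t -> F j x = 0) ->
  \sum_(x \in [set: I]) \sum_(j <- s) F j x =
  \sum_(j <- s) \sum_(x \in [set: I]) F j x.
Proof.
move=> hF; elim: s => [|j s IH].
  by rewrite big_nil; under eq_fsbigr do rewrite big_nil; exact: fsbig1.
rewrite big_cons -IH -fsumD //; first by under eq_fsbigr do rewrite big_cons.
elim: s {IH} => [|l s [t ht]]; first by exists [::] => x _; rewrite big_nil.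
have [t' ht'] := hF l; exists (t ++ t') => x.
by rewrite mem_cat negb_or => /andP[/ht h /ht' h']; rewrite big_cons h h' addr0.
Qed.

End SumExchange.

Lemma triangle_sum (M : zmodType) k (F : nat -> nat -> M) :
  \sum_(i < k.+1) \sum_(j < (k - i).+1) F i j =
  \sum_(l < k.+1) \sum_(i < l.+1) F i (l - i)%N.
Proof.
elim: k => [|k IH]; first by rewrite !big_ord1.
rewrite [RHS]big_ord_recr -IH /= big_ord_recr /= subnn big_ord1.
rewrite [X in _ = _ + X]big_ord_recr /= subnn addrA; congr (_ + _).
rewrite -big_split /=; apply: eq_bigr => i _.
by rewrite subSn ?big_ord_recr // -ltnS.
Qed.

Section ConvolutionAlgebra.
Variables (K : fieldType) (V : lmodType K).
Implicit Types A B C : fld V.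

Lemma hcompA (P Q R : hop V) : (forall k, linear (P k)) ->
  hcomp P (hcomp Q R) = hcomp (hcomp P Q) R.
Proof.
move=> lP; apply/funext => k; apply/funext => v; rewrite /hcomp.
under eq_bigr do rewrite (lin_sum (lP _)).
rewrite (triangle_sum _ (fun i j => P i (Q j (R (k - i - j)%N v)))).
apply: eq_bigr => l _; apply: eq_bigr => i _.
by rewrite -subnDA subnKC // -ltnS.
Qed.

Lemma hexpS (P : hop V) m : hexp P m.+1 = hcomp P (hexp P m).
Proof. by []. Qed.

Lemma hexpSr (P : hop V) m : (forall k, linear (P k)) ->
  hexp P m.+1 = hcomp (hexp P m) P.
Proof.
move=> lP; elim: m => [|m IH].
  by rewrite hexpS hone_hcomp hcomp_hone // => k; rewrite lin0.
by rewrite hexpS [in LHS]IH hcompA // -hexpS.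
Qed.

(** The inner sum is finite because [C] is locally finite, so it may be pulled
    out of [A]; the remaining sum over the middle index is then finite for each
    power of [u] in [C] by composability of [A] and [B]. *)
Lemma fmulA A B C : flin A -> flin B -> composable A B -> locally_finite C ->
  fmul A (fmul B C) = fmul (fmul A B) C.
Proof.
move=> lA lB cAB fC; apply/funext => n; apply/funext => k; apply/funext => v.
have [N hN] : exists N, forall j, j \in iota 0 k.+1 ->
    forall p, (N < `|p|)%N -> C p j v = 0.
  apply: uniform_bound => [j N M NM h p hp|j]; last exact: fC.
  by apply: h; apply: leq_ltn_trans NM hp.
have sumC j (F : int -> V -> V) : (j <= k)%N -> (forall p, F p 0 = 0) ->
    \sum_(p \in [set: int]) F p (C p j v) = \sum_(p <- undup (irange N)) F p (C p j v).
  move=> jk F0; apply: fsum_seq => [|p]; rewrite ?undup_uniq // mem_undup.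
  by rewrite mem_irange -ltnNge => hp; rewrite (hN j) ?F0 // mem_iota add0n.
have fin i j (p : int) w : exists t : seq int,
    forall m, m \notin t -> A (n - m) i (B (m - p) j w) = 0.
  have [t ht] := cAB i j (n - p) w; exists [seq m + p | m <- t] => m hm.
  have -> : n - m = n - p - (m - p) by ring.
  apply: ht; apply: contra hm => hm; apply/mapP; exists (m - p) => //.
  by rewrite subrK.
pose G i j r p := \sum_(m \in [set: int]) A (n - m) i (B (m - p) j (C p r v)).
transitivity (\sum_(i < k.+1) \sum_(j < (k - i).+1)
    \sum_(p <- undup (irange N)) G i j (k - i - j)%N p).
  apply: eq_bigr => i _; rewrite /fmul.
  transitivity (\sum_(m \in [set: int]) \sum_(j < (k - i).+1)
      \sum_(p <- undup (irange N)) A (n - m) i (B (m - p) j (C p (k - i - j)%N v))).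
    apply: eq_fsbigr => m _; rewrite (lin_sum (lA _ _)); apply: eq_bigr => j _.
    rewrite (sumC _ (fun p => B (m - p) j)); last by move=> p; rewrite lin0.
      by rewrite (lin_sum (lA _ _)).
    lia.
  rewrite exchange_fsum_seq; last first.
    move=> j; elim: (undup _) => [|p s [t ht]].
      by exists [::] => x _; rewrite big_nil.
    have [t' ht'] := fin i j p (C p (k - i - j)%N v); exists (t ++ t') => x.
    by rewrite mem_cat negb_or big_cons => /andP[/ht -> /ht' ->]; rewrite addr0.
  by apply: eq_bigr => j _; rewrite exchange_fsum_seq.
rewrite (triangle_sum _ (fun i j => \sum_(p <- undup (irange N)) G i j (k - i - j)%N p)).
rewrite [RHS]/fmul; apply: eq_bigr => l _; rewrite (sumC _ (fun p => fmul A B (n - p) l)).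
- rewrite exchange_big; apply: eq_bigr => p _; apply: eq_bigr => i _ /=.
  have bij : bijective (fun m : int => m + p).
    by exists (fun m => m - p) => m; rewrite ?addrK ?subrK.
  rewrite /G (reindex_fsbigT _ _ bij); apply: eq_fsbigr => m _.
  rewrite addrK; congr (A _ _ (B _ _ (C _ _ _))); first by ring.
  by rewrite -subnDA subnKC // -ltnS.
- by rewrite leq_subr.
- move=> p; rewrite /fmul big1 // => i _; apply: fsbig1 => m _.
  by rewrite !lin0.
Qed.

Lemma locally_finite_fmul A B : flin A -> locally_finite A -> locally_finite B ->
  locally_finite (fmul A B).
Proof.
move=> lA fA fB k v.
have [N hN] : exists N, forall j, j \in iota 0 k.+1 ->
    forall p, (N < `|p|)%N -> B p j v = 0.
  apply: uniform_bound => [j N M NM h p hp|j]; last exact: fB.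
  by apply: h; apply: leq_ltn_trans NM hp.
have [M hM] : exists M, forall x, x \in [seq (i, m) | i <- iota 0 k.+1, m <- irange N] ->
    forall n, (M < `|n|)%N -> A n x.1 (B x.2 (k - x.1)%N v) = 0.
  apply: uniform_bound => [x P Q PQ h n hn|x]; last exact: fA.
  by apply: h; apply: leq_ltn_trans PQ hn.
exists (N + M)%N => n hn; rewrite /fmul big1 // => i _; apply: fsbig1 => m _.
have [hm|hm] := ltnP N `|m|; first by rewrite hN ?lin0 // mem_iota; lia.
apply: (hM (i : nat, m)); last by rewrite /=; lia.
apply/allpairsPdep; exists (i : nat), m; split=> //.
  by rewrite mem_iota add0n ltn_ord.
by rewrite mem_irange.
Qed.

(** The coefficient of [h^0], as a power series in [u^e]. *)
Definition slice (e : int) A : hop V := fun n => A (e * n%:Z) 0.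

Lemma fmul0E A B n v : fmul A B n 0 v = \sum_(m \in [set: int]) A (n - m) 0 (B m 0 v).
Proof. by rewrite /fmul big_ord1. Qed.

Lemma slice_fone (e : int) : e = 1 \/ e = -1 -> slice e (@fone K V) = @hone K V.
Proof.
move=> he; apply/funext => n; apply/funext => v; rewrite /slice /fone.
by case: he => ->; case: n.
Qed.

Lemma slice_fmul (e : int) A B : e = 1 \/ e = -1 -> flin A -> window e A -> window e B ->
  slice e (fmul A B) = hcomp (slice e A) (slice e B).
Proof.
move=> he lA wA wB; apply/funext => n; apply/funext => v.
have ee : e * e = 1 by case: he => ->.
rewrite /slice fmul0E (@fsum_seq _ _ [seq e * (n - i)%N%:Z | i <- iota 0 n.+1]).
- rewrite big_map -[iota 0 n.+1]/(index_iota 0 n.+1) big_mkord; apply: eq_bigr => i _.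
  by congr (A _ 0 _); have := ltn_ord i; rewrite -mulrBr => hi; congr (_ * _); lia.
- rewrite map_inj_in_uniq ?iota_uniq // => i j; rewrite !mem_iota => hi hj.
  by case: he => ->; lia.
- move=> m hm; have [h|h] := ltP (e * m) 0; first by rewrite wB // lin0.
  apply: wA; rewrite mulrBr mulrA ee mul1r ltNge; apply/negP => h'; case/mapP: hm.
  exists (n - `|(e * m)%R|)%N; first by rewrite mem_iota; lia.
  have -> : (n - (n - `|(e * m)%R|))%N%:Z = e * m by lia.
  by rewrite mulrA ee mul1r.
Qed.

Lemma slice_fpow (e : int) A m : e = 1 \/ e = -1 -> flin A -> window e A ->
  slice e (fpow A m) = hexp (slice e A) m.
Proof.
move=> he lA wA; elim: m => [|m IH]; first exact: slice_fone.
by rewrite fpowS hexpS slice_fmul // ?IH //; exact: window_fpow (flin_fzero lA) wA.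
Qed.

Lemma gbin0 (x : K) : gbin x 0 = 1.
Proof. by rewrite /gbin big_ord0 fact0 divr1. Qed.

Lemma gbin_small (n l : nat) : (n < l)%N -> gbin (n%:~R : K) l = 0.
Proof.
move=> nl; rewrite /gbin (bigD1 (Ordinal nl)) //= -pmulrn subrr mul0r mul0r //.
Qed.

Lemma fshift0 A c n v : flin A -> fshift A c n 0 v = A n 0 v.
Proof.
move=> lA; rewrite /fshift big_ord1 gbin0 scale1r addr0 subn0.
by rewrite hcomp_hone // => k; rewrite lin0.
Qed.

Lemma window_fshift A c : window 1 A -> window 1 (fshift A c).
Proof.
move=> wA n k v; rewrite mul1r => n0; rewrite /fshift big1 // => l _.
have [h|h] := ltP (n + l%:Z) 0.
  rewrite /hcomp big1 ?scaler0 // => i _.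
  by rewrite wA // mul1r.
have [p hp] : exists p : nat, n + l%:Z = p%:Z by exists `|(n + l%:Z)%R|%N; lia.
by rewrite hp gbin_small ?scale0r //; lia.
Qed.

(** On the side of the negative powers of [u] a substitution by a multiple of
    [h] only moves towards more negative powers. *)
Lemma fshift_lt A c a : (forall n k v, a <= n -> A n k v = 0) ->
  forall n k v, a <= n -> fshift A c n k v = 0.
Proof.
move=> hA n k v an; rewrite /fshift big1 // => l _.
by rewrite /hcomp big1 ?scaler0 // => i _; rewrite hA //; lia.
Qed.

End ConvolutionAlgebra.

(** * Exponentials of power series of operators *)

Section PowerSeriesExponential.
Variables (K : numFieldType) (V : lmodType K).
Implicit Types (A P Q : hop V) (g : V -> V).

Definition hser_exp A : hop V := fun n v =>
  \sum_(m < n.+1) (m`!%:R)^-1 *: hexp A m n v.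

Lemma slice_fexp (e : int) (A : fld V) : e = 1 \/ e = -1 ->
  flin A -> window e A -> hfilt e 1 A -> slice e (fexp A) = hser_exp (slice e A).
Proof.
move=> he lA wA hA; apply/funext => n; apply/funext => v.
rewrite /slice fexpE (@fseries_trunc _ _ _ _ he lA hA _ n.+1); last first.
  by case: he => ->; lia.
by apply: eq_bigr => m _; rewrite -(slice_fpow _ he lA wA).
Qed.

(** The derivation [u d/du] of power series. *)
Definition hder P : hop V := fun n v => n%:R *: P n v.

Lemma linear_hder P : (forall k, linear (P k)) -> forall k, linear (hder P k).
Proof. by move=> lP k; apply: linear_scale. Qed.

Lemma hder_hcomp P Q n v : (forall k, linear (P k)) ->
  hder (hcomp P Q) n v = hcomp (hder P) Q n v + hcomp P (hder Q) n v.
Proof.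
move=> lP; rewrite /hder /hcomp scaler_sumr -big_split; apply: eq_bigr => i _ /=.
rewrite (linZ (lP i)) -scalerDl -natrD subnKC //; exact: (ltn_ord i).
Qed.

Section Exponent.
Variables (A : hop V) (lA : forall k, linear (A k)) (A0 : forall v, A 0 v = 0).

Lemma hexp_small m n v : (n < m)%N -> hexp A m n v = 0.
Proof.
elim: m n v => // m IH n v nm; rewrite hexpS /hcomp big1 // => -[[|i] hi] _ /=.
  exact: A0.
by rewrite IH ?lin0 //; lia.
Qed.

Lemma hser_exp_trunc M n v : (n < M)%N ->
  hser_exp A n v = \sum_(m < M) (m`!%:R)^-1 *: hexp A m n v.
Proof.
move=> nM; rewrite /hser_exp (big_ord_widen M (fun m => (m`!%:R)^-1 *: hexp A m n v)) //.
rewrite big_mkcond; apply: eq_bigr => m _.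
by case: leqP => // h; rewrite hexp_small ?scaler0.
Qed.

Lemma hser_exp0 v : hser_exp A 0 v = v.
Proof. by rewrite /hser_exp big_ord1 fact0 invr1 scale1r. Qed.

Lemma htwisted_hser_exp g : linear g -> htwisted g A -> htwisted g (hser_exp A).
Proof.
move=> gl gA n v; rewrite /hser_exp (lin_sum gl); apply: eq_bigr => m _.
by rewrite (htwisted_hexp gl _ gA) (linZ gl).
Qed.

Section Newton.
Hypothesis A_comm : forall i j v, A i (A j v) = A j (A i v).

Lemma hcomp_hder_comm : hcomp A (hder A) = hcomp (hder A) A.
Proof.
apply/funext => n; apply/funext => v; rewrite /hcomp /hder.
rewrite [RHS](reindex_inj rev_ord_inj) /=; apply: eq_bigr => i _.
rewrite (linZ (lA i)) subSS A_comm subKn //; exact: (ltn_ord i).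
Qed.

Lemma hder_hexp m n v :
  hder (hexp A m.+1) n v = m.+1%:R *: hcomp (hder A) (hexp A m) n v.
Proof.
elim: m n v => [|m IH] n v.
  rewrite hexpS hcomp_hone; last by move=> k; rewrite lin0.
  by rewrite scale1r hcomp_hone // => k; rewrite /hder lin0 // scaler0.
rewrite hexpS hder_hcomp // -[X in X%:R]add1n natrD scalerDl scale1r; congr (_ + _).
transitivity (m.+1%:R *: hcomp A (hcomp (hder A) (hexp A m)) n v).
  rewrite /hcomp scaler_sumr; apply: eq_bigr => i _.
  by rewrite IH (linZ (lA i)).
rewrite hcompA // hcomp_hder_comm -hcompA //; exact: linear_hder.
Qed.

(** Newton's identities: the logarithmic derivative of [exp A] is [A']. *)
Lemma hser_exp_newton n v : n%:R *: hser_exp A n v =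
  \sum_(r < n.+1) r%:R *: A r (hser_exp A (n - r)%N v).
Proof.
rewrite (@hser_exp_trunc n.+2) // scaler_sumr big_ord_recl /=.
have -> : n%:R *: ((0`!%:R)^-1 *: @hone K V n v) = 0.
  by case: n => [|n] /=; rewrite ?scale0r // !scaler0.
rewrite add0r; transitivity (\sum_(m < n.+1) (m`!%:R)^-1 *: hcomp (hder A) (hexp A m) n v).
  apply: eq_bigr => m _; rewrite /bump /= add1n scalerA mulrC -scalerA.
  rewrite -/(hder (hexp A m.+1) n v) hder_hexp scalerA; congr (_ *: _).
  by rewrite factS natrM invfM mulrAC mulVf ?mul1r // pnatr_eq0.
transitivity (\sum_(m < n.+1) \sum_(r < n.+1)
    (m`!%:R)^-1 *: hder A r (hexp A m (n - r)%N v)).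
  by apply: eq_bigr => m _; rewrite /hcomp scaler_sumr.
rewrite exchange_big; apply: eq_bigr => r _ /=.
rewrite (@hser_exp_trunc n.+1 (n - r)%N) ?ltnS ?leq_subr // (lin_sum (lA r)) scaler_sumr.
by apply: eq_bigr => m _; rewrite /hder (linZ (lA r)) !scalerA mulrC.
Qed.

End Newton.

(** Commuting [a] through the powers of [A] is a derivation, since the commutators
    of the coefficients of [A] with [a] are scalars; on the exponential it becomes
    multiplication by the series of these scalars. *)
Lemma hser_exp_translate (a : V -> V) (c : nat -> K) : linear a -> c 0 = 0 ->
  (forall r v, A r (a v) = a (A r v) + c r *: v) ->
  forall n v, hser_exp A n (a v) =
    a (hser_exp A n v) + \sum_(r < n.+1) c r *: hser_exp A (n - r)%N v.
Proof.
move=> la c0 comm.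
pose C : hop V := fun r v => c r *: v.
have lC k : linear (C k) by apply: linear_scale; exact: linear_id.
have comC P : (forall k, linear (P k)) -> hcomp P C = hcomp C P.
  move=> lP; apply/funext => n; apply/funext => v; rewrite /hcomp.
  rewrite [RHS](reindex_inj rev_ord_inj) /=; apply: eq_bigr => i _.
  rewrite /C (linZ (lP i)) subSS subKn //; exact: (ltn_ord i).
have hexp_comm m : forall n v, hexp A m.+1 n (a v) =
    a (hexp A m.+1 n v) + m.+1%:R *: hcomp (hexp A m) C n v.
  elim: m => [|m IH] n v.
    rewrite hexpS hcomp_hone ?comm; last by move=> k; rewrite lin0.
    by rewrite hone_hcomp scale1r.
  rewrite hexpS {1}/hcomp; under eq_bigr do rewrite IH (linD (lA _)) comm (linZ (lA _)).
  rewrite !big_split /= -scaler_sumr -/(hcomp A (hcomp (hexp A m) C) n v).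
  rewrite hcompA // -hexpS /hcomp (lin_sum la) -addrA; congr (_ + _).
  rewrite -[in RHS]add1n natrD scalerDl scale1r; congr (_ + _).
  by rewrite -/(hcomp C (hexp A m.+1) n v) -comC //; apply: linear_hexp.
move=> n v; rewrite (@hser_exp_trunc n.+2) // [in RHS](@hser_exp_trunc n.+2) //.
rewrite (lin_sum la) !(big_ord_recl n.+1) -addrA.
have -> : hexp A (@ord0 n.+1) n (a v) = a (hexp A (@ord0 n.+1) n v) by case: n => //= n; rewrite lin0.
rewrite (linZ la); congr (_ + _).
have -> : \sum_(r < n.+1) c r *: hser_exp A (n - r)%N v =
    \sum_(m < n.+1) (m`!%:R)^-1 *: hcomp (hexp A m) C n v.
  transitivity (\sum_(r < n.+1) \sum_(m < n.+1)
      c r *: ((m`!%:R)^-1 *: hexp A m (n - r)%N v)).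
    apply: eq_bigr => r _; rewrite (@hser_exp_trunc n.+1) ?ltnS ?leq_subr //.
    by rewrite scaler_sumr.
  rewrite exchange_big; apply: eq_bigr => m _; rewrite comC; last exact: linear_hexp.
  by rewrite /hcomp scaler_sumr; apply: eq_bigr => r _; rewrite /C !scalerA mulrC.
rewrite -big_split; apply: eq_bigr => m _; rewrite lift0 hexp_comm.
rewrite scalerDr (linZ la); congr (_ + _); rewrite scalerA; congr (_ *: _).
by rewrite factS natrM invfM mulrAC mulVf ?mul1r // pnatr_eq0.
Qed.

End Exponent.
End PowerSeriesExponential.

(** * The Fock space over a basis *)

Section LinearExtension.
Variables (K : fieldType) (T : choiceType) (W : lmodType K).
Implicit Types (phi : T -> W) (v : {malg K[T]}).

Definition mlin phi v : W := \sum_(b <- msupp v) v@_b *: phi b.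

Lemma mlinEw phi v (d : {fset T}) : {subset msupp v <= d} ->
  mlin phi v = \sum_(b <- d) v@_b *: phi b.
Proof.
move=> /fsubsetP le; rewrite /mlin (big_fset_incl _ le) // => b _.
by rewrite -mcoeff_neq0 negbK => /eqP ->; rewrite scale0r.
Qed.

Lemma linear_mlin phi : linear (mlin phi).
Proof.
move=> c u v; pose d := (msupp u `|` msupp v `|` msupp (c *: u + v))%fset.
rewrite !(@mlinEw _ _ d); try by move=> b bv; rewrite !inE bv ?orbT.
rewrite scaler_sumr -big_split /=; apply: eq_bigr => b _.
by rewrite mcoeffD mcoeffZ scalerDl scalerA.
Qed.

Lemma mlinU phi c b : mlin phi << c *g b >> = c *: phi b.
Proof.
rewrite (@mlinEw _ _ [fset b]%fset).
  by rewrite big_seq_fset1 mcoeffUU.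
by apply/fsubsetP; exact: msuppU_le.
Qed.

Lemma monalgUZ (c : K) (b : T) : << c *g b >> = c *: << b >> :> {malg K[T]}.
Proof. by apply/malgP => x; rewrite mcoeffZ !mcoeffU mulrnAr mulr1. Qed.

Lemma malg_basisE v : v = \sum_(b <- msupp v) v@_b *: << b >>.
Proof.
rewrite {1}[v]monalgE; apply: eq_bigr => b _; exact: monalgUZ.
Qed.

Lemma linear_ext (f g : {malg K[T]} -> W) : linear f -> linear g ->
  (forall b, f << b >> = g << b >>) -> forall v, f v = g v.
Proof.
move=> lf lg fg v; rewrite [v]malg_basisE (lin_sum lf) (lin_sum lg).
by apply: eq_bigr => b _; rewrite (linZ lf) (linZ lg) fg.
Qed.

Lemma malg_span (P : {malg K[T]} -> Prop) v :
  P 0 -> (forall c u w, P u -> P w -> P (c *: u + w)) ->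
  (forall b, b \in msupp v -> P << b >>) -> P v.
Proof.
move=> P0 PD Pb; rewrite [v]malg_basisE big_seq.
elim/big_rec: _ => // b u bv Pu; apply: PD => //; exact: Pb.
Qed.

End LinearExtension.

(** The Fock space, presented by its basis [fvec m s] of vectors
    [m (x) e^(s alpha/2)] and by the action of the basic operators on it.  Arguing from
    such a presentation keeps every computation at the level of basis vectors. *)
Record fock_rep (K : numFieldType) (V : lmodType K) := FockRep {
  fvec : heis_mon -> int -> V;
  fvec_span : forall P : V -> Prop, P 0 ->
    (forall c u w, P u -> P w -> P (c *: u + w)) ->
    (forall m s, P (fvec m s)) -> forall v, P v;
  fvec_free : forall (W : lmodType K) (f : heis_mon -> int -> W),
    exists2 phi : V -> W, linear phi & forall m s, phi (fvec m s) = f m s;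
  heisen : 'I_2 -> int -> V -> V;
  linear_heisen : forall j n, linear (heisen j n);
  heisen_negU : forall j r m s,
    heisen j (Negz r) (fvec m s) = fvec (mulcm m (ucm (j, r))) s;
  heisen_posU : forall j (r : nat) m s, heisen j r (fvec m s) =
    (r * m (j, r.-1))%:R *: fvec (divcm m (ucm (j, r.-1))) s;
  shift : int -> V -> V;
  linear_shift : forall s, linear (shift s);
  shiftU : forall s m t, shift s (fvec m t) = fvec m (t + s);
  chfun : weight -> (rat -> K) -> V -> V;
  linear_chfun : forall b g, linear (chfun b g);
  chfunU : forall b g m s, chfun b g (fvec m s) = g (form b (wt s)) *: fvec m s
}.

Section FockSpace.
Variables (K : numFieldType) (V : lmodType K) (F : fock_rep V).
Implicit Types (v : V) (m : heis_mon) (s : int).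

Notation fvec := (fvec F).
Notation heisen := (heisen F).
Notation shift := (shift F).
Notation chfun := (chfun F).
Notation a_neg j r := (heisen j (Negz r)).

Lemma fvec_ext (W : lmodType K) (f g : V -> W) : linear f -> linear g ->
  (forall m s, f (fvec m s) = g (fvec m s)) -> forall v, f v = g v.
Proof.
move=> lf lg fg; apply: fvec_span => [|c u w hu hw|//]; first by rewrite !lin0.
by rewrite lf lg hu hw.
Qed.

Lemma shiftD s t v : shift s (shift t v) = shift (t + s) v.
Proof.
apply: (fvec_ext (linear_comp (linear_shift F s) (linear_shift F t)) (linear_shift F _)).
by move=> m u; rewrite !shiftU addrA.
Qed.

Lemma shift0 v : shift 0 v = v.
Proof.
apply: (fvec_ext (linear_shift F 0) (@linear_id _ _)) => m s.
by rewrite shiftU addr0.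
Qed.

Lemma shift_inj s : injective (shift s).
Proof.
by apply: (can_inj (g := shift (- s))) => v; rewrite shiftD addrN shift0.
Qed.

Lemma shift_compat s : sum_compatible (shift s).
Proof. by apply: sum_compatible_inj; [exact: linear_shift | exact: shift_inj]. Qed.

Lemma form_alpha_wt s : form alpha (wt s) = s%:~R.
Proof.
rewrite /form /wt /alpha /eps !mxE big_ord_recl big_ord1 /= !mxE /=.
by rewrite !subr0 !sub0r !mul1r !mulr1 mulN1r mulrN1 opprK -splitr.
Qed.

(** The parity of the charge; its eigenspaces are the two Fock spaces. *)
Definition parity : V -> V := chfun alpha (fun x => (-1) ^ numq x).

Lemma linear_parity : linear parity.
Proof. exact: linear_chfun. Qed.

Lemma parityU m s : parity (fvec m s) = (-1) ^ s *: fvec m s.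
Proof. by rewrite /parity chfunU form_alpha_wt numq_int. Qed.

Lemma parityK : involutive parity.
Proof.
move=> v; apply: (fvec_ext (linear_comp linear_parity linear_parity) (@linear_id _ _)).
move=> m s; rewrite parityU (linZ linear_parity) parityU scalerA.
by rewrite -expfzMl mulrNN mulr1 exp1rz scale1r.
Qed.

Lemma parity_compat : sum_compatible parity.
Proof.
by apply: sum_compatible_inj; [exact: linear_parity | exact: inv_inj parityK].
Qed.

Lemma parity_shift s v : parity (shift s v) = (-1) ^ s *: shift s (parity v).
Proof.
apply: (fvec_ext (linear_comp linear_parity (linear_shift F s))
  (linear_scale _ (linear_comp (linear_shift F s) linear_parity))) => m t.
rewrite shiftU !parityU (linZ (linear_shift F s)) shiftU scalerA -expfzDr ?oppr_eq0 ?oner_eq0 //.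
by rewrite addrC.
Qed.

Lemma heisen_diag (g : V -> V) (h : int -> K) j n : linear g ->
  (forall m s, g (fvec m s) = h s *: fvec m s) ->
  forall v, heisen j n (g v) = g (heisen j n v).
Proof.
move=> lg gU; apply: (fvec_ext (linear_comp (linear_heisen F j n) lg)
  (linear_comp lg (linear_heisen F j n))) => m s.
rewrite gU (linZ (linear_heisen F j n)); case: n => r.
  by rewrite !heisen_posU (linZ lg) gU !scalerA mulrC.
by rewrite !heisen_negU gU.
Qed.

Lemma heisen_parity j n v : heisen j n (parity v) = parity (heisen j n v).
Proof. exact: (heisen_diag (h := fun s => (-1) ^ s)) linear_parity parityU v. Qed.

Lemma heisen_shift j n s v : heisen j n (shift s v) = shift s (heisen j n v).
Proof.
apply: (fvec_ext (linear_comp (linear_heisen F j n) (linear_shift F s))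
  (linear_comp (linear_shift F s) (linear_heisen F j n))) => m t.
rewrite shiftU; case: n => r.
  by rewrite !heisen_posU (linZ (linear_shift F s)) shiftU.
by rewrite !heisen_negU shiftU.
Qed.

Lemma heisen_negC j r j' r' v : a_neg j r (a_neg j' r' v) = a_neg j' r' (a_neg j r v).
Proof.
apply: (fvec_ext (linear_comp (linear_heisen F _ _) (linear_heisen F _ _))
  (linear_comp (linear_heisen F _ _) (linear_heisen F _ _))) => m s.
by rewrite !heisen_negU -!mulcmA [mulcm (ucm _) _]mulcmC.
Qed.

Lemma divcmK m x : m x != 0%N -> mulcm (divcm m (ucm x)) (ucm x) = m.
Proof.
move=> mx; apply/eqP/cmP => y; rewrite !(divcmE, mulcmE, ucmE).
by case: eqP => [<-|] /=; rewrite ?subn0 ?addn0 // subnK // lt0n.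
Qed.

Lemma mulcmK m m' : divcm (mulcm m m') m' = m.
Proof. by apply/eqP/cmP => x; rewrite !(divcmE, mulcmE) addnK. Qed.

Lemma heisen_comm j (r : nat) j' r' v : (0 < r)%N ->
  heisen j r (a_neg j' r' v) =
  a_neg j' r' (heisen j r v) + (r * ((j', r') == (j, r.-1)))%:R *: v.
Proof.
move=> r0; apply: (fvec_ext (linear_comp (linear_heisen F _ _) (linear_heisen F _ _))
  (linear_add (linear_comp (linear_heisen F _ _) (linear_heisen F _ _))
     (linear_scale _ (@linear_id _ _)))) => m s.
rewrite heisen_negU !heisen_posU (linZ (linear_heisen F _ _)) heisen_negU mulcmE ucmE.
case: eqP => [<-|ne] /=; last first.
  rewrite muln0 scale0r addn0 addr0.
  suff -> : divcm (mulcm m (ucm (j', r'))) (ucm (j, r.-1)) =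
      mulcm (divcm m (ucm (j, r.-1))) (ucm (j', r')) by [].
  apply/eqP/cmP => x; rewrite !(divcmE, mulcmE, ucmE).
  case: eqP => [e1|]; case: eqP => [e2|] //=; rewrite ?subn0 ?addn0 //.
  by case: ne; rewrite e1 e2.
rewrite mulcmK muln1 mulnDr muln1 natrD scalerDl; congr (_ + _).
have [->|mx] := eqVneq (m (j', r')) 0%N; first by rewrite muln0 !scale0r.
by rewrite divcmK.
Qed.

Lemma heisen_vac j (r : nat) s : heisen j r (fvec (onecm _) s) = 0.
Proof. by rewrite heisen_posU onecmE muln0 scale0r. Qed.

(** The energy grading, in which [a_j(-r)] has degree [r]: it bounds how many
    annihilation operators can act on a vector, hence makes [E+(u)] locally finite. *)
Definition energy m : nat := \sum_(x <- finsupp m) m x * x.2.+1.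

Lemma energyEw m (d : {fset 'I_2 * nat}) : {subset finsupp m <= d} ->
  energy m = (\sum_(x <- d) m x * x.2.+1)%N.
Proof.
move=> /fsubsetP le; rewrite /energy (big_fset_incl _ le) //.
by move=> x _; rewrite -cmE_neq0 negbK => /eqP ->.
Qed.

Lemma energyM m m' : energy (mulcm m m') = (energy m + energy m')%N.
Proof.
pose d := (finsupp m `|` finsupp m' `|` finsupp (mulcm m m'))%fset.
rewrite !(@energyEw _ d); try by move=> x xm; rewrite !inE xm ?orbT.
by rewrite -big_split /=; apply: eq_bigr => x _; rewrite mulcmE mulnDl.
Qed.

Lemma energyU x : energy (ucm x) = x.2.+1.
Proof.
rewrite (@energyEw _ [fset x]%fset).
  by rewrite big_seq_fset1 ucmE eqxx mul1n.
by move=> y; rewrite mdomU.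
Qed.

Definition energy_lt (d : int) v : Prop := forall P : V -> Prop, P 0 ->
  (forall c u w, P u -> P w -> P (c *: u + w)) ->
  (forall m s, ((energy m)%:Z < d)%R -> P (fvec m s)) -> P v.

Lemma energy_lt0 d : energy_lt d 0.
Proof. by []. Qed.

Lemma energy_ltP d c u v : energy_lt d u -> energy_lt d v -> energy_lt d (c *: u + v).
Proof. by move=> hu hv P P0 PD Pb; exact: (PD _ _ _ (hu P P0 PD Pb) (hv P P0 PD Pb)). Qed.

Lemma energy_ltD d u v : energy_lt d u -> energy_lt d v -> energy_lt d (u + v).
Proof. by rewrite -{2}[u]scale1r; exact: energy_ltP. Qed.

Lemma energy_ltZ d c u : energy_lt d u -> energy_lt d (c *: u).
Proof. by move=> hu; rewrite -[c *: u]addr0; apply: energy_ltP. Qed.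

Lemma energy_lt_big d (I : Type) (s : seq I) (P : pred I) (G : I -> V) :
  (forall i, P i -> energy_lt d (G i)) -> energy_lt d (\sum_(i <- s | P i) G i).
Proof. by move=> h; apply: big_ind => //; exact: energy_ltD. Qed.

Lemma energy_lt_le0 d v : (d <= 0)%R -> energy_lt d v -> v = 0.
Proof.
move=> d0 hv; apply: (hv (fun v => v = 0)) => // [c u w -> ->|m s h].
  by rewrite scaler0 addr0.
by exfalso; lia.
Qed.

Lemma energy_ltU d m s : ((energy m)%:Z < d)%R -> energy_lt d (fvec m s).
Proof. by move=> h P _ _ Pb; exact: Pb. Qed.

Lemma energy_ltW d e v : (d <= e)%R -> energy_lt d v -> energy_lt e v.
Proof. by move=> de hv P P0 PD Pb; apply: (hv P) => // m s h; apply: Pb; lia. Qed.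

Lemma energy_lt_ex v : exists d : nat, energy_lt d%:Z v.
Proof.
move: v; apply: (fvec_span (f0 := F)) => [|c u w [d hd] [e he]|m s]; first by exists 0%N.
  exists (maxn d e); apply: energy_ltP; [apply: energy_ltW hd|apply: energy_ltW he]; lia.
by exists (energy m).+1; apply: energy_ltU; lia.
Qed.

Lemma energy_heisen j (r : nat) d v : (0 < r)%N ->
  energy_lt d v -> energy_lt (d - r%:Z) (heisen j r v).
Proof.
move=> r0 hv; apply: (hv (fun v => energy_lt (d - r%:Z) (heisen j r v))) => [|c u w hu hw|m s hm].
- by rewrite lin0; [exact: energy_lt0 | exact: linear_heisen].
- by rewrite (linear_heisen F j r c u w); apply: energy_ltP.
rewrite heisen_posU; have [->|mx] := eqVneq (m (j, r.-1)) 0%N.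
  by rewrite muln0 scale0r; exact: energy_lt0.
apply: energy_ltZ; apply: energy_ltU.
have := energyM (divcm m (ucm (j, r.-1))) (ucm (j, r.-1)).
rewrite divcmK // energyU /= prednK // => e.
by move: hm; rewrite e; lia.
Qed.

End FockSpace.

(** * Generalized binomial coefficients *)

Section Binomials.
Variable K : numFieldType.
Implicit Types (x y a : K).

Lemma gbinS x k : k.+1%:R * gbin x k.+1 = (x - k%:R) * gbin x k.
Proof.
rewrite /gbin big_ord_recr /= factS natrM.
have : k.+1%:R != 0 :> K by rewrite pnatr_eq0.
have : k`!%:R != 0 :> K by rewrite pnatr_eq0 -lt0n fact_gt0.
move: (k.+1%:R) (k`!%:R) => a b b0 a0; field; by rewrite b0 a0.
Qed.

Lemma gbin_vandermonde x y k :
  \sum_(i < k.+1) gbin x i * gbin y (k - i)%N = gbin (x + y) k.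
Proof.
elim: k => [|k IH]; first by rewrite big_ord1 !gbin0 mulr1.
have k1 : k.+1%:R != 0 :> K by rewrite pnatr_eq0.
apply: (mulfI k1); rewrite gbinS -IH mulr_sumr.
transitivity (\sum_(i < k.+2) ((i%:R * gbin x i) * gbin y (k.+1 - i)%N +
    gbin x i * ((k.+1 - i)%:R * gbin y (k.+1 - i)%N))).
  apply: eq_bigr => i _.
  have -> : k.+1%:R = i%:R + (k.+1 - i)%:R :> K.
    by rewrite -natrD subnKC // -ltnS.
  by ring.
rewrite big_split /= big_ord_recl /= mul0r mul0r add0r.
rewrite [X in _ + X]big_ord_recr /= subnn mul0r mulr0 addr0 -big_split /= mulr_sumr.
apply: eq_bigr => i _; rewrite /bump /= add1n gbinS subSS subSn -1?ltnS // gbinS.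
rewrite natrB -1?ltnS //; by ring.
Qed.

Lemma gbin_0S k : gbin (0 : K) k.+1 = 0.
Proof. by rewrite /gbin big_ord_recl /= subrr !mul0r. Qed.

Lemma gbin1 x : gbin x 1 = x.
Proof. by rewrite /gbin big_ord1 subr0 divr1. Qed.

Lemma upow_eq0 a (p n : int) k : n + k%:Z != p -> upow a p n k = 0.
Proof.
move=> h; rewrite /upow ifF //; apply/negbTE; apply: contra h => /eqP ->.
by rewrite subrK.
Qed.

Lemma upow_neg a (r : nat) (n : int) k : (n < 0)%R -> upow a r n k = 0.
Proof.
move=> n0; rewrite /upow; case: eqP => // nk.
by rewrite gbin_small ?mul0r //; lia.
Qed.

Lemma upow_h0 a (p n : int) : upow a p n 0 = (n == p)%:R.
Proof. by rewrite /upow subr0 gbin0 expr0 mulr1; case: eqP. Qed.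

End Binomials.

(** * Vertex operators *)

Section VertexOperators.
Variables (K : numFieldType) (V : lmodType K) (F : fock_rep V).
Implicit Types (v : V) (m : heis_mon) (s : int) (g : V -> V).

Notation heisen := (heisen F).
Notation shift := (shift F).
Notation chfun := (chfun F).
Notation parity := (parity F).
Notation fldV := (fld V).

(** The formulas of the level one action, read over an arbitrary presentation [F] of
    the Fock space. *)
Definition vconst (A : V -> V) : fldV :=
  fun n k v => if (n == 0) && (k == 0)%N then A v else 0.

Definition vupartial (beta : weight) : fldV := fun n k v =>
  if k is 0%N then chfun beta (fun x => (x == n%:~R)%:R) v else 0.

Definition vopartial (a : K) (e : int) : fldV := fun n k =>
  chfun (2^-1 *: alpha) (fun x => onepow a (e%:~R * ratr x) n k).

Lemma vupartial_h0 b n v : vupartial b n 0 v = chfun b (fun x => (x == n%:~R)%:R) v.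
Proof. by []. Qed.

Lemma vopartialE a e n k v : vopartial a e n k v =
  chfun (2^-1 *: alpha) (fun x => onepow a (e%:~R * ratr x) n k) v.
Proof. by []. Qed.

Definition vEminus_log : fldV := fun n k v =>
  \sum_(r \in [set r : nat | (0 < r)%N])
    (- (upow (- (3 / 4)) r n k / r%:R) *: heisen j1 (- r%:Z) v
     + (upow (4^-1) r n k / r%:R) *: heisen j2 (- r%:Z) v).
Definition vEminus : fldV := fexp vEminus_log.

Definition vEplus_log : fldV := fun n k v =>
  \sum_(r \in [set r : nat | (0 < r)%N])
    (upow (4^-1) (- r%:Z) n k / r%:R) *: (heisen j1 r v - heisen j2 r v).
Definition vEplus : fldV := fexp vEplus_log.

Definition vcalE : fldV := fmul (finv (fev0 vEminus)) vEminus.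

Definition vXalpha : fldV :=
  fmul vcalE (fmul vEplus (fmul (vconst (shift 2))
    (fmul (vupartial alpha) (vopartial 1 1)))).

Definition vXmalpha : fldV :=
  fmul (finv (sh 2^-1 vcalE)) (fmul (finv (sh (- 2^-1) vEplus))
    (fmul (vconst (shift (-2)))
      (fmul (vupartial (- alpha))
        (fmul (vopartial (- 2^-1) (-1)) (vopartial 2^-1 (-1)))))).

Definition vkexp_plus (j : 'I_2) : fldV := fexp (fun n k v =>
  - \sum_(r \in [set r : nat | (0 < r)%N])
      ((upow 2^-1 (- r%:Z) n k - upow (- 2^-1) (- r%:Z) n k) / r%:R) *: heisen j r v).

Definition vk1plus : fldV :=
  fmul (vkexp_plus j1) (fmul (vopartial 4^-1 1) (vopartial (5 / 4) (-1))).
Definition vk2plus : fldV :=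
  fmul (vkexp_plus j2) (fmul (vopartial 4^-1 1) (vopartial (- (3 / 4)) (-1))).

Definition vk1minus_log : fldV := fun n k v =>
  \sum_(r \in [set r : nat | (0 < r)%N])
    ((upow 1 r n k - upow 0 r n k) / r%:R) *: heisen j2 (- r%:Z) v.
Definition vk2minus_log : fldV := fun n k v =>
  \sum_(r \in [set r : nat | (0 < r)%N])
    ((upow 0 r n k - upow (-1) r n k) / r%:R) *: heisen j1 (- r%:Z) v.
Definition vk1minus : fldV := fexp vk1minus_log.
Definition vk2minus : fldV := fexp vk2minus_log.

Definition vXtilde : fldV := fmul vXalpha (vopartial 1 (-1)).

(** ** Commutation with operators of the charge *)

Section HeisenbergCentral.
Variable g : V -> V.
Hypotheses (gc : sum_compatible g)
  (gh : forall j n v, heisen j n (g v) = g (heisen j n v)).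

Let gl : linear g. Proof. by case: gc. Qed.
Let gS : forall (I : choiceType) (D : set I) (f : I -> V),
  g (\sum_(i \in D) f i) = \sum_(i \in D) g (f i).
Proof. by case: gc. Qed.

Lemma twisted_vEminus : twisted g 0 vEminus.
Proof.
apply: (twisted_fexp gc) => n k v; rewrite subr0 /vEminus_log gS.
by apply: eq_fsbigr => r _; rewrite !gh (linD gl) !(linZ gl).
Qed.

Lemma twisted_vEplus : twisted g 0 vEplus.
Proof.
apply: (twisted_fexp gc) => n k v; rewrite subr0 /vEplus_log gS.
by apply: eq_fsbigr => r _; rewrite !gh (linZ gl) (linB gl).
Qed.

Lemma twisted_vcalE : twisted g 0 vcalE.
Proof.
rewrite -[0]addr0; apply: (twisted_fmul gc); last exact: twisted_vEminus.
by apply: (twisted_finv gc); apply: (twisted_fev0 gc); exact: twisted_vEminus.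
Qed.

Lemma twisted_vkexp_plus j : twisted g 0 (vkexp_plus j).
Proof.
apply: (twisted_fexp gc) => n k v; rewrite subr0 (linN gl) gS; congr (- _).
by apply: eq_fsbigr => r _; rewrite !gh (linZ gl).
Qed.

Lemma twisted_vk1minus : twisted g 0 vk1minus.
Proof.
apply: (twisted_fexp gc) => n k v; rewrite subr0 /vk1minus_log gS.
by apply: eq_fsbigr => r _; rewrite !gh (linZ gl).
Qed.

Lemma twisted_vk2minus : twisted g 0 vk2minus.
Proof.
apply: (twisted_fexp gc) => n k v; rewrite subr0 /vk2minus_log gS.
by apply: eq_fsbigr => r _; rewrite !gh (linZ gl).
Qed.

Lemma twisted_vconst A : (forall v, A (g v) = g (A v)) -> twisted g 0 (vconst A).
Proof.
move=> hA n k v; rewrite subr0 /vconst; case: ifP => _; last by rewrite lin0.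
exact: hA.
Qed.

End HeisenbergCentral.

Lemma chfun_parity b h v : chfun b h (parity v) = parity (chfun b h v).
Proof.
move: v; apply: (fvec_ext (F := F) (linear_comp (linear_chfun F b h) (linear_parity F))
  (linear_comp (linear_parity F) (linear_chfun F b h))) => m s.
by rewrite parityU chfunU (linZ (linear_chfun F b h)) (linZ (linear_parity F))
  parityU chfunU !scalerA mulrC.
Qed.

Lemma shift_even_parity (e : int) v : shift (2 * e) (parity v) = parity (shift (2 * e) v).
Proof.
rewrite parity_shift -exprz_exp.
have -> : (-1 : K) ^ (2 : int) = 1 by rewrite -[LHS]/((-1) ^+ 2) sqrrN expr1n.
by rewrite exp1rz scale1r.
Qed.

Lemma twisted_vopartial a e : twisted parity 0 (vopartial a e).
Proof. by move=> n k v; rewrite subr0 /vopartial chfun_parity. Qed.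

Lemma twisted_vupartial b : twisted parity 0 (vupartial b).
Proof.
move=> n [|k] v; rewrite subr0 /vupartial /=; first exact: chfun_parity.
by rewrite lin0 //; exact: linear_parity.
Qed.

Let pc := parity_compat F.
Let ph := heisen_parity F.

Let twisted_fmul0 A B :
  twisted parity 0 A -> twisted parity 0 B -> twisted parity 0 (fmul A B).
Proof. by move=> hA hB; rewrite -[0]addr0; apply: (twisted_fmul pc). Qed.

Lemma twisted_vXalpha : twisted parity 0 vXalpha.
Proof.
apply: twisted_fmul0; first exact: (twisted_vcalE pc ph).
apply: twisted_fmul0; first exact: (twisted_vEplus pc ph).
apply: twisted_fmul0; last first.
  by apply: twisted_fmul0; [exact: twisted_vupartial | exact: twisted_vopartial].
by apply: (twisted_vconst pc) => v; rewrite -[2]mulr1 shift_even_parity.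
Qed.

Lemma twisted_vXmalpha : twisted parity 0 vXmalpha.
Proof.
apply: twisted_fmul0.
  by apply: (twisted_finv pc); apply: (twisted_sh pc); exact: (twisted_vcalE pc ph).
apply: twisted_fmul0.
  by apply: (twisted_finv pc); apply: (twisted_sh pc); exact: (twisted_vEplus pc ph).
apply: twisted_fmul0.
  by apply: (twisted_vconst pc) => v; rewrite -[-2]/(2 * -1 : int) shift_even_parity.
apply: twisted_fmul0; first exact: twisted_vupartial.
by apply: twisted_fmul0; exact: twisted_vopartial.
Qed.

Lemma twisted_vkplus : twisted parity 0 vk1plus /\ twisted parity 0 vk2plus.
Proof.
by split; apply: twisted_fmul0;
  [exact: (twisted_vkexp_plus pc ph) | apply: twisted_fmul0; exact: twisted_vopartial
  |exact: (twisted_vkexp_plus pc ph) | apply: twisted_fmul0; exact: twisted_vopartial].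
Qed.

Lemma twisted_vXtilde_parity : twisted parity 0 vXtilde.
Proof. by apply: twisted_fmul0; [exact: twisted_vXalpha | exact: twisted_vopartial]. Qed.

(** ** Supports and the normalization at the origin *)

Lemma flin_vEminus_log : flin vEminus_log.
Proof.
move=> n k; apply: linear_fsum_set => [r|v].
  by apply: linear_add; apply: linear_scale; exact: linear_heisen.
exists [:: `|(n + k%:Z)%R|%N] => r _; rewrite inE => hr.
by rewrite !upow_eq0 ?mul0r ?oppr0 ?scale0r ?addr0 //; lia.
Qed.

Lemma window_vEminus_log : window 1 vEminus_log.
Proof.
move=> n k v; rewrite mul1r => n0; apply: fsbig1 => r _.
by rewrite !upow_neg // mul0r oppr0 !scale0r addr0.
Qed.

Lemma hfilt_vEminus_log : hfilt 1 1 vEminus_log.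
Proof.
move=> n k v; rewrite mul1r => n0; apply: fsbig1 => r /= r0.
by rewrite !upow_eq0 ?mul0r ?oppr0 ?scale0r ?addr0 //; lia.
Qed.

Lemma flin_vEplus_log : flin vEplus_log.
Proof.
move=> n k; apply: linear_fsum_set => [r|v].
  apply: linear_scale; apply: linear_add; first exact: linear_heisen.
  by apply: linear_opp; exact: linear_heisen.
exists [:: `|(n + k%:Z)%R|%N] => r _; rewrite inE => hr.
by rewrite !upow_eq0 ?mul0r ?scale0r //; lia.
Qed.

Lemma window_vEplus_log : window (-1) vEplus_log.
Proof.
move=> n k v n0; apply: fsbig1 => r _.
by rewrite !upow_eq0 ?mul0r ?scale0r //; lia.
Qed.

Lemma hfilt_vEplus_log : hfilt (-1) 1 vEplus_log.
Proof.
move=> n k v n0; apply: fsbig1 => r /= r0.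
by rewrite !upow_eq0 ?mul0r ?scale0r //; lia.
Qed.

Let e1 : (1 : int) = 1 \/ (1 : int) = -1. Proof. by left. Qed.
Let eN1 : (-1 : int) = 1 \/ (-1 : int) = -1. Proof. by right. Qed.

Lemma flin_vEminus : flin vEminus.
Proof.
by apply: (flin_fseries e1); [exact: flin_vEminus_log | exact: window_vEminus_log
  | exact: hfilt_vEminus_log].
Qed.

Lemma window_vEminus : window 1 vEminus.
Proof. by apply: window_fseries; [exact: flin_fzero flin_vEminus_log | exact: window_vEminus_log]. Qed.

Lemma vEminus00 v : vEminus 0 0 v = v.
Proof.
rewrite /vEminus fexpE (fseries_const e1) //; try exact: hfilt_vEminus_log.
  by rewrite fact0 invr1 scale1r.
exact: flin_vEminus_log.
Qed.

Lemma flin_vEplus : flin vEplus.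
Proof.
by apply: (flin_fseries eN1); [exact: flin_vEplus_log | exact: window_vEplus_log
  | exact: hfilt_vEplus_log].
Qed.

Lemma window_vEplus : window (-1) vEplus.
Proof. by apply: window_fseries; [exact: flin_fzero flin_vEplus_log | exact: window_vEplus_log]. Qed.

Let N0 : fldV := fsub (@fone K V) (fev0 vEminus).

Lemma flin_fev0 (A : fldV) : flin A -> flin (fev0 A).
Proof.
by move=> lA n k; rewrite /fev0; case: eqP => _; [exact: lA | exact: linear_zero].
Qed.

Lemma flin_N0 : flin N0.
Proof. by apply: flin_fsub; [exact: flin_fone | apply: flin_fev0; exact: flin_vEminus]. Qed.

Lemma N0_neq0 n k v : n != 0 -> N0 n k v = 0.
Proof. by move=> /negbTE n0; rewrite /N0 /fsub /fone /fev0 n0 subr0. Qed.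

Lemma window_N0 e : window e N0.
Proof.
by move=> n k v h; apply: N0_neq0; apply/eqP => n0; move: h; rewrite n0 mulr0.
Qed.

Lemma hfilt_N0 : hfilt 1 1 N0.
Proof.
move=> n k v; have [->|n0] := eqVneq n 0; last by rewrite N0_neq0.
case: k => // _; rewrite /N0 /fsub /fone /fev0 eqxx vEminus00 /=; exact: subrr.
Qed.

Lemma flin_vcalE_inv : flin (finv (fev0 vEminus)).
Proof.
by rewrite finvE; apply: (flin_fseries e1); [exact: flin_N0 | exact: window_N0 | exact: hfilt_N0].
Qed.

Lemma window_vcalE_inv e : window e (finv (fev0 vEminus)).
Proof. by rewrite finvE; apply: window_fseries; [exact: flin_fzero flin_N0 | exact: window_N0]. Qed.

Lemma flin_vcalE : flin vcalE.
Proof.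
apply: flin_fmul; [exact: flin_vcalE_inv | exact: flin_vEminus | ].
by apply: (composable_window e1); [exact: flin_vcalE_inv | exact: window_vcalE_inv
  | exact: window_vEminus].
Qed.

Lemma window_vcalE : window 1 vcalE.
Proof.
by apply: window_fmul; [exact: flin_fzero flin_vcalE_inv | exact: window_vcalE_inv
  | exact: window_vEminus].
Qed.

Lemma vcalE_inv_neq0 n k v : n != 0 -> finv (fev0 vEminus) n k v = 0.
Proof.
rewrite neq_lt => /orP[h|h].
  by apply: (window_vcalE_inv (e := 1)); rewrite mul1r.
by apply: (window_vcalE_inv (e := -1)); rewrite mulN1r oppr_lt0.
Qed.

(** This exact normalization, to all orders in [h], is what makes the products
    [x~(r_n) ... x~(r_1) 1] compatible with the shifts [e^alpha]. *)
Lemma vcalE_u0 : vcalE 0 = @hone K V.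
Proof.
apply/funext => k; apply/funext => v.
pose P : hop V := N0 0; have lP j : linear (P j) by exact: flin_N0.
have powP (d : nat) : forall j w, fpow N0 d 0 j w = hexp P d j w.
  elim: d => [|d IH] j w; first by [].
  rewrite fpowS hexpS /fmul /hcomp; apply: eq_bigr => i _.
  rewrite (@fsum_single _ _ _ 0) //= ?subr0 ?IH // => q _ q0.
  by rewrite sub0r N0_neq0 // oppr_eq0.
have invP M j w : (j < M)%N ->
    finv (fev0 vEminus) 0 j w = \sum_(m < M) hexp P m j w.
  move=> jM; rewrite finvE -/N0 (fseries_trunc e1 flin_N0 hfilt_N0 _ (M := M)).
    by apply: eq_bigr => m _; rewrite scale1r powP.
  by rewrite mul1r add0r ltz_nat.
have EP j w : vEminus 0 j w = @hone K V j w - P j w.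
  by rewrite /P /N0 /fsub /fone /fev0 eqxx; rewrite opprB addrC subrK.
(* the geometric series for the inverse telescopes against [1 - N0] *)
transitivity (\sum_(m < k.+1) (hexp P m k v - hexp P m.+1 k v)).
  transitivity (\sum_(m < k.+1) (\sum_(i < k.+1)
      hexp P m i (@hone K V (k - i)%N v - P (k - i)%N v))).
    rewrite /vcalE /fmul exchange_big; apply: eq_bigr => i _.
    rewrite (@fsum_single _ _ _ 0) //; last first.
      by move=> q _ q0; rewrite sub0r vcalE_inv_neq0 // oppr_eq0.
    by rewrite subr0 EP (invP k.+1).
  apply: eq_bigr => m _; have lPm j : linear (hexp P m j) by apply: linear_hexp.
  transitivity (hcomp (hexp P m) (@hone K V) k v - hcomp (hexp P m) P k v).
    rewrite /hcomp -sumrB; apply: eq_bigr => i _; exact: linB.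
  by rewrite hcomp_hone -?hexpSr // => j; rewrite lin0.
rewrite -(big_mkord xpredT (fun d => hexp P d k v - hexp P d.+1 k v)).
rewrite (eq_bigr (fun d => - hexp P d.+1 k v - - hexp P d k v)); last first.
  by move=> d _; rewrite opprK addrC.
rewrite (telescope_sumr (fun d => - hexp P d k v)) // opprK addrC.
have -> : hexp P k.+1 k v = 0.
  rewrite -powP; apply: (fpow_eq0 flin_N0 hfilt_N0).
  by rewrite mul1r add0r ltz_nat.
by rewrite subr0.
Qed.

End VertexOperators.

Section CurrentFactorization.
Variables (K : numFieldType) (V : lmodType K) (F : fock_rep V).
Implicit Types (v w : V) (s t : int) (A B C : fld V).

Notation fvec := (fvec F).
Notation heisen := (heisen F).
Notation shift := (shift F).
Notation chfun := (chfun F).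
Notation vcalE := (vcalE F).
Notation vEplus := (vEplus F).
Notation vEplus_log := (vEplus_log F).
Notation vopartial := (vopartial F).
Notation vupartial := (vupartial F).
Notation vXtilde := (vXtilde F).

(** ** Local finiteness of the annihilation part *)

Lemma vEplus_logE n k v (r : nat) : n + k%:Z = - r%:Z -> (0 < r)%N ->
  vEplus_log n k v = (upow (4^-1) (- r%:Z) n k / r%:R) *: (heisen j1 r v - heisen j2 r v).
Proof.
move=> e r0; rewrite /vEplus_log (@fsum_single _ _ _ r) // => q _ /eqP qr.
by rewrite upow_eq0 ?mul0r ?scale0r //; apply/eqP => e'; apply: qr; lia.
Qed.

Lemma vEplus_log_eq0 n k v : (0 <= n + k%:Z)%R -> vEplus_log n k v = 0.
Proof. by move=> h; apply: hfilt_vEplus_log; lia. Qed.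

Lemma energy_vEplus_log d n k v :
  energy_lt F d v -> energy_lt F (d + (n + k%:Z)) (vEplus_log n k v).
Proof.
move=> hv; have [h|h] := leP 0 (n + k%:Z).
  by rewrite vEplus_log_eq0 //; exact: energy_lt0.
rewrite (@vEplus_logE n k v `|(n + k%:Z)%R|%N); [|lia|lia].
apply: energy_ltZ; apply: energy_ltD.
  by apply: energy_ltW (energy_heisen _ _ hv); lia.
rewrite -scaleN1r; apply: energy_ltZ.
by apply: energy_ltW (energy_heisen _ _ hv); lia.
Qed.

Lemma energy_fpow_vEplus_log c d n k v :
  energy_lt F d v -> energy_lt F (d + (n + k%:Z)) (fpow vEplus_log c n k v).
Proof.
elim: c n k => [|c IH] n k hv.
  rewrite fpow0 /fone; case: eqP => [->|_]; last exact: energy_lt0.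
  by case: k => [|k] /=; [apply: energy_ltW hv; lia | exact: energy_lt0].
rewrite fpowS; apply: energy_lt_big => i _; apply: energy_lt_big => q _.
have := @energy_vEplus_log _ (n - q) i _ (IH q (k - i)%N hv).
by apply: energy_ltW; have := ltn_ord i; lia.
Qed.

Lemma locally_finite_vEplus : locally_finite vEplus.
Proof.
move=> k v; have [d hd] := energy_lt_ex F v; exists (d + k)%N => n hn.
have [n0|n0] := ltP 0 n; first by apply: window_vEplus; lia.
apply: fsbig1 => c _; suff -> : fpow vEplus_log c n k v = 0 by rewrite scaler0.
have le0 : (d%:Z + (n + k%:Z) <= 0)%R by lia.
exact: (@energy_lt_le0 _ _ F _ _ le0 (@energy_fpow_vEplus_log c d n k v hd)).
Qed.

Definition singular v := forall j (r : nat), (0 < r)%N -> heisen j r v = 0.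

Lemma singular_vac s : singular (fvec (onecm _) s).
Proof. by move=> j r _; exact: heisen_vac. Qed.

Lemma vEplus_singular n k v : singular v -> vEplus n k v = fone n k v.
Proof.
move=> hv; have logv q l : vEplus_log q l v = 0.
  have [h|h] := leP 0 (q + l%:Z); first exact: vEplus_log_eq0.
  rewrite (@vEplus_logE q l v `|(q + l%:Z)%R|%N); [|lia|lia].
  by rewrite !hv ?subrr ?scaler0 //; lia.
have powv c : forall q l, fpow vEplus_log c.+1 q l v = 0.
  elim: c => [|c IH] q l; last first.
    rewrite fpowS /fmul big1 // => i _; apply: fsbig1 => p _.
    by rewrite IH lin0 //; exact: flin_vEplus_log.
  by rewrite fpowS fpow0 fmul_fone; [exact: logv | exact: flin_vEplus_log].
rewrite -[vEplus]/(fexp vEplus_log) fexpE /fseries (@fsum_single _ _ _ 0%N) //.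
  by rewrite fact0 invr1 scale1r.
by move=> [//|c] _ _; rewrite powv scaler0.
Qed.

(** ** The zero mode *)

(** [v] has charge [s], i.e. lies in the component of [e^(s alpha/2)]. *)
Definition charge s v := forall b g, chfun b g v = g (form b (wt s)) *: v.

Lemma charge_fvec m s : charge s (fvec m s).
Proof. by move=> b g; rewrite chfunU. Qed.

Lemma charge0 s : charge s 0.
Proof. by move=> b g; rewrite scaler0 lin0 //; exact: linear_chfun. Qed.

Lemma chargeP s c v w : charge s v -> charge s w -> charge s (c *: v + w).
Proof.
by move=> hv hw b g; rewrite (linear_chfun F b g c v w) hv hw scalerDr !scalerA mulrC.
Qed.

Lemma form_alpha_half s : form (2^-1 *: alpha) (wt s) = s%:~R / 2.
Proof. by rewrite /form -scalemxAl mxE -/(form alpha (wt s)) form_alpha_wt mulrC. Qed.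

Lemma form_Nalpha s : form (- alpha) (wt s) = - s%:~R.
Proof. by rewrite /form mulNmx mxE -/(form alpha (wt s)) form_alpha_wt. Qed.

Lemma chfun_zero b v : chfun b (fun=> 0) v = 0.
Proof.
move: v; apply: (fvec_ext (F := F) (linear_chfun F b _) (@linear_zero _ _ _)) => m s.
by rewrite chfunU scale0r.
Qed.

Lemma flin_vopartial a e : flin (vopartial a e).
Proof. by move=> n k; exact: linear_chfun. Qed.

Lemma vopartial_eq0 a e n k v : n != - k%:Z -> vopartial a e n k v = 0.
Proof.
move=> /negbTE h; rewrite -[RHS](chfun_zero (2^-1 *: alpha) v).
by congr (chfun _ _ _); apply/funext => x; rewrite /onepow h.
Qed.

Lemma locally_finite_vopartial a e : locally_finite (vopartial a e).
Proof. by move=> k v; exists k => n hn; apply: vopartial_eq0; lia. Qed.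

Lemma vopartial_h0 a e n v : vopartial a e n 0 v = fone n 0 v.
Proof.
rewrite /fone; case: eqP => [->|/eqP n0] /=; last by apply: vopartial_eq0.
move: v; apply: (fvec_ext (F := F) (linear_chfun F _ _) (@linear_id _ _)) => m s.
by rewrite chfunU /onepow eqxx gbin0 expr0 mulr1 scale1r.
Qed.

Lemma vopartial_mulV a : fmul (vopartial a 1) (vopartial a (-1)) = @fone K V.
Proof.
apply/funext => n; apply/funext => k; apply/funext => v; move: v.
have lO := flin_vopartial.
apply: (fvec_ext (F := F)) => [||m s].
- apply: flin_fmul => //; apply: composable_locally_finite => //.
  exact: locally_finite_vopartial.
- exact: flin_fone.
pose x : K := ratr (s%:~R / 2).
transitivity (\sum_(i < k.+1) ((n == - k%:Z)%:R * a ^+ k * (gbin x i * gbin (- x) (k - i)%N))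
    *: fvec m s).
  apply: eq_bigr => i _; rewrite (@fsum_single _ _ _ (- (k - i)%N%:Z)) //; last first.
    by move=> q _ q0; rewrite (vopartial_eq0 _ _ _ q0) lin0 //; exact: lO.
  rewrite !vopartialE !chfunU (linZ (linear_chfun F _ _)) chfunU scalerA.
  congr (_ *: _); rewrite form_alpha_half -/x /onepow eqxx mulN1r mul1r.
  have -> : (n - - (k - i)%N%:Z == - i%:Z) = (n == - k%:Z).
    by have := ltn_ord i; move=> hi; apply/eqP/eqP; lia.
  case: eqP => _; last by rewrite !(mul0r, mulr0).
  have -> : a ^+ k = a ^+ i * a ^+ (k - i)%N by rewrite -exprD subnKC // -ltnS.
  by rewrite mulr1n; ring.
rewrite -scaler_suml -mulr_sumr gbin_vandermonde subrr /fone.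
case: k => [|k]; last by rewrite gbin_0S mulr0 scale0r; case: eqP.
by rewrite oppr0 expr0 gbin0 !mulr1 /=; case: eqP => _; rewrite ?scale1r ?scale0r.
Qed.

Lemma flin_vupartial b : flin (vupartial b).
Proof. by move=> n [|k]; [exact: linear_chfun | exact: linear_zero]. Qed.

Lemma vupartial_charge n k s v : charge s v ->
  vupartial alpha n k v = if (n == s) && (k == 0)%N then v else 0.
Proof.
move=> hv; case: k => [|k]; last by rewrite andbF.
rewrite vupartial_h0 hv form_alpha_wt eqr_int eq_sym andbT.
by case: eqP; rewrite ?scale1r ?scale0r.
Qed.

Lemma locally_finite_vupartial : locally_finite (vupartial alpha).
Proof.
move=> k v; move: v; apply: (fvec_span (f0 := F)) => [|c u w [N hN] [M hM]|m s].
- by exists 0%N => n _; rewrite lin0 //; exact: flin_vupartial.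
- exists (maxn N M) => n hn; rewrite (flin_vupartial alpha n k c u w) hN ?hM ?scaler0 ?addr0 //.
    by apply: leq_ltn_trans hn; rewrite leq_maxr.
  by apply: leq_ltn_trans hn; rewrite leq_maxl.
- exists `|s|%N => n hn; rewrite (vupartial_charge _ _ (charge_fvec m s)).
  by case: eqP hn => // ->; rewrite ltnn.
Qed.

Lemma flin_vconst (A : V -> V) : linear A -> flin (vconst A).
Proof.
move=> lA n k; rewrite /vconst.
by case: ((n == 0) && (k == 0)%N); [exact: lA | exact: linear_zero].
Qed.

Lemma locally_finite_vconst (A : V -> V) : locally_finite (vconst A).
Proof. by move=> k v; exists 0%N => n hn; rewrite /vconst; case: eqP hn => // ->. Qed.

Lemma fmul_vconst (A : V -> V) B : linear A ->
  fmul (vconst A) B = (fun n k v => A (B n k v)).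
Proof.
move=> lA; apply/funext => n; apply/funext => k; apply/funext => v.
rewrite /fmul big_ord_recl [X in _ + X]big1 => [|i _]; last first.
  by apply: fsbig1 => q _; rewrite /vconst andbF.
rewrite addr0 (@fsum_single _ _ _ n) //.
  by rewrite /vconst subrr eqxx subn0.
by move=> q _ qn; rewrite /vconst subr_eq0 eq_sym (negbTE qn).
Qed.

Definition vW : fld V := fmul vcalE vEplus.

Let lE : flin vcalE. Proof. exact: flin_vcalE. Qed.
Let lEp : flin vEplus. Proof. exact: flin_vEplus. Qed.
Let lS : flin (vconst (shift 2)). Proof. by apply: flin_vconst; exact: linear_shift. Qed.

Lemma flin_vW : flin vW.
Proof.
by apply: flin_fmul => //; apply: composable_locally_finite => //; exact: locally_finite_vEplus.
Qed.

(** The factor [(1 + h/u)^(- d_(alpha/2))] of [X~] cancels the half-integral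
    powers of [u + h] in [X_alpha]; only [u^(d_alpha)] remains. *)
Lemma vXtilde_factor : vXtilde = fmul vW (fmul (vconst (shift 2)) (vupartial alpha)).
Proof.
have lO a e := flin_vopartial a e; have fO a e := locally_finite_vopartial a e.
have lU := flin_vupartial alpha; have fU := locally_finite_vupartial.
have fS := @locally_finite_vconst (shift 2).
have lUO : flin (fmul (vupartial alpha) (vopartial 1 1)).
  by apply: flin_fmul => //; exact: composable_locally_finite.
have fUO : locally_finite (fmul (vupartial alpha) (vopartial 1 1)).
  exact: locally_finite_fmul.
have lSUO : flin (fmul (vconst (shift 2)) (fmul (vupartial alpha) (vopartial 1 1))).
  by apply: flin_fmul => //; exact: composable_locally_finite.
have fSUO : locally_finite (fmul (vconst (shift 2)) (fmul (vupartial alpha) (vopartial 1 1))).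
  exact: locally_finite_fmul.
have lW := flin_vW.
rewrite -[vXtilde]/(fmul (vXalpha F) (vopartial 1 (-1))) /vXalpha (fmulA lE lEp) //; last first.
  by apply: composable_locally_finite => //; exact: locally_finite_vEplus.
rewrite -/vW -fmulA //; last exact: composable_locally_finite.
congr (fmul vW _); rewrite -fmulA //; last exact: composable_locally_finite.
congr (fmul _ _); rewrite -fmulA //; last exact: composable_locally_finite.
by rewrite vopartial_mulV fmul_fone.
Qed.

Lemma flin_vXtilde : flin vXtilde.
Proof.
rewrite vXtilde_factor; have lW := flin_vW; have lU := flin_vupartial alpha.
have fSU : locally_finite (fmul (vconst (shift 2)) (vupartial alpha)).
  apply: locally_finite_fmul => //; first exact: locally_finite_vconst.
  exact: locally_finite_vupartial.
apply: flin_fmul => //; last exact: composable_locally_finite.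
apply: flin_fmul => //; apply: composable_locally_finite => //.
exact: locally_finite_vupartial.
Qed.

Lemma vXtilde_charge n k s v : charge s v -> vXtilde n k v = vW (n - s) k (shift 2 v).
Proof.
move=> hv; rewrite vXtilde_factor fmul_vconst; last exact: linear_shift.
have lW := flin_vW.
rewrite {1}/fmul big_ord_recr /= subnn big1 ?add0r => [|i _]; last first.
  apply: fsbig1 => q _; rewrite (vupartial_charge _ _ hv).
  have -> : (k - i == 0)%N = false by have := ltn_ord i; lia.
  by rewrite andbF lin0 ?lin0 //; exact: linear_shift.
rewrite (@fsum_single _ _ _ s) //; first by rewrite (vupartial_charge _ _ hv) eqxx.
move=> q _ /negbTE qs; rewrite (vupartial_charge _ _ hv) qs /= lin0 ?lin0 //.
exact: linear_shift.
Qed.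

(** Only the factor [u^(d_alpha)] of [vXtilde_factor] sees the charge, so conjugation
    by [e^(t alpha/2)] multiplies [X~(u)] by [u^t] to all orders in [h]. *)
Lemma vXtilde_shift t n k v : vXtilde n k (shift t v) = shift t (vXtilde (n - t) k v).
Proof.
have gc := shift_compat F t.
have gh j q u : heisen j q (shift t u) = shift t (heisen j q u) by exact: heisen_shift.
have h : twisted (shift t) t vXtilde.
  rewrite vXtilde_factor -[X in twisted _ X]add0r; apply: (twisted_fmul gc).
    rewrite -[0]addr0; apply: (twisted_fmul gc); [exact: twisted_vcalE | exact: twisted_vEplus].
  rewrite -[X in twisted _ X]add0r; apply: (twisted_fmul gc).
    by apply: (twisted_vconst gc) => u; rewrite !shiftD addrC.
  move=> q [|l] u; last by rewrite (lin0 (linear_shift F t)).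
  apply: (fvec_ext (F := F) (linear_comp (linear_chfun F _ _) (linear_shift F t))
    (linear_comp (linear_shift F t) (linear_chfun F _ _))) u => m s.
  rewrite shiftU !chfunU (linZ (linear_shift F t)) shiftU !form_alpha_wt !eqr_int.
  by rewrite [s + t == q]eq_sym [s == _]eq_sym subr_eq eq_sym.
exact: h.
Qed.

Lemma vXtilde_vac k : vXtilde 0 k (fvec (onecm _) 0) = @hone K V k (fvec (onecm _) 2).
Proof.
rewrite (vXtilde_charge _ _ (charge_fvec _ 0)) subr0 shiftU add0r.
set w := fvec _ 2; have hw : singular w by exact: singular_vac.
rewrite /vW /fmul big_ord_recr /= subnn big1 ?add0r => [|i _]; last first.
  apply: fsbig1 => q _; rewrite vEplus_singular // /fone; case: eqP => _; last exact: lin0.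
  by case: (k - i)%N (subn_gt0 i k) => [|j _] /=; rewrite ?ltn_ord ?lin0.
rewrite (@fsum_single _ _ _ 0) //.
  by rewrite vEplus_singular // /fone eqxx subr0 vcalE_u0.
by move=> q _ /negbTE q0; rewrite vEplus_singular // /fone q0 lin0.
Qed.

End CurrentFactorization.

(** * Dominance *)

Section Dominance.
Local Open Scope nat_scope.

Fixpoint wsum (w : nat -> nat) (s : seq nat) : nat :=
  if s is x :: s' then w 0 * x + wsum (fun i => w i.+1) s' else 0.

Lemma eq_wsum (w w' : nat -> nat) s : (forall i, w i = w' i) -> wsum w s = wsum w' s.
Proof. by elim: s w w' => //= x s IH w w' e; rewrite e (IH _ (fun i => w' i.+1)). Qed.

Lemma wsum_rcons w s x : wsum w (rcons s x) = wsum w s + w (size s) * x.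
Proof. by elim: s w => //= [|y s IH] w; rewrite ?addn0 // IH addnA. Qed.

Lemma wsumS s : wsum succn s = wsum id s + sumn s.
Proof.
suff H c : wsum (fun i => c + i.+1) s = wsum (fun i => c + i) s + sumn s.
  by rewrite -(H 0); apply: eq_wsum.
elim: s c => //= x s IH c.
rewrite (@eq_wsum _ (fun i => c.+1 + i.+1)); last by move=> i; lia.
rewrite (@eq_wsum (fun i => c + i.+1) (fun i => c.+1 + i)); last by move=> i; lia.
by rewrite IH; lia.
Qed.

Definition nondecreasing_weight (w : nat -> nat) := forall i, w i <= w i.+1.

Lemma nondecreasing_weight_le w : nondecreasing_weight w ->
  forall i j, i <= j -> w i <= w j.
Proof. by move=> h i j ij; apply: (homo_leq leqnn leq_trans h). Qed.

(** Dominance of compositions of the same size and sum, expressed dually by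
    pairing with the nondecreasing weights rather than by partial sums: in this
    form the composition of moves to the right is immediate. *)
Definition dom (s t : seq nat) : Prop :=
  [/\ size s = size t, sumn s = sumn t &
      forall w, nondecreasing_weight w -> wsum w t <= wsum w s].

Definition sdom (s t : seq nat) : Prop := dom s t /\ wsum id t < wsum id s.

Lemma dom_refl s : dom s s. Proof. by split. Qed.

Lemma dom_trans s t u : dom s t -> dom t u -> dom s u.
Proof.
move=> [e1 e2 h] [f1 f2 k]; split; [by rewrite e1 | by rewrite e2 | move=> w hw].
exact: leq_trans (k w hw) (h w hw).
Qed.

Lemma nondecreasing_id : nondecreasing_weight id. Proof. by move=> i; exact: leqnSn. Qed.

Lemma sdom_trans s t u : dom s t -> sdom t u -> sdom s u.
Proof.
move=> st [tu h]; split; first exact: dom_trans st tu.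
by apply: leq_trans h _; case: st => _ _; apply; exact: nondecreasing_id.
Qed.

Lemma sdom_rcons s t x : sdom s t -> sdom (rcons s x) (rcons t x).
Proof.
move=> [[e1 e2 h] k]; split; [split|].
- by rewrite !size_rcons e1.
- by rewrite !sumn_rcons e2.
- by move=> w hw; rewrite !wsum_rcons e1 leq_add2r h.
- by rewrite !wsum_rcons e1 ltn_add2r.
Qed.

Lemma sdom_cons s t x : sdom s t -> sdom (x :: s) (x :: t).
Proof.
move=> [[e1 e2 h] k]; split; [split => /=|].
- by rewrite e1.
- by rewrite e2.
- by move=> w hw; rewrite leq_add2l h // => i; exact: hw.
- by rewrite /= !wsumS e2; lia.
Qed.

(** Moving [j] units from the first entry to the last cannot decrease the pairing with
    a nondecreasing weight. *)
Lemma sdom_move s t x j l : 0 < j -> j <= x -> dom s (rcons t (l + j)) ->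
  sdom (x - j :: s) (x :: rcons t l).
Proof.
move=> j0 jx [e1 e2 h]; split; [split => /=|].
- by rewrite e1 !size_rcons.
- by rewrite e2 !sumn_rcons; lia.
- move=> w hw; have hS : nondecreasing_weight (fun i => w i.+1) by move=> i; exact: hw.
  have := h _ hS; rewrite !wsum_rcons => h1.
  have := nondecreasing_weight_le hw (leq0n (size t).+1) => h2.
  have : w 0 * j <= w (size t).+1 * j by rewrite leq_mul2r h2 orbT.
  have : w 0 * x = w 0 * (x - j) + w 0 * j by rewrite -mulnDr subnK.
  by move: h1; rewrite mulnDr; lia.
- have := h _ nondecreasing_id; rewrite /= !wsumS e2 !sumn_rcons !wsum_rcons mulnDr; lia.
Qed.

Definition sumsq (s : seq nat) : nat := sumn [seq x ^ 2 | x <- s].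

Fixpoint dotp (s t : seq nat) : nat :=
  match s, t with x :: s', y :: t' => x * y + dotp s' t' | _, _ => 0 end.

Lemma dotpE c s t : size s = size t -> wsum (nth c s) t = dotp s t.
Proof. by elim: s t => [|x s IH] [|y t] //= [e]; rewrite IH. Qed.

Lemma dotpp s : dotp s s = sumsq s.
Proof. by elim: s => //= x s ->; rewrite mulnn. Qed.

Lemma dotp_lt s t : size s = size t -> s <> t -> 2 * dotp s t < sumsq s + sumsq t.
Proof.
have le x y : 2 * (x * y) <= x ^ 2 + y ^ 2 by have := (nat_Cauchy x y).1; lia.
have leS u t' : size u = size t' -> 2 * dotp u t' <= sumsq u + sumsq t'.
  elim: u t' => [|x u IH] [|y t'] //= [e]; rewrite /sumsq /= -!/(sumsq _).
  by have := IH _ e; have := le x y; lia.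
elim: s t => [|x s IH] [|y t] //= [e] ne; rewrite /sumsq /= -!/(sumsq _).
have [exy|nxy] := eqVneq x y.
  have := IH t e; rewrite exy => h; have : s <> t by move=> st; apply: ne; rewrite exy st.
  by move=> /h; rewrite -!mulnn; lia.
have := leS _ _ e; have : 2 * (x * y) < x ^ 2 + y ^ 2.
  by rewrite ltn_neqAle le andbT (nat_Cauchy x y).2.
lia.
Qed.

(** The entries of a partition are themselves a nondecreasing weight: pairing with it
    bounds [t.t] by [s.t], and Cauchy-Schwarz concludes. *)
Lemma sumsq_sdom s t : sorted leq t -> sdom s t -> sumsq t < sumsq s.
Proof.
move=> st [[e1 e2 h] k]; pose w := nth (last 0 t) t.
have hw : nondecreasing_weight w.
  move=> i; rewrite /w; have [hi|hi] := ltnP i.+1 (size t).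
    by apply: (sorted_leq_nth leq_trans leqnn) => //; rewrite ?inE ?(ltn_trans _ hi).
  rewrite (nth_default _ hi); have [hi'|hi'] := ltnP i (size t).
    rewrite (last_nth 0) (set_nth_default 0) //; case: t st e1 e2 h k w hi hi' => // x t.
    move=> st _ _ _ _ _ hi hi' /=.
    apply: (sorted_leq_nth leq_trans leqnn 0 st) => //; rewrite ?inE //=.
  by rewrite nth_default.
have := h w hw; rewrite !dotpE ?dotpp // => h1.
have ne : t <> s by move=> ts; move: k; rewrite ts ltnn.
have := dotp_lt (esym e1) ne; lia.
Qed.

Lemma sumsq_perm s t : perm_eq s t -> sumsq s = sumsq t.
Proof. by move=> h; apply: perm_sumn; apply: perm_map. Qed.

Lemma sumsq_le s : sumsq s <= (sumn s) ^ 2.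
Proof.
elim: s => //= x s IH; rewrite /sumsq /= -/(sumsq s) sqrnD.
by apply: leq_trans (leq_addr _ _); rewrite leq_add2l.
Qed.

End Dominance.

(** * Spans *)

Section Spans.
Variables (K : fieldType) (V : lmodType K).
Implicit Types (B : V -> Prop) (v : V).

Definition in_span B v : Prop := forall P : V -> Prop, P 0 ->
  (forall c u w, P u -> P w -> P (c *: u + w)) -> (forall b, B b -> P b) -> P v.

Lemma span_gen B b : B b -> in_span B b.
Proof. by move=> Bb P _ _; apply. Qed.

Lemma span0 B : in_span B 0.
Proof. by []. Qed.

Lemma spanP B c u w : in_span B u -> in_span B w -> in_span B (c *: u + w).
Proof. by move=> hu hw P P0 PD Pb; exact: (PD _ _ _ (hu P P0 PD Pb) (hw P P0 PD Pb)). Qed.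

Lemma spanD B u w : in_span B u -> in_span B w -> in_span B (u + w).
Proof. by move=> hu hw; rewrite -[u]scale1r; exact: spanP. Qed.

Lemma spanZ B c u : in_span B u -> in_span B (c *: u).
Proof. by move=> hu; rewrite -[_ *: _]addr0; apply: spanP => //; exact: span0. Qed.

Lemma spanN B u : in_span B u -> in_span B (- u).
Proof. by rewrite -scaleN1r; exact: spanZ. Qed.

Lemma spanB B u w : in_span B u -> in_span B w -> in_span B (u - w).
Proof. by move=> hu /spanN; exact: spanD. Qed.

Lemma span_sum B (I : Type) (s : seq I) (P : pred I) (G : I -> V) :
  (forall i, P i -> in_span B (G i)) -> in_span B (\sum_(i <- s | P i) G i).
Proof. by move=> h; apply: big_ind => //; exact: spanD. Qed.

Lemma span_sub B B' v : (forall b, B b -> in_span B' b) -> in_span B v -> in_span B' v.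
Proof.
move=> h hv; apply: (hv (in_span B')) => //.
by move=> c u w; exact: spanP.
Qed.

End Spans.

Lemma span_linear (K : fieldType) (V W : lmodType K) (B : V -> Prop) (B' : W -> Prop)
    (f : V -> W) v : linear f -> (forall b, B b -> in_span B' (f b)) ->
  in_span B v -> in_span B' (f v).
Proof.
move=> lf fB hv; apply: (hv (fun v => in_span B' (f v))) => //.
  by rewrite lin0.
by move=> c u w hu hw; rewrite lf; exact: spanP.
Qed.

Lemma fsum_linear (K : fieldType) (V W : lmodType K) (I : choiceType) (f : V -> W)
    (G : I -> V) : linear f -> (exists s : seq I, forall i, i \notin s -> G i = 0) ->
  f (\sum_(i \in [set: I]) G i) = \sum_(i \in [set: I]) f (G i).
Proof.
move=> lf [s hs]; rewrite !(fsum_seq (undup_uniq s)) ?(lin_sum lf) // => i.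
  by rewrite mem_undup => /hs ->; rewrite lin0.
by rewrite mem_undup => /hs.
Qed.

Lemma fsumZ (K : fieldType) (V : lmodType K) (I : choiceType) c (G : I -> V) :
  (exists s : seq I, forall i, i \notin s -> G i = 0) ->
  \sum_(i \in [set: I]) c *: G i = c *: \sum_(i \in [set: I]) G i.
Proof.
by move=> h; rewrite (fsum_linear (linear_scale c (@linear_id _ V)) h).
Qed.

(** * Reduction of the current modulo h *)

Section Classical.
Variables (K : numFieldType) (V : lmodType K) (F : fock_rep V).
Implicit Types (v w : V) (s t : int).

Notation heisen := (heisen F).
Notation shift := (shift F).
Notation a_neg j r := (heisen j (Negz r)).
Notation vcalE := (vcalE F).
Notation vEplus := (vEplus F).
Notation vW := (vW F).

Let e1 : (1 : int) = 1 \/ (1 : int) = -1. Proof. by left. Qed.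
Let eN1 : (-1 : int) = 1 \/ (-1 : int) = -1. Proof. by right. Qed.

(** The operators [H_n] with generating series
    [exp (sum_r (a_2(-r) - a_1(-r)) u^r / r)]: complete symmetric functions in
    the power sums [gop r = a_2(-r) - a_1(-r)]. *)
Definition Hop (n : int) : V -> V := vcalE n 0.
Definition gop (r : nat) : V -> V := fun v => a_neg j2 r.-1 v - a_neg j1 r.-1 v.
Definition Eop (q : int) : V -> V := vEplus q 0.
Definition Yop (l : int) : V -> V := vW l 0.

Lemma gopE r v : gop r v = a_neg j2 r.-1 v - a_neg j1 r.-1 v. Proof. by []. Qed.

Lemma linear_Hop n : linear (Hop n). Proof. exact: flin_vcalE. Qed.
Lemma linear_Eop n : linear (Eop n). Proof. exact: flin_vEplus. Qed.
Lemma linear_Yop n : linear (Yop n). Proof. exact: flin_vW. Qed.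
Lemma linear_gop r : linear (gop r).
Proof. by apply: linear_add; [|apply: linear_opp]; exact: linear_heisen. Qed.

Lemma Hop_neg n v : (n < 0)%R -> Hop n v = 0.
Proof. by move=> n0; apply: window_vcalE; rewrite mul1r. Qed.

Let A : hop V := slice 1 (vEminus_log F).
Let B : hop V := slice (-1) (vEplus_log F).

Let lA k : linear (A k). Proof. exact: flin_vEminus_log. Qed.
Let lB k : linear (B k). Proof. exact: flin_vEplus_log. Qed.

Let A_E r v : A r v = r%:R^-1 *: gop r v.
Proof.
rewrite /A /slice mul1r /vEminus_log; case: r => [|r].
  rewrite invr0 scale0r; apply: fsbig1 => r /= r0.
  by rewrite !upow_eq0 ?mul0r ?oppr0 ?scale0r ?addr0 //; lia.
rewrite (@fsum_single _ _ _ r.+1) // => [|q _ qr]; last first.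
  by rewrite !upow_eq0 ?mul0r ?oppr0 ?scale0r ?addr0 //; lia.
rewrite !upow_h0 eqxx mul1r -NegzE /gop /=.
by rewrite addrC scalerBr scaleNr.
Qed.

Let B_E r v : B r v = r%:R^-1 *: (heisen j1 r v - heisen j2 r v).
Proof.
rewrite /B /slice mulN1r; case: r => [|r].
  by rewrite vEplus_log_eq0 // invr0 scale0r.
by rewrite (@vEplus_logE _ _ _ _ 0%N _ r.+1) ?addr0 // upow_h0 eqxx mul1r.
Qed.

Let A0 v : A 0 v = 0. Proof. by rewrite A_E invr0 scale0r. Qed.
Let B0 v : B 0 v = 0. Proof. by rewrite B_E invr0 scale0r. Qed.

Lemma gop_a_neg r j q v : gop r (a_neg j q v) = a_neg j q (gop r v).
Proof.
by rewrite /gop (linB (linear_heisen F _ _)) !(heisen_negC F _ _ j q).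
Qed.

Lemma gop_comm r q v : gop r (gop q v) = gop q (gop r v).
Proof. by rewrite {2}/gop (linB (linear_gop r)) !gop_a_neg. Qed.

Let A_comm i j v : A i (A j v) = A j (A i v).
Proof.
by rewrite !A_E !(linZ (linear_gop _)) !scalerA mulrC gop_comm.
Qed.

Lemma Hop_natE (n : nat) v : Hop n v = hser_exp A n v.
Proof.
rewrite [Hop _ _]fmul0E (@fsum_single _ _ _ n%:Z) //; last first.
  move=> q _ qn; apply: vcalE_inv_neq0; apply: contra qn => /eqP.
  by move=> /eqP; rewrite subr_eq0 eq_sym.
rewrite subrr finvE (fseries_const e1 (flin_N0 F) (hfilt_N0 F)) // scale1r /=.
have := congr1 (fun P : hop V => P n v)
  (slice_fexp e1 (flin_vEminus_log F) (window_vEminus_log F) (hfilt_vEminus_log F)).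
by rewrite {1}/slice mul1r.
Qed.

Lemma Eop_natE (n : nat) v : Eop (- n%:Z) v = hser_exp B n v.
Proof.
have := congr1 (fun P : hop V => P n v)
  (slice_fexp eN1 (flin_vEplus_log F) (window_vEplus_log F) (hfilt_vEplus_log F)).
by rewrite {1}/slice mulN1r.
Qed.

Lemma Eop_pos q v : (0 < q)%R -> Eop q v = 0.
Proof. by move=> q0; apply: window_vEplus; rewrite mulN1r oppr_lt0. Qed.

Lemma Hop0 v : Hop 0 v = v.
Proof. by rewrite (Hop_natE 0) hser_exp0. Qed.

Lemma Hop_comm_gen (g : V -> V) : linear g -> (forall r v, gop r (g v) = g (gop r v)) ->
  forall n v, Hop n (g v) = g (Hop n v).
Proof.
move=> lg gg n v; have [n0|n0] := ltP n 0; first by rewrite !Hop_neg // lin0.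
have -> : n = `|n|%N by lia.
rewrite !Hop_natE (htwisted_hser_exp lg) // => k w.
by rewrite !A_E gg (linZ lg).
Qed.

Lemma Hop_a_neg n j q v : Hop n (a_neg j q v) = a_neg j q (Hop n v).
Proof. by apply: Hop_comm_gen; [exact: linear_heisen | move=> r w; exact: gop_a_neg]. Qed.

Lemma Hop_gop n r v : Hop n (gop r v) = gop r (Hop n v).
Proof. by rewrite /gop (linB (linear_Hop n)) !Hop_a_neg. Qed.

Lemma Hop_comm n q v : Hop n (Hop q v) = Hop q (Hop n v).
Proof. by apply: Hop_comm_gen; [exact: linear_Hop | move=> r w; rewrite Hop_gop]. Qed.

Lemma Hop_shift n s v : Hop n (shift s v) = shift s (Hop n v).
Proof.
have := twisted_vcalE (shift_compat F s) (fun j n v => heisen_shift F j n s v) n 0 v.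
by rewrite subr0.
Qed.

Lemma charge_Hop n s v : charge F s v -> charge F s (Hop n v).
Proof.
move=> hv b g.
rewrite -(@Hop_comm_gen (chfun F b g)) ?hv ?(linZ (linear_Hop n)) //.
  exact: linear_chfun.
move=> r w; rewrite /gop (linB (linear_chfun F b g)).
have hd j q u : heisen j q (chfun F b g u) = chfun F b g (heisen j q u).
  apply: (heisen_diag (h := fun s => g (form b (wt s)))); first exact: linear_chfun.
  by move=> m s'; rewrite chfunU.
by rewrite !hd.
Qed.

(** Newton's identity, with enough terms of the sum added to make it uniform in
    the integer [n]. *)
Lemma Hop_newton (N : nat) (n : int) v : (n <= N%:Z)%R ->
  n%:~R *: Hop n v = \sum_(1 <= r < N.+1) gop r (Hop (n - r%:Z) v).
Proof.
move=> nN; have [n0|n0] := ltP n 0.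
  rewrite Hop_neg // scaler0 big_nat_cond big1 // => r; rewrite andbT => /andP[r1 _].
  by rewrite Hop_neg ?lin0 //; [exact: linear_gop | lia].
have {n0 nN} [m -> mN] : exists2 m : nat, n = m & (m <= N)%N by exists `|n|%N; lia.
rewrite -[m%:~R]/(m%:R) Hop_natE (hser_exp_newton lA A0 A_comm).
rewrite -(big_mkord xpredT (fun r => r%:R *: A r (hser_exp A (m - r)%N v))).
rewrite big_ltn // scale0r add0r [RHS](@big_cat_nat _ _ _ m.+1) //=.
rewrite [X in _ = _ + X]big_nat_cond [X in _ = _ + X]big1 => [|r]; last first.
  rewrite andbT => /andP[r1 _]; rewrite Hop_neg ?lin0 //; [exact: linear_gop | lia].
rewrite addr0; apply: eq_big_nat => r /andP[r1 r2].
have -> : (m%:Z - r%:Z)%R = (m - r)%N by lia.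
rewrite Hop_natE A_E scalerA mulfV ?scale1r // pnatr_eq0; lia.
Qed.

Lemma Eop_gop q (r : nat) v : (0 < r)%N ->
  Eop q (gop r v) = gop r (Eop q v) - 2 *: Eop (q + r%:Z) v.
Proof.
move=> r0; have [q0|q0] := ltP 0 q.
  rewrite !(Eop_pos _ q0) Eop_pos; last by lia.
  by rewrite (lin0 (linear_gop r)) scaler0 subr0.
have {q0} [n ->] : exists n : nat, q = - n%:Z by exists `|q|%N; lia.
pose c p : K := if p == r then - 2 else 0.
have heisen_gop j p w : heisen j p.+1 (gop r w) = gop r (heisen j p.+1 w) +
    ((if j == j2 then 1 else -1) * (if p.+1 == r then p.+1%:R else 0)) *: w.
  rewrite /gop (linB (linear_heisen F _ _)) !heisen_comm //= !xpair_eqE /=.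
  rewrite -[r.-1 == p]eqSS prednK // [r == _]eq_sym.
  have [->|->] : j = j1 \/ j = j2.
    by case: j => [[|[|//]] hj]; [left | right]; apply: val_inj.
    rewrite /= muln0 scale0r addr0 mulN1r scaleNr opprD addrA.
    by case: eqP => _; rewrite ?muln1 ?muln0.
  rewrite /= muln0 scale0r addr0 mul1r addrAC.
  by case: eqP => _; rewrite ?muln1 ?muln0.
have comm p w : B p (gop r w) = gop r (B p w) + c p *: w.
  rewrite !B_E (linZ (linear_gop r)); case: p => [|p].
    by rewrite invr0 !scale0r /c; case: eqP r0 => [<-|] //; rewrite scale0r addr0.
  rewrite !heisen_gop /= mul1r mulN1r opprD addrACA -(linB (linear_gop r)) scalerDr.
  congr (_ + _); rewrite -scaleNr -scalerDl scalerA /c; case: eqP => _; last first.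
    by rewrite oppr0 addr0 mulr0.
  by congr (_ *: _); rewrite mulrDr mulrN mulVf ?pnatr_eq0 // -opprD.
have c0 : c 0 = 0 by rewrite /c; case: eqP r0 => // <-.
rewrite !Eop_natE (hser_exp_translate lB B0 (linear_gop r) c0 comm); congr (_ + _).
have [rn|nr] := leqP r n.
  have rn' : (r < n.+1)%N by [].
  rewrite (bigD1 (Ordinal rn')) //= big1 ?addr0 => [|i ir]; last first.
    rewrite /c; case: eqP => [e|_]; last by rewrite scale0r.
    by case/eqP: ir; apply: val_inj.
  have -> : - n%:Z + r%:Z = - (n - r)%N%:Z by lia.
  by rewrite Eop_natE /c eqxx scaleNr.
rewrite Eop_pos ?scaler0 ?oppr0; last by lia.
by rewrite big1 // => i _; rewrite /c; case: eqP => [e|_]; [have := ltn_ord i; lia | rewrite scale0r].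
Qed.

End Classical.

Section Triangularity.
Variables (K : numFieldType) (V : lmodType K) (F : fock_rep V).
Implicit Types (v w : V) (s t : int).

Notation Hop := (Hop F).
Notation Eop := (Eop F).
Notation Yop := (Yop F).
Notation gop := (gop F).

Let lH := linear_Hop F.
Let lE := linear_Eop F.

(** The factor [(1 - w/u)^2] produced when the annihilation part [E+(u)] moves
    past the generating series of the [H_n]. *)
Lemma Eop_Hop (n : nat) q v : Eop q (Hop n v) =
  Hop n (Eop q v) - 2 *: Hop (n%:Z - 1) (Eop (q + 1) v) + Hop (n%:Z - 2) (Eop (q + 2) v).
Proof.
have [N] := ubnP n; elim: N n q => // N IH [|n] q nN.
  by rewrite !Hop0 !Hop_neg // scaler0 subr0 addr0.
(* the right-hand side for [m], to which the induction hypothesis reduces the terms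
   of Newton's identity *)
pose T (m p : int) := Hop m (Eop p v) - 2 *: Hop (m - 1) (Eop (p + 1) v)
  + Hop (m - 2) (Eop (p + 2) v).
have IH' r p : (0 < r)%N -> (r < n.+2)%N -> Eop p (Hop (n.+1%:Z - r%:Z) v) = T (n.+1%:Z - r%:Z) p.
  move=> r0 rn; have -> : n.+1%:Z - r%:Z = (n.+1 - r)%N by lia.
  apply: IH; lia.
have n0 : n.+1%:~R != 0 :> K by rewrite intr_eq0.
apply: (scalerI n0); rewrite -(linZ (lE q)) (@Hop_newton _ _ F n.+1) //.
rewrite (lin_sum (lE q)).
pose U (r : nat) := Hop (n.+1%:Z - r%:Z) (Eop (q + r%:Z) v).
pose S (d : int) w := \sum_(1 <= r < n.+2) gop r (Hop (n.+1%:Z - d - r%:Z) w).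
transitivity (S 0 (Eop q v) - 2 *: S 1 (Eop (q + 1) v) + S 2 (Eop (q + 2) v)
    - 2 *: (U 1%N - U 2%N)).
  (* the second differences in [T] telescope *)
  have -> : U 1%N - U 2%N = \sum_(1 <= r < n.+2) T (n.+1%:Z - r%:Z) (q + r%:Z).
    rewrite (eq_bigr (fun r => (- U r.+1 + U r.+2) - (- U r + U r.+1))); last first.
      move=> r _; rewrite /T /U.
      have -> : n.+1%:Z - r%:Z - 1 = n.+1%:Z - r.+1%:Z by lia.
      have -> : n.+1%:Z - r%:Z - 2 = n.+1%:Z - r.+2%:Z by lia.
      have -> : q + r%:Z + 1 = q + r.+1%:Z by lia.
      have -> : q + r%:Z + 2 = q + r.+2%:Z by lia.
      by rewrite scaler_nat mulr2n !opprD opprK !addrA [RHS](ACl (3*1*4*2)).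
    rewrite (telescope_sumr (fun r => - U r + U r.+1)) //.
    have -> : U n.+2 = 0 by rewrite /U Hop_neg //; lia.
    have -> : U n.+3 = 0 by rewrite /U Hop_neg //; lia.
    by rewrite oppr0 addr0 add0r opprD opprK.
  rewrite scaler_sumr /S scaler_sumr -!sumrB -big_split -sumrB /=.
  apply: eq_big_nat => r /andP[r0 rn]; rewrite Eop_gop // !IH' //; congr (_ - _).
  rewrite /T (linD (linear_gop F r)) (linB (linear_gop F r)) (linZ (linear_gop F r)).
  by rewrite subr0 [_ - 1 - r%:Z]addrAC [_ - 2 - r%:Z]addrAC.
(* the remaining terms match after Newton's identity for [n.+1], [n] and [n - 1] *)
have newton d w : (0 <= d)%R ->
    n.+1%:~R *: Hop (n.+1%:Z - d) w = S d w + d%:~R *: Hop (n.+1%:Z - d) w.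
  move=> d0; rewrite /S -(@Hop_newton _ _ F n.+1); last by lia.
  by rewrite -scalerDl -intrD subrK.
have E0 := newton 0 (Eop q v) isT; rewrite subr0 scale0r addr0 in E0.
have E1 := newton 1 (Eop (q + 1) v) isT; rewrite scale1r in E1.
have E2 := newton 2 (Eop (q + 2) v) isT.
have C2 (x : V) : n.+1%:~R *: (2 *: x) = 2 *: (n.+1%:~R *: x) by rewrite !scalerA mulrC.
rewrite [in RHS]scalerDr [in RHS]scalerBr C2 E0 E1 E2.
rewrite -[U 1%N]/(Hop (n.+1%:Z - 1) (Eop (q + 1) v)) -[U 2%N]/(Hop (n.+1%:Z - 2) (Eop (q + 2) v)).
rewrite -[2%:~R]/(2 : K) scalerBr scalerDr opprB !opprD !addrA.
by rewrite [RHS](ACl (1*2*4*5*3)).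
Qed.

Lemma Eop_supp v : exists s : seq int, forall q, q \notin s -> Eop q v = 0.
Proof.
have [N hN] := @locally_finite_vEplus K V F 0 v; exists (irange N) => q.
by rewrite mem_irange -ltnNge; exact: hN.
Qed.

Lemma YopE l v : Yop l v = \sum_(q \in [set: int]) Hop (l - q) (Eop q v).
Proof. by rewrite [Yop _ _]fmul0E. Qed.

Lemma Yop_Hop (n : nat) l v : Yop l (Hop n v) =
  Hop n (Yop l v) - 2 *: Hop (n%:Z - 1) (Yop (l + 1) v) + Hop (n%:Z - 2) (Yop (l + 2) v).
Proof.
have [s hs] := Eop_supp v.
have supp (f : int -> V -> V) (j : int) : (forall q, f q 0 = 0) ->
    exists s : seq int, forall q, q \notin s -> f q (Eop (q + j) v) = 0.
  move=> f0; exists [seq q - j | q <- s] => q hq; rewrite hs ?f0 //.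
  apply: contra hq => hq; apply/mapP; exists (q + j) => //; by rewrite addrK.
have G j : \sum_(q \in [set: int]) Hop (l - q) (Hop (n%:Z - j) (Eop (q + j) v)) =
    Hop (n%:Z - j) (Yop (l + j) v).
  rewrite YopE fsum_linear; [|exact: lH|].
    have bij : bijective (fun m : int => m + j).
      by exists (fun m => m - j) => m; rewrite ?addrK ?subrK.
    rewrite [RHS](reindex_fsbigT _ _ bij); apply: eq_fsbigr => q _.
    by rewrite Hop_comm opprD addrACA subrr addr0.
  have [t ht] := supp (fun q => Hop (l + j - (q + j))) j (fun q => lin0 (lH _)).
  exists [seq q + j | q <- t] => q hq; rewrite -(ht (q - j)) ?subrK //.
  by apply: contra hq => hq; apply/mapP; exists (q - j); rewrite ?subrK.
have suppG j : exists s : seq int, forall q, q \notin s ->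
    Hop (l - q) (Hop (n%:Z - j) (Eop (q + j) v)) = 0.
  by apply: (supp (fun q w => Hop (l - q) (Hop (n%:Z - j) w))) => q; rewrite !lin0.
have [t0 h0] := suppG 0; have [t1 h1] := suppG 1; have [t2 h2] := suppG 2.
have h0' q : q \notin t0 -> Hop (l - q) (Hop n (Eop (q + 0) v)) = 0.
  by move=> /h0; rewrite subr0.
have := G 0; rewrite subr0 addr0 => <-; rewrite -!G YopE.
rewrite -fsumZ; last by exists t1.
rewrite -scaleN1r -fsumZ; last by exists t1 => q hq; rewrite h1 // scaler0.
rewrite -!fsumD.
- apply: eq_fsbigr => q _; rewrite Eop_Hop addr0.
  by rewrite (linD (lH _)) (linB (lH _)) (linZ (lH _)) scaleN1r.
- by exists (t0 ++ t1) => q; rewrite mem_cat negb_or => /andP[/h0' -> /h1 ->];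
    rewrite !scaler0 addr0.
- by exists t2 => q /h2.
- by exists t0 => q /h0'.
- by exists t1 => q hq; rewrite h1 // !scaler0.
Qed.

Lemma Yop_singular l v : singular F v -> Yop l v = Hop l v.
Proof.
move=> hv; rewrite YopE (@fsum_single _ _ _ 0) // => [|q _ /negbTE q0].
  by rewrite subr0 [Eop _ _]vEplus_singular.
by rewrite [Eop _ _]vEplus_singular // /fone q0 lin0.
Qed.

Definition Hseq (nu : seq nat) v : V := foldr (fun k w => Hop k%:Z w) v nu.

(** [x(u)] applied to [H_nu e^mu] has the leading term obtained by appending an
    index; each commutation with a factor [H_k] moves at most two units of [k] to
    that index, which raises [nu] in the dominance order. *)
Lemma Yop_Hseq nu (l : nat) v : singular F v ->
  in_span (fun b => exists2 rho, sdom rho (rcons nu l) & b = Hseq rho v)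
    (Yop l (Hseq nu v) - Hseq (rcons nu l) v).
Proof.
move=> hv; elim: nu l => [|k nu IH] l.
  by rewrite /= Yop_singular // subrr.
rewrite /= Yop_Hop.
have term j : (0 < j)%N ->
    in_span (fun b => exists2 rho, sdom rho (k :: rcons nu l) & b = Hseq rho v)
      (Hop (k%:Z - j%:Z) (Yop (l%:Z + j%:Z) (Hseq nu v))).
  move=> j0; have [kj|jk] := ltnP k j; first by rewrite Hop_neg //; lia.
  have -> : k%:Z - j%:Z = (k - j)%N by lia.
  apply: (span_linear (B := fun b => exists2 rho, dom rho (rcons nu (l + j)) & b = Hseq rho v)).
  - exact: lH.
  - move=> b [rho hrho ->]; apply: span_gen; exists ((k - j)%N :: rho) => //.
    exact: sdom_move.
  - rewrite -[Yop _ _](subrK (Hseq (rcons nu (l + j)) v)); apply: spanD.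
      apply: span_sub (IH (l + j)%N) => b [rho [hrho _] ->].
      by apply: span_gen; exists rho.
    by apply: span_gen; exists (rcons nu (l + j)) => //; exact: dom_refl.
rewrite [X in in_span _ X](ACl (1*4*2*3)) /= -(linB (lH k)).
apply: spanD; last exact: (term 2).
apply: spanB; last by apply: spanZ; exact: (term 1).
apply: span_linear (IH l); first exact: lH.
by move=> b [rho hrho ->]; apply: span_gen; exists (k :: rho) => //; exact: sdom_cons.
Qed.

End Triangularity.

(** * The semi-infinite monomials *)

Section Monomials.
Variables (K : numFieldType) (V : lmodType K) (F : fock_rep V).
Implicit Types (v w : V) (s t : seq nat).

Notation fvec := (fvec F).
Notation shift := (shift F).
Notation parity := (parity F).
Notation vXtilde := (vXtilde F).
Notation Yop := (Yop F).
Notation Hseq := (Hseq F).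

(** The modes [-1 - lambda_j - 2 j]: sequences with gaps at least two are
    partitions shifted by the staircase. *)
Fixpoint modes_from (j : nat) s : seq int :=
  if s is l :: s' then (- (l + 2 * j)%N%:Z - 1) :: modes_from j.+1 s' else [::].

Definition part_modes s : seq int := modes_from 0 s.

Lemma part_modes_rcons s l :
  part_modes (rcons s l) = rcons (part_modes s) (- (l + 2 * size s)%N%:Z - 1).
Proof.
suff H j : modes_from j (rcons s l) = rcons (modes_from j s) (- (l + 2 * (j + size s))%N%:Z - 1).
  by rewrite /part_modes H add0n.
by elim: s j => [|x s IH] j /=; rewrite ?addn0 // IH addSnnS.
Qed.

Definition vac : fock V := hconst (fvec (onecm _) 0).

Definition vbeta s : fock V :=
  foldl (fun g r => happ (vXtilde (- r - 1)) g) vac (part_modes s).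

Lemma vbeta_rcons s l : vbeta (rcons s l) = happ (vXtilde (l + 2 * size s)%N%:Z) (vbeta s).
Proof.
rewrite /vbeta part_modes_rcons foldl_rcons; move: (foldl _ _ _) => g.
by have -> : - (- (l + 2 * size s)%N%:Z - 1) - 1 = (l + 2 * size s)%N%:Z by lia.
Qed.

Lemma happ_hconst (A : hop V) v k : (forall j, A j 0 = 0) -> happ A (hconst v) k = A k v.
Proof.
move=> A0; rewrite /happ big_ord_recr /= subnn big1 ?add0r // => i _.
by case: (k - i)%N (subn_gt0 i k) => [|j _] /=; rewrite ?ltn_ord ?A0.
Qed.

(** The mode of index [-1] sends the vacuum to [e^alpha], and conjugation by [e^alpha]
    displaces the other modes by two.  This is the inclusion of the set of index [m]
    into the set of index [m - 1]. *)
Lemma vbeta_cons0 s : (fun k => shift 2 (vbeta s k)) = vbeta (0%N :: s).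
Proof.
elim/last_ind: s => [|s l IH].
  apply/funext => k; rewrite -[[:: 0%N]]/(rcons [::] 0%N) vbeta_rcons happ_hconst; last first.
    by move=> j; rewrite lin0 //; exact: flin_vXtilde.
  rewrite vXtilde_vac /vbeta /= /vac /hconst.
  by case: k => [|k]; [rewrite shiftU | rewrite lin0 //; exact: linear_shift].
rewrite -rcons_cons !vbeta_rcons -IH /=; apply/funext => k.
rewrite /happ (lin_sum (linear_shift F 2)); apply: eq_bigr => i _.
rewrite vXtilde_shift.
by have -> : (l + 2 * (size s).+1)%N%:Z - 2 = (l + 2 * size s)%N%:Z by lia.
Qed.

Lemma vbeta_parity s k : parity (vbeta s k) = vbeta s k.
Proof.
have lP := linear_parity F; elim/last_ind: s k => [|s l IH] k.
  by case: k => [|k]; rewrite /vbeta /vac /= ?parityU ?expr0z ?scale1r ?lin0.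
rewrite vbeta_rcons /happ (lin_sum lP); apply: eq_bigr => i _.
by have := twisted_vXtilde_parity F; rewrite -{2}IH => ->; rewrite subr0.
Qed.

Lemma charge_Hseq (c : int) nu v : charge F c v -> charge F c (Hseq nu v).
Proof. by move=> hv; elim: nu => //= k nu IH; apply: charge_Hop. Qed.

Lemma Hseq_shift (c : int) nu v : shift c (Hseq nu v) = Hseq nu (shift c v).
Proof. by elim: nu => //= k nu IH; rewrite -Hop_shift IH. Qed.

Notation top s := (fvec (onecm _) (2 * size s)%N%:Z).

(** Appending a part multiplies by [Yop] after a translation of the charge, and
    [Yop_Hseq] says that this respects leading terms for the dominance order. *)
Lemma vbeta_head s :
  in_span (fun b => exists2 nu, sdom nu s & b = Hseq nu (top s))
    (vbeta s 0%N - Hseq s (top s)).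
Proof.
elim/last_ind: s => [|s l IH]; first by rewrite /vbeta /= subrr.
set d := _ - _ in IH.
have cx : charge F (2 * size s)%N%:Z (vbeta s 0%N).
  rewrite -[vbeta s 0%N](subrK (Hseq s (top s))) -[_ + _]/(d + _) -[d]scale1r.
  apply: chargeP; last by apply: charge_Hseq; exact: charge_fvec.
  apply: IH => [|c u w|b [nu _ ->]]; [exact: charge0 | exact: chargeP |].
  by apply: charge_Hseq; exact: charge_fvec.
have topS : shift 2 (top s) = top (rcons s l).
  rewrite shiftU size_rcons; have -> // : (2 * size s)%N%:Z + 2 = (2 * (size s).+1)%N%:Z by lia.
have -> : vbeta (rcons s l) 0%N = Yop l (shift 2 (vbeta s 0%N)).
  rewrite vbeta_rcons /happ big_ord1 (vXtilde_charge _ _ cx).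
  by have -> : (l + 2 * size s)%N%:Z - (2 * size s)%N%:Z = l by lia.
have sv := singular_vac F (2 * size (rcons s l))%N%:Z.
rewrite -[vbeta s 0%N](subrK (Hseq s (top s))) -/d (linD (linear_shift F 2)).
rewrite (linD (linear_Yop F l)) -addrA; apply: spanD; last first.
  rewrite Hseq_shift topS; exact: Yop_Hseq.
apply: (span_linear (linear_comp (linear_Yop F l) (linear_shift F 2)) _ IH).
move=> b [nu hnu ->]; rewrite Hseq_shift topS.
rewrite -[Yop _ _](subrK (Hseq (rcons nu l) (top (rcons s l)))).
apply: spanD; last by apply: span_gen; exists (rcons nu l) => //; exact: sdom_rcons.
apply: (span_sub _ (@Yop_Hseq _ _ F nu l _ sv)) => b' [rho hrho ->]; apply: span_gen; exists rho => //.
by apply: sdom_trans (sdom_rcons l hnu); case: hrho.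
Qed.

End Monomials.

(** * A basis of the classical Fock space *)

(** The polynomial algebra in the [a_j(-r)]; the existence statement exposes its
    monomials and coefficients alone. *)
Lemma polynomial_algebra (K : fieldType) : exists (P : comAlgType K) (mon : heis_mon -> P)
    (cf : heis_mon -> P -> K^o),
  [/\ mon (onecm _) = 1, forall m m', mon (mulcm m m') = mon m * mon m',
      forall m, linear (cf m) & forall m m', cf m (mon m') = (m' == m)%:R].
Proof.
exists {malg K[heis_mon]}, (fun m => << m >>), (fun m g => g@_m); split.
- by [].
- by move=> m m'; rewrite malgM_def fgmulUU mulr1.
- by move=> m c u v; rewrite mcoeffD mcoeffZ.
- by move=> m m'; rewrite mcoeffU1.
Qed.

Section CourseOfValues.
Variables (T : Type) (x0 : T) (Phi : nat -> (nat -> T) -> T).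
Hypothesis Phi_ext : forall n f g, (forall l, (l < n)%N -> f l = g l) -> Phi n f = Phi n g.

Lemma course_of_values : exists f : nat -> T, forall n, f n = Phi n f.
Proof.
pose tab := fix tab n : nat -> T := if n is n'.+1 then
  (fun l => if l == n' then Phi n' (tab n') else tab n' l) else (fun=> x0).
have tabS n l : (l < n)%N -> tab n.+1 l = tab n l.
  by move=> ln /=; rewrite ltn_eqF.
have tabE n l : (l < n)%N -> tab n l = tab l.+1 l.
  elim: n => // n IH; rewrite ltnS leq_eqVlt => /predU1P[->//|ln].
  by rewrite tabS // IH.
exists (fun n => tab n.+1 n) => n /=; rewrite eqxx.
by apply: Phi_ext => l ln; rewrite tabE // /= eqxx.
Qed.

End CourseOfValues.

(** The monomial whose [j]-part is the partition [s], zero entries being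
    ignored. *)
Definition pmon (j : 'I_2) (s : seq nat) : heis_mon :=
  foldr (fun k m => if k is k'.+1 then mulcm (ucm (j, k')) m else m) (onecm _) s.

Lemma pmonE j s j' k : pmon j s (j', k) = ((j == j') * count_mem k.+1 s)%N.
Proof.
elim: s => [|[|n] s IH] /=; first by rewrite onecmE muln0.
  by rewrite IH.
by rewrite mulcmE ucmE IH xpair_eqE eqSS mulnDr mulnb.
Qed.

Lemma pmon_inj mu nu mu' nu' :
  mulcm (pmon j1 mu) (pmon j2 nu) = mulcm (pmon j1 mu') (pmon j2 nu') ->
  perm_eq (filter (leq 1) mu) (filter (leq 1) mu') /\
  perm_eq (filter (leq 1) nu) (filter (leq 1) nu').
Proof.
move=> e; have cnt j k := congr1 (fun m : heis_mon => m (j, k)) e.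
have perm s s' : (forall k, count_mem k.+1 s = count_mem k.+1 s') ->
    perm_eq (filter (leq 1) s) (filter (leq 1) s').
  move=> h; apply/allP => k _; apply/eqP; rewrite /= !count_filter.
  case: k => [|k]; last first.
    have E t : count (predI (pred1 k.+1) (leq 1)) t = count_mem k.+1 t.
      by apply: eq_count => x /=; case: eqP => // ->.
    by rewrite !E.
  by rewrite !(eq_count (a2 := pred0)) ?count_pred0 // => x /=; case: eqP => // ->.
by split; apply: perm => k;
  [have := cnt j1 k | have := cnt j2 k]; rewrite !mulcmE !pmonE /= ?mul0n ?mul1n ?addn0.
Qed.

Lemma sumsq_filter s : sumsq (filter (leq 1) s) = sumsq s.
Proof. by elim: s => [|[|x] s IH] //=; rewrite /sumsq /= -/(sumsq _) IH. Qed.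

Lemma sumn_filter_pos s : sumn (filter (leq 1) s) = sumn s.
Proof. by elim: s => [|[|x] s IH] //=; rewrite IH. Qed.

Lemma foldr_perm (T : eqType) (W : Type) (f : T -> W -> W) w s t :
  (forall x y w, f x (f y w) = f y (f x w)) -> perm_eq s t -> foldr f w s = foldr f w t.
Proof.
move=> fC st; pose Q u := foldr f w s = foldr f w u.
apply: (catCA_perm_ind (P := Q)) st _ => // s1 s2 s3; rewrite /Q !foldr_cat => ->.
elim: s1 {s3} (foldr f w s3) => //= x s1 IH z; rewrite IH.
by elim: s2 {IH} => //= y s2 IH; rewrite -IH fC.
Qed.

Section ClassicalBasis.
Variables (K : numFieldType) (V : lmodType K) (F : fock_rep V).
Implicit Types (v w : V) (mu nu la : seq nat) (c t : int).

Notation fvec := (fvec F).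
Notation heisen := (heisen F).
Notation a_neg j r := (heisen j (Negz r)).
Notation Hop := (Hop F).
Notation gop := (gop F).
Notation Hseq := (Hseq F).

(** The classical limit [a_1(-r) + a_2(-r)] of [kappa^(-r)]. *)
Definition Cop (r : nat) : V -> V := fun v => a_neg j1 r.-1 v + a_neg j2 r.-1 v.
Definition Cseq mu v : V := foldr Cop v mu.
Definition Mvec mu nu c : V := Cseq mu (Hseq nu (fvec (onecm _) c)).

Lemma CopE r v : Cop r v = a_neg j1 r.-1 v + a_neg j2 r.-1 v. Proof. by []. Qed.

Lemma MvecE mu nu c : Mvec mu nu c = Cseq mu (Hseq nu (fvec (onecm _) c)).
Proof. by []. Qed.

Lemma linear_Cop r : linear (Cop r).
Proof. by apply: linear_add; exact: linear_heisen. Qed.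

Lemma linear_Cseq mu : linear (Cseq mu).
Proof. by elim: mu => [|r mu IH] //; apply: linear_comp => //; exact: linear_Cop. Qed.

Lemma Cop_comm r q v : Cop r (Cop q v) = Cop q (Cop r v).
Proof.
rewrite /Cop !(linD (linear_heisen F _ _)) !(heisen_negC F j2 r.-1) !(heisen_negC F j1 r.-1).
by rewrite [RHS]addrACA.
Qed.

Lemma Hop_Cop n r v : Hop n (Cop r v) = Cop r (Hop n v).
Proof. by rewrite /Cop (linD (linear_Hop F n)) !Hop_a_neg. Qed.

Lemma Hop_Cseq n mu v : Hop n (Cseq mu v) = Cseq mu (Hop n v).
Proof.
by elim: mu v => [|r mu IH] v //=; rewrite Hop_Cop IH.
Qed.

Lemma Cseq_perm mu mu' v : perm_eq mu mu' -> Cseq mu v = Cseq mu' v.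
Proof. by apply: foldr_perm; exact: Cop_comm. Qed.

Lemma Hseq_perm nu nu' v : perm_eq nu nu' -> Hseq nu v = Hseq nu' v.
Proof. by apply: foldr_perm => x y w; exact: Hop_comm. Qed.

Lemma Hseq_filter nu v : Hseq (filter (leq 1) nu) v = Hseq nu v.
Proof. by elim: nu => [|[|k] nu IH] //=; rewrite ?Hop0 IH. Qed.

(** ** Linear independence *)

(** The linear map to polynomials in two families of variables that turns the
    operators [Cop r] and [Hop r] into multiplication by the variables: it exists
    because the power sums are polynomials in the complete symmetric functions. *)
Section Coordinates.
Variables (P : comAlgType K) (X : 'I_2 -> nat -> P) (c : int).

Let X2 (k : int) : P := if k is Posz k' then if k' is k''.+1 then X j2 k'' else 1 else 0.

Lemma newton_solution : exists G : nat -> P, forall r : nat,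
  \sum_(1 <= l < r.+1) G l * X2 (r%:Z - l%:Z) = r%:R * X2 r.
Proof.
have [|G hG] := @course_of_values P 0
  (fun r G => r%:R * X2 r - \sum_(1 <= l < r) G l * X2 (r%:Z - l%:Z)).
- move=> n f g fg; congr (_ - _); apply: eq_big_nat => l /andP[_ ln].
  by rewrite fg.
- exists G => -[|r]; first by rewrite big_geq // mul0r.
  by rewrite big_nat_recr //= subrr mulr1 [G r.+1]hG addrC subrK.
Qed.

Definition ev (y : 'I_2 * nat -> P) (m : heis_mon) : P := \prod_(x <- finsupp m) y x ^+ m x.

Lemma evEw y (m : heis_mon) (d : {fset 'I_2 * nat}) : {subset finsupp m <= d} ->
  ev y m = \prod_(x <- d) y x ^+ m x.
Proof.
move=> /fsubsetP le; rewrite /ev (big_fset_incl _ le) //.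
by move=> x _; rewrite -cmE_neq0 negbK => /eqP ->.
Qed.

Lemma ev_mul y (m : heis_mon) x : ev y (mulcm m (ucm x)) = y x * ev y m.
Proof.
pose d := (finsupp m `|` [fset x] `|` finsupp (mulcm m (ucm x)))%fset.
have xd : x \in d by rewrite !inE eqxx ?orbT.
rewrite !(@evEw _ _ d); try by move=> z zm; rewrite !inE zm ?orbT.
rewrite !(big_fsetD1 x xd) /= mulcmE ucmE eqxx addn1 exprS -!mulrA; congr (_ * (_ * _)).
apply: eq_big_seq => z; rewrite !inE => /andP[zx _].
by rewrite mulcmE ucmE eq_sym (negbTE zx) addn0.
Qed.

Lemma coordinates : exists2 Phi : V -> P, linear Phi &
  [/\ forall s, Phi (fvec (onecm _) s) = (s == c)%:R,
      forall r v, (0 < r)%N -> Phi (Cop r v) = X j1 r.-1 * Phi v &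
      forall (n : nat) v, Phi (Hop n v) = X2 n * Phi v].
Proof.
have [G hG] := newton_solution.
pose y (x : 'I_2 * nat) : P := 2^-1 *: (X j1 x.2 + (if x.1 == j1 then -1 else 1) * G x.2.+1).
have [Phi lPhi PhiU] := fvec_free F (fun m s => (s == c)%:R *: ev y m).
have Phi_a j r v : Phi (a_neg j r v) = y (j, r) * Phi v.
  apply: (fvec_ext (F := F) (linear_comp lPhi (linear_heisen F j _))
    (g := fun v => y (j, r) * Phi v)).
    by move=> a u w; rewrite lPhi mulrDr scalerAr.
  by move=> m s; rewrite heisen_negU !PhiU ev_mul scalerAr.
have n2 : 2%:R != 0 :> K by rewrite pnatr_eq0.
have half (p : P) : 2^-1 *: (p + p) = p.
  by rewrite -mulr2n -scaler_nat scalerA mulVf ?scale1r.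
have PhiC r v : (0 < r)%N -> Phi (Cop r v) = X j1 r.-1 * Phi v.
  move=> r0; rewrite /Cop (linD lPhi) !Phi_a -mulrDl /y /= -scalerDr.
  by rewrite mulN1r mul1r addrACA addNr addr0 half.
have PhiG r v : (0 < r)%N -> Phi (gop r v) = G r * Phi v.
  move=> r0; rewrite /gop (linB lPhi) !Phi_a -mulrBl /y /= -scalerBr prednK //.
  by rewrite mulN1r mul1r opprD opprK addrACA subrr add0r half.
have PhiH (n : nat) v : Phi (Hop n v) = X2 n * Phi v.
  have [N] := ubnP n; elim: N n => // N IH [|n] nN; first by rewrite Hop0 mul1r.
  have n0 : n.+1%:R != 0 :> K by rewrite pnatr_eq0.
  apply: (scalerI n0); rewrite -(linZ lPhi).
  have -> : n.+1%:R *: Hop n.+1 v = _ := @Hop_newton _ _ F n.+1 n.+1 v (lexx _).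
  rewrite (lin_sum lPhi).
  transitivity ((\sum_(1 <= l < n.+2) G l * X2 (n.+1%:Z - l%:Z)) * Phi v).
    rewrite mulr_suml; apply: eq_big_nat => l /andP[l0 ln]; rewrite PhiG //.
    have -> : n.+1%:Z - l%:Z = (n.+1 - l)%N by lia.
    by rewrite IH ?mulrA //; lia.
  by rewrite hG scaler_nat mulr_natl mulrnAl.
exists Phi => //; split=> // s.
by rewrite PhiU /ev mdom1 big_seq_fset0 scaler_nat.
Qed.

End Coordinates.

End ClassicalBasis.

Definition partition (s : seq nat) : bool := all (leq 1) s && sorted leq s.

Lemma partition_filter s : partition s -> filter (leq 1) s = s.
Proof. by case/andP => /all_filterP. Qed.

Lemma partition_perm s t : partition s -> partition t -> perm_eq s t -> s = t.
Proof.
by move=> /andP[_ hs] /andP[_ ht]; apply: (sorted_eq leq_trans anti_leq).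
Qed.

Definition normalize (s : seq nat) : seq nat := sort leq (filter (leq 1) s).

Lemma partition_normalize s : partition (normalize s).
Proof.
rewrite /partition sort_sorted ?andbT; last exact: leq_total.
by rewrite all_sort filter_all.
Qed.

Lemma normalize_perm s : perm_eq (normalize s) (filter (leq 1) s).
Proof. by rewrite perm_sort. Qed.

Section ClassicalBasisTheorem.
Variables (K : numFieldType) (V : lmodType K) (F : fock_rep V).
Implicit Types (v w : V) (mu nu la : seq nat) (c t : int).

Notation fvec := (fvec F).
Notation shift := (shift F).
Notation a_neg j r := (heisen F j (Negz r)).
Notation Hop := (Hop F).
Notation gop := (gop F).
Notation Cop := (Cop F).
Notation Hseq := (Hseq F).
Notation Cseq := (Cseq F).
Notation Mvec := (Mvec F).
Notation vbeta := (vbeta F).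

(** The classical limits of the elements of the proposed basis. *)
Definition Wvec mu t la : V := Cseq mu (shift t (vbeta la 0%N)).

Lemma Wvec_head mu t la c : c = (2 * size la)%N%:Z + t ->
  in_span (fun b => exists2 nu, sdom nu la & b = Mvec mu nu c)
    (Wvec mu t la - Mvec mu la c).
Proof.
move=> ->; rewrite /Wvec !MvecE -shiftU -Hseq_shift.
rewrite -(linB (linear_Cseq F mu)) -(linB (linear_shift F t)).
apply: (span_linear (linear_comp (linear_Cseq F mu) (linear_shift F t)) _ (@vbeta_head _ _ F la)).
move=> b [nu hnu ->]; apply: span_gen; exists nu => //.
by rewrite Hseq_shift shiftU.
Qed.

(** Under [coordinates] the vectors [Mvec mu nu c0] become monomials, which the
    coefficients separate. *)
Lemma Mvec_dual mu0 nu0 c0 : all (leq 1) mu0 -> exists2 ell : V -> K^o, linear ell &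
  forall mu nu c, all (leq 1) mu -> ell (Mvec mu nu c) =
    ([&& c == c0, perm_eq mu mu0 & perm_eq (filter (leq 1) nu) (filter (leq 1) nu0)])%:R.
Proof.
move=> h0; have [P [mon [cf [mon1 monM lcf cfE]]]] := polynomial_algebra K.
pose X j k := mon (ucm (j, k)).
have [Phi lPhi [Phi1 PhiC PhiH]] := coordinates F X c0.
have PhiHs nu v : Phi (Hseq nu v) = mon (pmon j2 nu) * Phi v.
  elim: nu => [|[|k] nu IH] /=; first by rewrite mon1 mul1r.
    by rewrite Hop0 IH.
  by rewrite PhiH IH /X monM mulrA.
have PhiCs mu v : all (leq 1) mu -> Phi (Cseq mu v) = mon (pmon j1 mu) * Phi v.
  elim: mu => [|[|k] mu IH] //=; first by rewrite mon1 mul1r.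
  by move=> h; rewrite PhiC // IH // /X monM mulrA.
exists (fun v => cf (mulcm (pmon j1 mu0) (pmon j2 nu0)) (Phi v)).
  exact: linear_comp.
move=> mu nu c hmu; rewrite !MvecE PhiCs // PhiHs Phi1 mulrA -monM.
case: (c == c0); last by rewrite mulr0 (lin0 (lcf _)).
rewrite mulr1 cfE; congr (_%:R); congr nat_of_bool.
apply/eqP/and3P => [|[_ p1 p2]].
  by move=> /pmon_inj; rewrite (all_filterP hmu) (all_filterP h0) => -[-> ->].
have pm j s s' : perm_eq (filter (leq 1) s) (filter (leq 1) s') -> pmon j s = pmon j s'.
  move=> p; apply/eqP/cmP => -[j' k]; rewrite !pmonE; congr (_ * _)%N.
  have E u : count_mem k.+1 u = count_mem k.+1 (filter (leq 1) u).
    by rewrite count_filter; apply: eq_count => x /=; case: eqP => // ->.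
  by rewrite E [RHS]E (permP p).
by rewrite (pm j1 mu mu0) ?(pm j2 nu nu0) // (all_filterP hmu) (all_filterP h0).
Qed.

(** By [Wvec_head] and [sumsq_sdom] the functionals of [Mvec_dual] are triangular on the
    vectors [Wvec], for the sum of squares of the second partition. *)
Lemma Wvec_dual mu0 la0 c0 : partition mu0 -> partition la0 ->
  exists2 ell : V -> K^o, linear ell &
  forall mu t la, partition mu -> partition la -> (sumsq la0 <= sumsq la)%N ->
    ell (Wvec mu t la) = ([&& (2 * size la)%N%:Z + t == c0, mu == mu0 & la == la0])%:R.
Proof.
move=> hmu0 hla0; have [|ell lell ellM] := @Mvec_dual mu0 la0 c0; first by case/andP: hmu0.
exists ell => // mu t la hmu hla sq; set c := _ + t.
have amu : all (leq 1) mu by case/andP: hmu.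
have H : ell (Wvec mu t la - Mvec mu la c) = 0.
  apply: (@Wvec_head mu t la c erefl (fun v => ell v = 0)).
  - by rewrite lin0.
  - by move=> a u w hu hw; rewrite lell hu hw scaler0 addr0.
  - move=> b [nu hnu ->]; rewrite ellM //; case: and3P => // -[_ _ p].
    have sla : sorted leq la by case/andP: hla.
    have := sumsq_sdom sla hnu; rewrite -(sumsq_filter nu) (sumsq_perm p) sumsq_filter.
    by rewrite ltnNge sq.
rewrite -[Wvec _ _ _](subrK (Mvec mu la c)) (linD lell) H add0r ellM //.
congr (_%:R); congr nat_of_bool; rewrite !partition_filter //; congr [&& _, _ & _].
  by apply/idP/eqP => [/(partition_perm hmu hmu0)|->].
by apply/idP/eqP => [/(partition_perm hla hla0)|->].
Qed.

(** The functional dual to a term of least sum of squares kills all the others. *)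
Lemma Wvec_free n (a : 'I_n -> K) (p : 'I_n -> seq nat * int * seq nat) :
  injective p -> (forall j, partition (p j).1.1 && partition (p j).2) ->
  \sum_(j < n) a j *: Wvec (p j).1.1 (p j).1.2 (p j).2 = 0 -> forall j, a j = 0.
Proof.
move=> pinj ppart sum0 j; apply/eqP; apply/negPn/negP => aj.
case: (@arg_minnP _ j (fun j => a j != 0) (fun j => sumsq (p j).2) aj) => j0 aj0 jmin.
pose mu0 := (p j0).1.1; pose la0 := (p j0).2; pose c0 := (2 * size la0)%N%:Z + (p j0).1.2.
have /andP[hmu0 hla0] := ppart j0.
have [ell lell ellW] := @Wvec_dual mu0 la0 c0 hmu0 hla0.
have := congr1 ell sum0; rewrite (lin_sum lell) (lin0 lell) (bigD1 j0) //= big1 ?addr0.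
  by rewrite (linZ lell) ellW // !eqxx /= => /eqP; rewrite scaler_eq0 (negbTE aj0) oner_eq0.
move=> l lj0; rewrite (linZ lell).
have [->|al] := eqVneq (a l) 0; first by rewrite scale0r.
have /andP[hmu hla] := ppart l; rewrite ellW //; last exact: jmin.
case: and3P => [[/eqP e1 /eqP e2 /eqP e3]|_]; last by rewrite scaler0.
case/eqP: lj0; apply: pinj; move: e1 e2 e3; rewrite /c0 /mu0 /la0.
case: (p l) => [[? ?] ?]; case: (p j0) => [[? ?] ?] /= e1 e2 e3; subst.
by move/addrI: e1 => ->.
Qed.

(** ** Spanning *)

Definition Wset c b : Prop := exists mu t la,
  [/\ partition mu, partition la, (2 * size la)%N%:Z + t = c & b = Wvec mu t la].

(** The difference between [Mvec] and [Wvec] involves larger sums of squares only, and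
    these are bounded by the square of the sum of the parts. *)
Lemma Mvec_span mu la c : all (leq 1) mu -> in_span (Wset c) (Mvec mu la c).
Proof.
have [N] := ubnP ((sumn la) ^ 2 - sumsq la)%N.
elim: N mu la => // N IH mu la laN hmu.
have pm := normalize_perm mu; have pl := normalize_perm la.
have eqM : Mvec (normalize mu) (normalize la) c = Mvec mu la c.
  rewrite !MvecE (Cseq_perm _ _ pm) (Hseq_perm _ _ pl) Hseq_filter.
  by rewrite (all_filterP hmu).
rewrite -eqM; pose t := c - (2 * size (normalize la))%N%:Z.
have ct : c = (2 * size (normalize la))%N%:Z + t by rewrite addrC subrK.
rewrite -[Mvec _ _ _](subKr (Wvec (normalize mu) t (normalize la))); apply: spanB.
  by apply: span_gen; exists (normalize mu), t, (normalize la); split=> //;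
    exact: partition_normalize.
apply: (span_sub _ (@Wvec_head (normalize mu) t (normalize la) c ct)).
move=> b [nu hnu ->]; apply: IH; last by case/andP: (partition_normalize mu).
have sla : sorted leq (normalize la) by case/andP: (partition_normalize la).
have := sumsq_sdom sla hnu; rewrite (sumsq_perm pl) sumsq_filter => lt.
have e : sumn nu = sumn la.
  by case: hnu => -[_ -> _] _; rewrite (perm_sumn pl) sumn_filter_pos.
have := sumsq_le nu; rewrite e; lia.
Qed.

Definition Mset c b : Prop := exists mu nu, all (leq 1) mu /\ b = Mvec mu nu c.

Lemma Mset_Cop c (r : nat) v : (0 < r)%N -> in_span (Mset c) v -> in_span (Mset c) (Cop r v).
Proof.
move=> r0; apply: span_linear; first exact: linear_Cop.
move=> b [mu [nu [hmu ->]]]; apply: span_gen; exists (r :: mu), nu; split=> //=.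
by rewrite r0.
Qed.

Lemma Mset_Hop c (n : nat) v : in_span (Mset c) v -> in_span (Mset c) (Hop n v).
Proof.
apply: span_linear; first exact: linear_Hop.
move=> b [mu [nu [hmu ->]]]; apply: span_gen; exists mu, (n :: nu); split=> //=.
by rewrite !MvecE Hop_Cseq.
Qed.

(** Newton's identity, solved for the power sum of highest index. *)
Lemma Mset_gop c (r : nat) v : in_span (Mset c) v -> in_span (Mset c) (gop r.+1 v).
Proof.
have [N] := ubnP r; elim: N r v => // N IH r v rN hv.
have := @Hop_newton _ _ F r.+1 r.+1 v (lexx _); rewrite big_nat_recr //= subrr Hop0 => e.
rewrite -[gop _ _](addKr (\sum_(1 <= l < r.+1) gop l (Hop (r.+1%:Z - l%:Z) v))) -e.
apply: spanD; last by apply: spanZ; exact: Mset_Hop.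
apply: spanN; rewrite big_nat_cond; apply: span_sum => -[|l] //; rewrite andbT ltnS => lr.
have -> : r.+1%:Z - l.+1%:Z = (r - l)%N by lia.
by apply: IH; [lia | exact: Mset_Hop].
Qed.

Lemma Mset_a_neg c j (r : nat) v : in_span (Mset c) v -> in_span (Mset c) (a_neg j r v).
Proof.
move=> hv; have hC := Mset_Cop (ltn0Sn r) hv; have hG := Mset_gop r hv.
have n2 : 2%:R != 0 :> K by rewrite pnatr_eq0.
have half w : w = 2^-1 *: (w + w) by rewrite -mulr2n -scaler_nat scalerA mulVf ?scale1r.
have [->|->] : j = j1 \/ j = j2.
  by case: j => [[|[|//]] hj]; [left | right]; apply: val_inj.
- rewrite (half (a_neg j1 r v)).
  have -> : a_neg j1 r v + a_neg j1 r v = Cop r.+1 v - gop r.+1 v.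
    by rewrite CopE gopE /= opprB addrACA subrr addr0.
  by apply: spanZ; exact: spanB.
- rewrite (half (a_neg j2 r v)).
  have -> : a_neg j2 r v + a_neg j2 r v = Cop r.+1 v + gop r.+1 v.
    by rewrite CopE gopE /= (addrC (a_neg j1 r v)) addrACA subrr addr0.
  by apply: spanZ; exact: spanD.
Qed.

Lemma fvec_induction (Q : V -> Prop) c : Q (fvec (onecm _) c) ->
  (forall j r v, Q v -> Q (a_neg j r v)) -> forall m, Q (fvec m c).
Proof.
move=> Q1 Qa m; have [N] := ubnP (mdeg m); elim: N m => // N IH m mN.
have [->|m1] := eqVneq m (onecm _); first by [].
have [x mx] : exists x, m x != 0%N.
  apply: contrapT => h; case/eqP: m1; apply/eqP/cmP => x.
  by rewrite onecmE; apply/eqP; apply/negPn/negP => mx; apply: h; exists x.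
case: x mx => j r mx; rewrite -(divcmK mx) -heisen_negU; apply: Qa; apply: IH.
have e : mdeg m = (mdeg (divcm m (ucm (j, r))) + 1)%N.
  by rewrite -[in LHS](divcmK mx) [LHS]mdegM mdegU.
by move: mN; rewrite e addn1 ltnS.
Qed.

Lemma Wvec_span m c : in_span (Wset c) (fvec m c).
Proof.
apply: (span_sub (B := Mset c)) => [b [mu [nu [hmu ->]]]|]; first exact: Mvec_span.
move: m; apply: (@fvec_induction (in_span (Mset c))).
  by apply: span_gen; exists [::], [::].
by move=> j r v; exact: Mset_a_neg.
Qed.

End ClassicalBasisTheorem.

(** * Leading coefficients of the vertex operators *)

Section ZeroPreserving.
Variables (K : fieldType) (V : lmodType K).
Implicit Types (A B : fld V) (v w : V) (n s : int).

Lemma fzeroP A : twisted (fun=> 0) 0 A <-> fzero A.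
Proof. by split=> [h n k|h n k v]; [exact: (h n k 0) | exact: h]. Qed.

Let zc := @sum_compatible_zero K V.

Lemma fzero_fmul A B : fzero A -> fzero B -> fzero (fmul A B).
Proof.
by move=> /fzeroP hA /fzeroP hB; apply/fzeroP; exact: (twisted_fmul zc hA hB).
Qed.

Lemma fzero_finv A : fzero A -> fzero (finv A).
Proof. by move=> /fzeroP hA; apply/fzeroP; apply: (twisted_finv zc). Qed.

Lemma fzero_fone : fzero (@fone K V).
Proof. exact: flin_fzero (@flin_fone K V). Qed.

Lemma fzero_fsub A B : fzero A -> fzero B -> fzero (fsub A B).
Proof. by move=> hA hB n k; rewrite /fsub hA hB subrr. Qed.

Lemma fmul0_delta A B n s v w : fzero A ->
  (forall q, B q 0%N v = if q == s then w else 0) -> fmul A B n 0%N v = A (n - s) 0%N w.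
Proof.
move=> zA hB; rewrite fmul0E (@fsum_single _ _ _ s) // ?hB ?eqxx // => q _ /negbTE qs.
by rewrite hB qs zA.
Qed.

Lemma fone0E q v : @fone K V q 0%N v = if q == 0 then v else 0.
Proof. by []. Qed.

Lemma fmul0_one A B n v : fzero A -> (forall q, B q 0%N v = fone q 0%N v) ->
  fmul A B n 0%N v = A n 0%N v.
Proof. by move=> zA hB; rewrite (@fmul0_delta A B n 0 v v) ?subr0. Qed.

Lemma finv0_one A v : fzero A -> (forall q, A q 0%N v = fone q 0%N v) ->
  forall q, finv A q 0%N v = fone q 0%N v.
Proof.
move=> zA hA; have zN : fzero (fsub (@fone K V) A) by apply: fzero_fsub => //; exact: fzero_fone.
have Nv q : fsub (@fone K V) A q 0%N v = 0 by rewrite /fsub hA subrr.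
have pv m q : fpow (fsub (@fone K V) A) m.+1 q 0%N v = 0.
  elim: m q => [|m IH] q; rewrite fpowS; first by rewrite fmul0_one.
  by rewrite fmul0E fsbig1 // => p _; rewrite IH zN.
move=> q; rewrite /finv (@fsum_single _ _ _ 0%N) // => -[|m] _ // _; exact: pv.
Qed.

Lemma finv00 A v : fzero A -> window 1 A -> (forall w, A 0 0%N w = w) ->
  finv A 0 0%N v = v.
Proof.
move=> zA wA hA; have zN : fzero (fsub (@fone K V) A).
  by apply: fzero_fsub => //; exact: fzero_fone.
have wN : window 1 (fsub (@fone K V) A) by apply: window_fsub => //; exact: window_fone.
rewrite /finv (@fsum_single _ _ _ 0%N) // => -[|m] _ // _.
rewrite fpowS fmul0E fsbig1 // => q _; have [->|q0] := eqVneq q 0.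
  by rewrite subr0 /fsub /fone eqxx hA subrr.
have [h|h] := ltP q 0.
  by rewrite (window_fpow m zN wN) ?zN // mul1r.
by apply: wN; rewrite mul1r sub0r oppr_lt0 lt_neqAle eq_sym q0.
Qed.

(** The powers beyond the first are of order [h^2]. *)
Lemma fexp_h1 A n v : flin A -> (forall q w, A q 0%N w = 0) -> fexp A n 1%N v = A n 1%N v.
Proof.
move=> lA A0; rewrite /fexp (@fsum_single _ _ _ 1%N) //.
  by rewrite fpowS fpow0 fmul_fone // invr1 scale1r.
have p0 m q w : fpow A m.+1 q 0%N w = 0.
  by rewrite fpowS fmul0E fsbig1 // => p _; exact: A0.
move=> [|[|m]] _ // _.
  by rewrite fpow0 /fone; case: eqP => _; rewrite scaler0.
rewrite fpowS /fmul big_ord_recl big_ord1 !fsbig1 ?addr0 ?scaler0 // => q _.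
by rewrite [X in A _ _ X]p0 lin0.
Qed.

End ZeroPreserving.

Section Values.
Variables (K : numFieldType) (V : lmodType K) (F : fock_rep V).
Implicit Types (v w : V) (n s t : int).

Notation fvec := (fvec F).
Notation heisen := (heisen F).
Notation shift := (shift F).
Notation vopartial := (vopartial F).
Notation vupartial := (vupartial F).

Lemma vupartial_Nalpha q s v : charge F s v ->
  vupartial (- alpha) q 0%N v = if q == - s then v else 0.
Proof.
move=> hv; rewrite vupartial_h0 hv form_Nalpha -intrN eqr_int eq_sym.
by case: eqP; rewrite ?scale1r ?scale0r.
Qed.

Lemma vXalpha_top s : vXalpha F s 0%N (fvec (onecm _) s) = fvec (onecm _) (s + 2).
Proof.
set v := fvec _ s; set w := fvec _ (s + 2).
have hw : singular F w by exact: singular_vac.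
have lS := linear_shift F 2; have zE := flin_fzero (flin_vcalE F).
have zEp := flin_fzero (flin_vEplus F).
have Z q : fmul (vconst (shift 2)) (fmul (vupartial alpha) (vopartial 1 1)) q 0%N v =
    if q == s then w else 0.
  rewrite fmul_vconst // fmul0_one; [|exact: flin_fzero (flin_vupartial F _)|].
    rewrite (vupartial_charge _ _ (charge_fvec _ _ _)) andbT.
    by case: eqP => _; [rewrite shiftU | rewrite lin0].
  by move=> p; exact: vopartial_h0.
have Z2 q : fmul (vEplus F) (fmul (vconst (shift 2))
    (fmul (vupartial alpha) (vopartial 1 1))) q 0%N v = if q == s then w else 0.
  by rewrite (fmul0_delta _ zEp Z) vEplus_singular // fone0E subr_eq0.
by rewrite /vXalpha (fmul0_delta _ zE Z2) subrr vcalE_u0.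
Qed.

Lemma vXmalpha_top s : vXmalpha F (- s) 0%N (fvec (onecm _) s) = fvec (onecm _) (s - 2).
Proof.
set v := fvec _ s; set w := fvec _ (s - 2).
have hw : singular F w by exact: singular_vac.
have lS := linear_shift F (-2); have lE := flin_vcalE F; have lEp := flin_vEplus F.
have lh c k : linear (hscale c (@hone K V) k).
  by apply: linear_scale; exact: linear_hone.
have zE c : fzero (sh c (vcalE F)) by apply: flin_fzero; exact: flin_fshift.
have zEp c : fzero (sh c (vEplus F)) by apply: flin_fzero; exact: flin_fshift.
have Z q : fmul (vconst (shift (-2))) (fmul (vupartial (- alpha))
    (fmul (vopartial (- 2^-1) (-1)) (vopartial 2^-1 (-1)))) q 0%N v =
    if q == - s then w else 0.
  rewrite fmul_vconst // fmul0_one; [|exact: flin_fzero (flin_vupartial F _)|].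
    rewrite (vupartial_Nalpha _ (charge_fvec _ _ _)).
    by case: eqP => _; [rewrite shiftU | rewrite lin0].
  move=> p; rewrite fmul0_one ?vopartial_h0 //.
    exact: flin_fzero (flin_vopartial F _ _).
  by move=> p'; exact: vopartial_h0.
have Z2 q : fmul (finv (sh (- 2^-1) (vEplus F))) (fmul (vconst (shift (-2)))
    (fmul (vupartial (- alpha)) (fmul (vopartial (- 2^-1) (-1)) (vopartial 2^-1 (-1)))))
    q 0%N v = if q == - s then w else 0.
  rewrite (fmul0_delta _ (fzero_finv (zEp _)) Z) finv0_one //.
    by rewrite fone0E subr_eq0.
  by move=> p; rewrite /sh fshift0 // vEplus_singular.
rewrite /vXmalpha (fmul0_delta _ (fzero_finv (zE _)) Z2) subrr finv00 //.
  by apply: window_fshift; exact: window_vcalE.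
by move=> u; rewrite /sh fshift0 // vcalE_u0.
Qed.

Definition kminus_log (a b : K) (j : 'I_2) : fld V := fun n k v =>
  \sum_(r \in [set r : nat | (0 < r)%N])
    ((upow a r n k - upow b r n k) / r%:R) *: heisen j (- r%:Z) v.

Lemma kminus_h1 a b j (r : nat) v :
  fexp (kminus_log a b j) r 1%N v = (a - b) *: heisen j (Negz r) v.
Proof.
rewrite fexp_h1.
- have r0 : r.+1%:R != 0 :> K by rewrite pnatr_eq0.
  rewrite /kminus_log (@fsum_single _ _ _ r.+1) // => [|q _ /eqP qr]; last first.
    by rewrite !upow_eq0 ?subrr ?mul0r ?scale0r //; apply/eqP => e; apply: qr; lia.
  have U (x : K) : upow x r.+1 r 1 = r.+1%:R * x.
    by rewrite /upow ifT; [rewrite gbin1 expr1 | apply/eqP; lia].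
  by rewrite !U -mulrBr [_ * (a - b)]mulrC mulfK // -NegzE.
- move=> n k; apply: linear_fsum_set => [q|w].
    by apply: linear_scale; exact: linear_heisen.
  exists [:: `|(n + k%:Z)%R|%N] => q _; rewrite inE => /eqP hq.
  by rewrite !upow_eq0 ?subrr ?mul0r ?scale0r //; apply/eqP => e; apply: hq; lia.
- by move=> q w; apply: fsbig1 => p _; rewrite !upow_h0 subrr mul0r scale0r.
Qed.

Lemma vk1minus_h1 (r : nat) v : vk1minus F r 1%N v = heisen j2 (Negz r) v.
Proof.
rewrite -[vk1minus F]/(fexp (kminus_log 1 0 j2)) kminus_h1.
by rewrite subr0 scale1r.
Qed.

Lemma vk2minus_h1 (r : nat) v : vk2minus F r 1%N v = heisen j1 (Negz r) v.
Proof.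
rewrite -[vk2minus F]/(fexp (kminus_log 0 (-1) j1)) kminus_h1.
by rewrite opprK add0r scale1r.
Qed.

End Values.

(** * Level one modules over the double Yangian *)

(** If [g] commutes with [G B] (or [B G]) and with [G], where [G = 1 + O(h)], then
    it commutes with [B]: solve for the coefficients of [B] by induction on the
    power of [h].  The product need only be controlled where [B] is nonzero. *)
Section Cancellation.
Variables (K : fieldType) (V : lmodType K) (g : V -> V) (gc : sum_compatible g).
Implicit Types (G B T : fld V).

Let gl : linear g. Proof. by case: gc. Qed.
Let gS : forall (I : choiceType) (D : set I) (f : I -> V),
  g (\sum_(i \in D) f i) = \sum_(i \in D) g (f i).
Proof. by case: gc. Qed.

Lemma twisted_cancel_l G B : fzero G -> (forall n v, G n 0%N v = fone n 0%N v) ->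
  twisted g 0 G ->
  (forall n, (forall k v, B n k v = 0) \/ htwisted g (fmul G B n)) -> twisted g 0 B.
Proof.
move=> zG G0 gG hB; apply/twisted0P => n k; have [N] := ubnP k.
elim: N k n => // N IH k n kN v; case: (hB n) => [B0|hn]; first by rewrite !B0 lin0.
pose R w : V := \sum_(i < k) \sum_(m \in [set: int]) G (n - m) i.+1 (B m (k - i.+1)%N w).
have split w : fmul G B n k w = B n k w + R w.
  rewrite /fmul big_ord_recl; congr (_ + _).
  rewrite (@fsum_single _ _ _ n) // => [|m _ mn]; first by rewrite subrr G0 subn0.
  by rewrite G0 /fone subr_eq0 eq_sym (negbTE mn).
have Rg : R (g v) = g (R v).
  rewrite /R (lin_sum gl); apply: eq_bigr => i _; rewrite gS; apply: eq_fsbigr => m _.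
  have [_ gG'] := twisted0P g G; rewrite IH; last by have := ltn_ord i; lia.
  by have := gG (n - m) i.+1 (B m (k - i.+1)%N v); rewrite subr0.
by have := hn k v; rewrite !split (linD gl) Rg => /addIr.
Qed.

Lemma twisted_cancel_r G B : fzero B -> (forall n v, G n 0%N v = fone n 0%N v) ->
  twisted g 0 G ->
  (forall n, (forall k v, B n k v = 0) \/ htwisted g (fmul B G n)) -> twisted g 0 B.
Proof.
move=> zB G0 gG hB; apply/twisted0P => n k; have [N] := ubnP k.
elim: N k n => // N IH k n kN v; case: (hB n) => [B0|hn]; first by rewrite !B0 lin0.
pose R w : V := \sum_(i < k) \sum_(m \in [set: int]) B (n - m) i (G m (k - i)%N w).
have split w : fmul B G n k w = R w + B n k w.
  rewrite /fmul big_ord_recr /= subnn; congr (_ + _).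
  rewrite (@fsum_single _ _ _ 0) // => [|m _ /negbTE m0]; first by rewrite G0 subr0.
  by rewrite G0 /fone m0 zB.
have Rg : R (g v) = g (R v).
  rewrite /R (lin_sum gl); apply: eq_bigr => i _; rewrite gS; apply: eq_fsbigr => m _.
  rewrite -IH; last by have := ltn_ord i; lia.
  by have := gG m (k - i)%N v; rewrite subr0 => ->.
by have := hn k v; rewrite !split (linD gl) Rg => /addrI.
Qed.

(** The substitution [u := u + c h] is unitriangular in the powers of [h]. *)
Lemma twisted_unshift T c : fzero T -> htwisted g c -> twisted g 0 (fshift T c) ->
  twisted g 0 T.
Proof.
move=> zT gc' hT; apply/twisted0P => n k; have [N] := ubnP k.
elim: N k n => // N IH k n kN v.
pose R w : V := \sum_(l < k) gbin (n + l.+1%:Z)%:~R l.+1 *: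
  hcomp (T (n + l.+1%:Z)) (hexp c l.+1) (k - l.+1)%N w.
have split w : fshift T c n k w = T n k w + R w.
  rewrite /fshift big_ord_recl; congr (_ + _).
  by rewrite gbin0 scale1r addr0 subn0 hcomp_hone // => j; exact: zT.
have Rg : R (g v) = g (R v).
  rewrite /R (lin_sum gl); apply: eq_bigr => l _; rewrite (linZ gl); congr (_ *: _).
  rewrite /hcomp (lin_sum gl); apply: eq_bigr => i _.
  rewrite (htwisted_hexp gl _ gc') IH //; have := ltn_ord l; have := ltn_ord i; lia.
by have := hT n k v; rewrite subr0 !split (linD gl) Rg => /addIr.
Qed.

End Cancellation.

Lemma I2_ind (P : 'I_2 -> Prop) : P j1 -> P j2 -> forall l, P l.
Proof.
move=> P1 P2 [[|[|//]] hl]; [move: P1 | move: P2]; congr P; exact: val_inj.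
Qed.

Section LevelOne.
Variables (K : numFieldType) (V : lmodType K) (F : fock_rep V) (D : DYops V).
Implicit Types (v w : V) (i j : 'I_2) (r n : int).

Hypothesis DYt_linear : forall i j r k, linear (DYt D i j r k).
Hypothesis DYC_one : DYC D = @hone K V.
Hypotheses (Xplus_eq : fdivh (Xplus D) = vXalpha F)
  (Xminus_eq : fdivh (Xminus D) = vXmalpha F).
Hypotheses (k1plus_eq : k1 D true = vk1plus F) (k2plus_eq : k2 D true = vk2plus F).
Hypotheses (k1minus_eq : k1 D false = vk1minus F) (k2minus_eq : k2 D false = vk2minus F).

Notation parity := (parity F).
Let pc := parity_compat F.
Let lP := linear_parity F.

Lemma flin_DYT s i j : flin (DYT D s i j).
Proof.
move=> n k; have hm (A : hop V) : (forall k, linear (A k)) -> linear (hmulh A k).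
  by case: k => [|k] hA; [exact: linear_zero | exact: hA].
apply: linear_add; first by case: (i == j); [exact: flin_fone | exact: linear_zero].
case: s; case: n => r; try exact: linear_zero.
  by apply: linear_opp; apply: hm; exact: DYt_linear.
by apply: hm; exact: DYt_linear.
Qed.

Lemma DYT_h0 s i j n v : DYT D s i j n 0%N v = if i == j then fone n 0%N v else 0.
Proof. by rewrite /DYT; case: s; case: n => r; rewrite /= ?oppr0 addr0. Qed.

Lemma DYT_plus_ge0 i j n k v : i != j -> (0 <= n)%R -> DYT D true i j n k v = 0.
Proof. by rewrite /DYT => /negbTE -> /=; case: n => r //; rewrite addr0. Qed.

Lemma DYT_plus_gt0 i j n k v : (0 < n)%R -> DYT D true i j n k v = 0.
Proof.
move=> n0; rewrite /DYT /fone (_ : (n == 0) = false); last by apply/eqP; lia.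
by case: n n0 => r // _; case: (i == j); rewrite addr0.
Qed.

Lemma window_DYT_minus i j : window 1 (DYT D false i j).
Proof.
move=> n k v; rewrite mul1r => n0.
rewrite /DYT /fone (_ : (n == 0) = false); last by apply/eqP; lia.
by case: n n0 => r // _; case: (i == j); rewrite addr0.
Qed.

Lemma DYt_pos i j (r : nat) k v : DYt D i j r k v = - DYT D true i j (Negz r) k.+1 v.
Proof. by rewrite /DYT /fone; case: (i == j); rewrite /= add0r opprK. Qed.

Lemma DYt_neg i j (r : nat) k v : DYt D i j (Negz r) k v = DYT D false i j r k.+1 v.
Proof.
by rewrite /DYT /fone; case: (i == j) => /=; [case: eqP => _|]; rewrite /= add0r.
Qed.

Let sc c : hop V := hscale c (DYC D).

Lemma linear_sc c k : linear (sc c k).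
Proof. by rewrite /sc DYC_one; apply: linear_scale; exact: linear_hone. Qed.

Lemma parity_sc c : htwisted parity (sc c).
Proof. by rewrite /sc DYC_one; apply: (htwisted_hscale lP); exact: (htwisted_hone lP). Qed.

Let tsh c s i j : fld V := shC D c (DYT D s i j).

Lemma flin_tsh c s i j : flin (tsh c s i j).
Proof. by apply: flin_fshift; [exact: flin_DYT | exact: linear_sc]. Qed.

Lemma tsh_h0 c s i j n v : tsh c s i j n 0%N v = if i == j then fone n 0%N v else 0.
Proof. by rewrite /tsh /shC fshift0 ?DYT_h0 //; exact: flin_DYT. Qed.

Lemma tsh_h1 c s i j n v : i != j -> tsh c s i j n 1%N v = DYT D s i j n 1%N v.
Proof.
move=> ij; rewrite /tsh /shC /fshift big_ord_recl big_ord1 gbin0 scale1r addr0.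
rewrite hcomp_hone; last by move=> k; rewrite lin0 //; exact: flin_DYT.
by rewrite /hcomp big_ord1 DYT_h0 (negbTE ij) scaler0 addr0.
Qed.

Lemma window_tsh_minus c i j : window 1 (tsh c false i j).
Proof. by apply: window_fshift; exact: window_DYT_minus. Qed.

Lemma window_tsh_plus c i j : window (-1) (tsh c true i j).
Proof.
move=> n k v h; apply: (@fshift_lt _ _ _ _ 1); last by lia.
by move=> p l w p1; apply: DYT_plus_gt0; lia.
Qed.

Lemma tsh_plus_ge0 c i j n k v : i != j -> (0 <= n)%R -> tsh c true i j n k v = 0.
Proof.
move=> ij n0; apply: (@fshift_lt _ _ _ _ 0) => // p l w p0.
exact: DYT_plus_ge0.
Qed.

Let inv c s : fld V := finv (tsh c s j1 j1).

Lemma fzero_inv c s : fzero (inv c s).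
Proof. by apply: fzero_finv; apply: flin_fzero; exact: flin_tsh. Qed.

Lemma inv_h0 c s n v : inv c s n 0%N v = fone n 0%N v.
Proof.
apply: finv0_one => [|q]; first by apply: flin_fzero; exact: flin_tsh.
by rewrite tsh_h0 eqxx.
Qed.

Lemma window_inv (e : int) c s : window e (tsh c s j1 j1) -> window e (inv c s).
Proof.
move=> w; rewrite /inv finvE; apply: window_fseries.
  by apply: fzero_fsub; [exact: fzero_fone | apply: flin_fzero; exact: flin_tsh].
by apply: window_fsub => //; exact: window_fone.
Qed.

(** The negative and the nonnegative powers of [u] separate the two terms of each
    current. *)
Lemma Xplus_neg n : (n < 0)%R ->
  Xplus D n = fmul (inv (- 4^-1) true) (tsh (- 4^-1) true j1 j2) n.
Proof.
move=> n0; apply/funext => k; apply/funext => v; rewrite /Xplus /fsub.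
rewrite [X in _ - X](window_fmul (e := 1) (fzero_inv _ _)) ?subr0 //.
- exact: window_inv (@window_tsh_minus _ _ _).
- exact: window_tsh_minus.
- by rewrite mul1r.
Qed.

Lemma Xplus_ge0 n k v : (0 <= n)%R ->
  Xplus D n k v = - fmul (inv 4^-1 false) (tsh 4^-1 false j1 j2) n k v.
Proof.
move=> n0; rewrite /Xplus /fsub [X in X - _](_ : _ = 0) ?sub0r //.
rewrite /fmul big1 // => i _; apply: fsbig1 => m _.
have [m0|m0] := ltP m 0; last by rewrite [X in finv _ _ _ X]tsh_plus_ge0 //; exact: fzero_inv.
by apply: (window_inv (@window_tsh_plus _ _ _)); lia.
Qed.

Lemma Xminus_neg n : (n < 0)%R ->
  Xminus D n = fmul (tsh 4^-1 true j2 j1) (inv 4^-1 true) n.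
Proof.
move=> n0; apply/funext => k; apply/funext => v; rewrite /Xminus /fsub.
rewrite [X in _ - X](window_fmul (e := 1) (flin_fzero (@flin_tsh _ _ _ _))) ?subr0 //.
- exact: window_tsh_minus.
- exact: window_inv (@window_tsh_minus _ _ _).
- by rewrite mul1r.
Qed.

Lemma Xminus_ge0 n k v : (0 <= n)%R ->
  Xminus D n k v = - fmul (tsh (- 4^-1) false j2 j1) (inv (- 4^-1) false) n k v.
Proof.
move=> n0; rewrite /Xminus /fsub [X in X - _](_ : _ = 0) ?sub0r //.
rewrite /fmul big1 // => i _; apply: fsbig1 => m _.
have [m0|m0] := ltP 0 m.
  rewrite [X in shC _ _ _ _ _ X](_ : _ = 0); first by rewrite lin0 //; exact: flin_tsh.
  by apply: (window_inv (@window_tsh_plus _ _ _)); lia.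
by apply: tsh_plus_ge0 => //; lia.
Qed.

(** ** Leading coefficients of the generators *)

Lemma fmul_h1_l c s j n v : j1 != j ->
  fmul (inv c s) (tsh c s j1 j) n 1%N v = DYT D s j1 j n 1%N v.
Proof.
move=> ij; rewrite /fmul big_ord_recl big_ord1 [X in _ + X]fsbig1 ?addr0; last first.
  by move=> m _; rewrite [X in inv _ _ _ _ X]tsh_h0 (negbTE ij) fzero_inv.
rewrite (@fsum_single _ _ _ n) //; last first.
  by move=> m _ mn; rewrite inv_h0 /fone subr_eq0 eq_sym (negbTE mn).
by rewrite subrr inv_h0 /fone eqxx /= tsh_h1.
Qed.

Lemma fmul_h1_r c s i n v : i != j1 ->
  fmul (tsh c s i j1) (inv c s) n 1%N v = DYT D s i j1 n 1%N v.
Proof.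
move=> ij; rewrite /fmul big_ord_recl big_ord1 fsbig1 ?add0r; last first.
  by move=> m _; rewrite tsh_h0 (negbTE ij).
rewrite (@fsum_single _ _ _ 0) //; last first.
  by move=> m _ /negbTE m0; rewrite inv_h0 /fone m0 lin0 //; exact: flin_tsh.
by rewrite subr0 inv_h0 /fone eqxx /= tsh_h1.
Qed.

Lemma t12_h0 r v : DYt D j1 j2 r 0%N v = - vXalpha F (- r - 1) 0%N v.
Proof.
rewrite -Xplus_eq /fdivh /hdivh; case: r => r.
  rewrite DYt_pos Xplus_neg; last by lia.
  by rewrite fmul_h1_l //; have -> : - r%:Z - 1 = Negz r by lia.
rewrite DYt_neg Xplus_ge0; last by lia.
by rewrite fmul_h1_l // opprK; have -> : - Negz r - 1 = r by lia.
Qed.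

Lemma t21_h0 r v : DYt D j2 j1 r 0%N v = - vXmalpha F (- r - 1) 0%N v.
Proof.
rewrite -Xminus_eq /fdivh /hdivh; case: r => r.
  rewrite DYt_pos Xminus_neg; last by lia.
  by rewrite fmul_h1_r //; have -> : - r%:Z - 1 = Negz r by lia.
rewrite DYt_neg Xminus_ge0; last by lia.
by rewrite fmul_h1_r // opprK; have -> : - Negz r - 1 = r by lia.
Qed.

Lemma t11_h0 (r : nat) v : DYt D j1 j1 (Negz r) 0%N v = heisen F j2 (Negz r) v.
Proof. by rewrite DYt_neg -vk1minus_h1 -k1minus_eq. Qed.

Lemma k2_tail_h1 s n v : fmul (DYT D s j2 j1)
  (fmul (finv (DYT D s j1 j1)) (DYT D s j1 j2)) n 1%N v = 0.
Proof.
have zT i j : fzero (DYT D s i j) by apply: flin_fzero; exact: flin_DYT.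
rewrite /fmul big_ord_recl big_ord1 !fsbig1 ?addr0 // => m _; last by rewrite DYT_h0.
rewrite -[X in DYT _ _ _ _ _ _ X]/(fmul (finv (DYT D s j1 j1)) (DYT D s j1 j2) m 0%N v).
rewrite fmul0E fsbig1 ?zT // => p _.
by rewrite DYT_h0; apply: fzero_finv.
Qed.

Lemma t22_h0 (r : nat) v : DYt D j2 j2 (Negz r) 0%N v = heisen F j1 (Negz r) v.
Proof. by rewrite DYt_neg -vk2minus_h1 -k2minus_eq /k2 /fsub k2_tail_h1 subr0. Qed.

Lemma k_h0 s n v : k1 D s n 0%N v = fone n 0%N v /\ k2 D s n 0%N v = fone n 0%N v.
Proof.
split; first by rewrite /k1 DYT_h0.
rewrite /k2 /fsub DYT_h0 /= fmul0E fsbig1 ?subr0 // => m _; exact: DYT_h0.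
Qed.

Lemma sh_h0 c (A : fld V) n v : fzero A -> sh c A n 0%N v = A n 0%N v.
Proof.
move=> zA; rewrite /sh /fshift big_ord1 gbin0 scale1r addr0 subn0.
by rewrite hcomp_hone // => k; exact: zA.
Qed.

Lemma sh_h1 c (A : fld V) n v : fzero A -> (forall q w, A q 0%N w = fone q 0%N w) ->
  (0 <= n)%R -> sh c A n 1%N v = A n 1%N v.
Proof.
move=> zA A0 n0; rewrite /sh /fshift big_ord_recl big_ord1 gbin0 scale1r addr0.
rewrite hcomp_hone; last by move=> k; exact: zA.
rewrite [X in _ + X](_ : _ = 0) ?addr0 //.
rewrite /hcomp big_ord1 A0 fone0E; case: eqP => [e|_]; last by rewrite scaler0.
by exfalso; have e' : n + 1 = 0 := e; lia.
Qed.

Lemma kappa_h0 (r : nat) v : (0 < r)%N -> kappa D r 0%N v = Cop F r v.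
Proof.
move=> r0; rewrite /kappa /fdivh /hdivh /fsub [fone _ _ _](_ : _ = 0); last first.
  by rewrite /fone; case: eqP.
have zT i j : fzero (DYT D false i j) by apply: flin_fzero; exact: flin_DYT.
have z1 : fzero (k1 D false) by exact: zT.
have z2 : fzero (k2 D false).
  by apply: fzero_fsub => //; do 2! apply: fzero_fmul => //; exact: fzero_finv.
have h1 q w : k1 D false q 0%N w = fone q 0%N w by have [-> _] := k_h0 false q w.
have h2 q w : k2 D false q 0%N w = fone q 0%N w by have [_ ->] := k_h0 false q w.
rewrite subr0 /Kminus /fmul big_ord_recl big_ord1.
rewrite (@fsum_single _ _ _ r.-1%:Z) //; last first.
  by move=> m _ mr; rewrite sh_h0 // h1 fone0E subr_eq0 eq_sym (negbTE mr).
rewrite [X in _ + X](@fsum_single _ _ _ 0) //; last first.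
  move=> m _ /negbTE m0; rewrite [X in sh _ _ _ _ X]sh_h0 // h2 fone0E m0.
  by rewrite /sh /fshift big1 // => l _; rewrite /hcomp big1 ?scaler0 // => i _;
    rewrite (lin0 (linear_hexp _ _ _)) ?z1 // => k; apply: linear_scale; exact: linear_hone.
rewrite subrr subr0 sh_h0 // h1 fone0E eqxx.
have -> : sh 2^-1 (k2 D false) 0 (1 - lift ord0 (@ord0 0))%N v = v.
  by rewrite [LHS]sh_h0 // h2 fone0E eqxx.
rewrite [X in X + _]sh_h1 // [X in _ + X]sh_h1 // k1minus_eq k2minus_eq.
by rewrite vk1minus_h1 vk2minus_h1.
Qed.

(** ** The generators preserve the parity of the charge *)

(** The off-diagonal entries are obtained from the currents by cancelling the invertible
    factor [t_11], and [t_22] then from the quasi-determinant [k_2]. *)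
Lemma twisted_DYT s i j : twisted parity 0 (DYT D s i j).
Proof.
have tX : twisted parity 0 (fdivh (Xplus D)) by rewrite Xplus_eq; exact: twisted_vXalpha.
have tY : twisted parity 0 (fdivh (Xminus D)) by rewrite Xminus_eq; exact: twisted_vXmalpha.
have t11 : twisted parity 0 (DYT D s j1 j1).
  rewrite -/(k1 D s); case: s; [rewrite k1plus_eq | rewrite k1minus_eq].
    by have [] := twisted_vkplus F.
  exact: (twisted_vk1minus pc (heisen_parity F)).
have tk2 : twisted parity 0 (k2 D s).
  case: s t11 => _; [rewrite k2plus_eq | rewrite k2minus_eq].
    by have [] := twisted_vkplus F.
  exact: (twisted_vk2minus pc (heisen_parity F)).
have tinv c : twisted parity 0 (inv c s).
  by apply: (twisted_finv pc); apply: (twisted_fshift pc) => //; exact: parity_sc.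
have zT s' i' j' : fzero (DYT D s' i' j') by apply: flin_fzero; exact: flin_DYT.
have ztsh c s' i' j' : fzero (tsh c s' i' j') by apply: flin_fzero; exact: flin_tsh.
have Xh0 n v : Xplus D n 0%N v = 0.
  rewrite /Xplus /fsub !fmul0E !fsbig1 ?subrr // => m _.
    by rewrite [X in finv _ _ _ X]tsh_h0; exact: fzero_inv.
  by rewrite [X in finv _ _ _ X]tsh_h0; exact: fzero_inv.
have Yh0 n v : Xminus D n 0%N v = 0.
  by rewrite /Xminus /fsub !fmul0E !fsbig1 ?subrr // => m _; exact: tsh_h0.
have tXn n : htwisted parity (Xplus D n).
  move=> [|k] v; first by rewrite !Xh0 lin0.
  by have := tX n k v; rewrite subr0.
have tYn n : htwisted parity (Xminus D n).
  move=> [|k] v; first by rewrite !Yh0 lin0.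
  by have := tY n k v; rewrite subr0.
have opp (A B : hop V) : (forall k v, A k v = - B k v) -> htwisted parity A -> htwisted parity B.
  move=> AB hA k v; apply: oppr_inj; rewrite -AB hA AB; exact: (linN lP).
have t12 : twisted parity 0 (DYT D s j1 j2).
  pose c : K := if s then - 4^-1 else 4^-1.
  apply: (twisted_unshift pc (zT _ _ _) (parity_sc c)).
  apply: (twisted_cancel_l pc (fzero_inv c s) (@inv_h0 c s) (tinv c)) => n.
  rewrite {t11 tk2 tinv}/c; case: s; have [n0|n0] := ltP n 0.
  - by right; rewrite -/(tsh (- 4^-1) true j1 j2) -Xplus_neg.
  - by left=> k v; exact: tsh_plus_ge0.
  - by left=> k v; apply: window_tsh_minus; rewrite mul1r.
  - right; apply: opp (tXn n) => k v; exact: Xplus_ge0.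
have t21 : twisted parity 0 (DYT D s j2 j1).
  pose c : K := if s then 4^-1 else - 4^-1.
  apply: (twisted_unshift pc (zT _ _ _) (parity_sc c)).
  apply: (twisted_cancel_r pc (ztsh c s _ _) (@inv_h0 c s) (tinv c)) => n.
  rewrite {t11 tk2 tinv t12}/c; case: s; have [n0|n0] := ltP n 0.
  - by right; rewrite -/(tsh (4^-1) true j2 j1) -Xminus_neg.
  - by left=> k v; exact: tsh_plus_ge0.
  - by left=> k v; apply: window_tsh_minus; rewrite mul1r.
  - right; apply: opp (tYn n) => k v; exact: Xminus_ge0.
have t22 : twisted parity 0 (DYT D s j2 j2).
  pose tail := fmul (DYT D s j2 j1) (fmul (finv (DYT D s j1 j1)) (DYT D s j1 j2)).
  have tt : twisted parity 0 tail.
    exact: (twisted_fmul pc t21 (twisted_fmul pc (twisted_finv pc t11) t12)).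
  move=> n k v; have := tk2 n k v; rewrite /k2 /fsub -/tail tt subr0 (linB lP).
  by move/addIr.
by move: i j; apply: I2_ind; apply: I2_ind.
Qed.

Lemma DYt_parity i j r : htwisted parity (DYt D i j r).
Proof.
move=> k v; case: r => r.
  by rewrite !DYt_pos (twisted_DYT true i j) subr0 (linN lP).
by rewrite !DYt_neg (twisted_DYT false i j) subr0.
Qed.

(** With [g] a multiple of the parity operator, this transports eigenvectors of the
    parity without an appeal to the linearity of [kappa]. *)
Lemma htwisted_kappa (g : V -> V) (r : nat) : sum_compatible g ->
  (forall i j, twisted g 0 (DYT D false i j)) -> htwisted g (kappa D r).
Proof.
move=> gc tT; have tk2 : twisted g 0 (k2 D false).
  apply: (twisted_fsub gc (tT _ _)).
  exact: (twisted_fmul gc (tT _ _) (twisted_fmul gc (twisted_finv gc (tT _ _)) (tT _ _))).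
move=> k v; rewrite /kappa.
have tK : twisted g 0 (fdivh (fsub (Kminus D) (@fone K V))).
  apply: twisted_fdivh; apply: (twisted_fsub gc _ (twisted_fone gc)).
  exact: (twisted_fmul gc (twisted_sh gc _ (tT j1 j1)) (twisted_sh gc _ tk2)).
by rewrite tK subr0.
Qed.

(** ** The orbit of a highest weight vector *)

Lemma DYword_linear (u : {fmonom DYgen}) k : linear (DYword_act D u k).
Proof.
rewrite /DYword_act; elim: (fmonom_val u) k => [|g t IH] k /=; first exact: linear_hone.
apply: linear_hcomp => // l; case: g => [[[i j] r]|] /=; first exact: DYt_linear.
by rewrite DYC_one; exact: linear_hone.
Qed.

Lemma DYword_parity (u : {fmonom DYgen}) : htwisted parity (DYword_act D u).
Proof.
rewrite /DYword_act; elim: (fmonom_val u) => [|g t IH] /=; first exact: (htwisted_hone lP).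
apply: (htwisted_hcomp lP) => //; case: g => [[[i j] r]|] /=; first exact: DYt_parity.
by rewrite DYC_one; exact: (htwisted_hone lP).
Qed.

Let act (p : {malg K[{fmonom DYgen}]}) (k : nat) v : V :=
  mlin (fun x => DYword_act D x k v) p.

Lemma act_parity p k v : act p k (parity v) = parity (act p k v).
Proof.
rewrite /act /mlin (lin_sum lP); apply: eq_bigr => x _.
by rewrite DYword_parity (linZ lP).
Qed.

Lemma DY_actE a k v : DY_act D a k v = \sum_(i < k.+1) act (a i) (k - i)%N v.
Proof. by []. Qed.

(** The subspace of charges congruent to [c] modulo two. *)
Definition same_parity (c : int) v : Prop := parity v = (-1) ^ c *: v.

Lemma same_parity0 c : same_parity c 0.
Proof. by rewrite /same_parity lin0 // scaler0. Qed.

Lemma same_parityP c a u w : same_parity c u -> same_parity c w ->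
  same_parity c (a *: u + w).
Proof.
by move=> hu hw; rewrite /same_parity lP hu hw scalerDr !scalerA mulrC.
Qed.

Lemma same_parityB c u w : same_parity c u -> same_parity c w -> same_parity c (u - w).
Proof. by move=> hu hw; rewrite /same_parity (linB lP) hu hw scalerBr. Qed.

Lemma same_parity_sum c (I : Type) (s : seq I) (P : pred I) (G : I -> V) :
  (forall x, P x -> same_parity c (G x)) -> same_parity c (\sum_(x <- s | P x) G x).
Proof.
move=> h; apply: big_ind => // [|u w hu hw]; first exact: same_parity0.
by rewrite -[u]scale1r; apply: same_parityP.
Qed.

Lemma same_parity_fvec c m : same_parity c (fvec F m c).
Proof. exact: parityU. Qed.

Lemma act_same_parity c p k v : same_parity c v -> same_parity c (act p k v).
Proof.
move=> hv; rewrite /same_parity -act_parity hv /act /mlin scaler_sumr.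
apply: eq_bigr => x _; rewrite (linZ (@DYword_linear x k)) !scalerA.
by rewrite mulrC.
Qed.

Lemma same_parity_span c v : same_parity c v ->
  in_span (fun b => exists m (d : int), b = fvec F m (c + 2 * d)) v.
Proof.
move=> hv; set S := in_span _.
have sq : (-1) ^ c * (-1) ^ c = 1 :> K by rewrite -expfzMl mulrNN mulr1 exp1rz.
(* twice the projection of [v] on the vectors of parity [c] *)
have key : S (v + (-1) ^ c *: parity v).
  move: v {hv}; apply: (fvec_span (f0 := F)) => [|a u w hu hw|m s].
  - by rewrite add0r lin0 // scaler0.
  - rewrite lP scalerDr scalerA [_ * a]mulrC -scalerA addrACA -scalerDr.
    exact: spanP.
  - rewrite parityU scalerA -expfzDr ?oppr_eq0 ?oner_eq0 //.
    have [d [e|e]] : exists d : int, c + s = 2 * d \/ c + s = 2 * d + 1.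
      by exists ((c + s) %/ 2)%Z; lia.
      rewrite e -exprz_exp [X in X ^ d](_ : _ = 1); last first.
        by rewrite -[LHS]/((-1) ^+ 2) sqrrN expr1n.
      rewrite exp1rz scale1r; apply: spanD; apply: span_gen; exists m, (d - c); congr (fvec F m _);
        lia.
    rewrite e expfzDr ?oppr_eq0 ?oner_eq0 // -exprz_exp [X in X ^ d](_ : _ = 1); last first.
      by rewrite -[LHS]/((-1) ^+ 2) sqrrN expr1n.
    by rewrite exp1rz mul1r expr1z scaleN1r subrr.
have n2 : 2%:R != 0 :> K by rewrite pnatr_eq0.
have -> : v = 2^-1 *: (v + (-1) ^ c *: parity v).
  by rewrite hv scalerA sq scale1r -mulr2n -scaler_nat scalerA mulVf ?scale1r.
exact: spanZ.
Qed.

Notation vtop c := (fvec F (onecm _) c).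

(** Modulo [h] the generators act by [a_1(-r)], [a_2(-r)] and by the modes of the
    two vertex operators, whose extremal modes translate the charge. *)
Lemma orbit_h0 c v : same_parity c v -> exists p, act p 0 (vtop c) = v.
Proof.
pose S w := exists p, act p 0 (vtop c) = w.
have lact : linear (fun p => act p 0 (vtop c)) by exact: linear_mlin.
have SP a u w : S u -> S w -> S (a *: u + w).
  by move=> [p <-] [q <-]; exists (a *: p + q); rewrite lact.
have S0 : S 0 by exists 0; rewrite (lin0 lact).
have Sgen i j r w : S w -> S (DYt D i j r 0%N w).
  move=> [p <-]; pose L (x : {fmonom DYgen}) : {malg K[{fmonom DYgen}]} :=
    << fmmul (fmu (Some (i, j, r))) x >>.
  exists (mlin L p); move: p; apply: linear_ext.
  - by move=> a u u'; rewrite linear_mlin lact.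
  - by move=> a u u'; rewrite lact DYt_linear.
  - move=> x; rewrite mlinU scale1r /L /act !mlinU !scale1r.
    by rewrite /DYword_act fmmulE fmuE /= /hcomp big_ord1.
have S1 : S (vtop c).
  by exists << fmone DYgen >>; rewrite /act mlinU scale1r /DYword_act fmoneE.
have Sa j (p : nat) w : S w -> S (heisen F j (Negz p) w).
  move=> Sw; move: j; apply: I2_ind; first by rewrite -t22_h0; exact: Sgen.
  by rewrite -t11_h0; exact: Sgen.
have SN w : S (- w) -> S w.
  by move=> Sw; rewrite -[w]opprK -scaleN1r -[_ *: _]addr0; exact: SP.
have Sup s : S (vtop s) -> S (vtop (s + 2)).
  move=> h; apply: SN; rewrite -vXalpha_top.
  have -> : s = - (- s - 1) - 1 by ring.
  by rewrite -t12_h0 opprD opprK addrK; exact: Sgen.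
have Sdown s : S (vtop s) -> S (vtop (s - 2)).
  move=> h; apply: SN; rewrite -vXmalpha_top.
  have -> : vXmalpha F (- s) = vXmalpha F (- (s - 1) - 1) by congr (vXmalpha F _); ring.
  by rewrite -t21_h0; exact: Sgen.
have Stop d : S (vtop (c + 2 * d)).
  case: d => d.
    elim: d => [|d IH]; first by rewrite mulr0 addr0.
    by have := Sup _ IH; have -> : c + 2 * d%:Z + 2 = c + 2 * d.+1%:Z by lia.
  elim: d => [|d IH]; first by have := Sdown _ S1; have -> : c - 2 = c + 2 * Negz 0 by lia.
  by have := Sdown _ IH; have -> : c + 2 * Negz d - 2 = c + 2 * Negz d.+1 by lia.
move=> /same_parity_span hv; apply: (hv S) => // b [m [d ->]].
exact: (@fvec_induction _ _ F S (c + 2 * d)).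
Qed.

(** The coefficient of [h^k] in the algebra is chosen so as to correct, modulo [h], the
    error left by the preceding coefficients. *)
Lemma orbitE (c : int) (f : fock V) :
  DY_orbit D (hconst (vtop c)) f <-> forall k, same_parity c (f k).
Proof.
have act0 p k : act p k 0 = 0.
  by rewrite /act /mlin big1 // => x _; rewrite (lin0 (@DYword_linear x k)) scaler0.
have happE a k : happ (DY_act D a) (hconst (vtop c)) k =
    \sum_(i < k.+1) act (a i) (k - i)%N (vtop c).
  rewrite happ_hconst ?DY_actE // => l; rewrite DY_actE big1 // => i _; exact: act0.
split=> [[a ->] k|hf].
  rewrite happE; apply: same_parity_sum => i _; apply: act_same_parity.
  exact: same_parity_fvec.
have /choice [ch hch] : forall v : V, exists p, same_parity c v -> act p 0 (vtop c) = v.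
  move=> v; have [/orbit_h0 [p hp]|nv] := pselect (same_parity c v); first by exists p.
  by exists 0 => /nv.
have [|a ha] := @course_of_values _ (0 : {malg K[{fmonom DYgen}]})
  (fun (l : nat) a => ch (f l - \sum_(i < l) act (a i) (l - i)%N (vtop c))).
  move=> l a b ab; congr (ch (_ - _)); apply: eq_bigr => i _; by rewrite ab.
exists a; apply/funext => k; rewrite happE big_ord_recr /= subnn [a k]ha hch.
  by rewrite addrC subrK.
apply: same_parityB => //; apply: same_parity_sum => i _; apply: act_same_parity.
exact: same_parity_fvec.
Qed.

End LevelOne.

(** * Lifting a basis modulo [h] *)

Section Lifting.
Variables (K : fieldType) (V : lmodType K) (S : V -> Prop).
Hypotheses (S0 : S 0) (SP : forall a u w, S u -> S w -> S (a *: u + w)).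
Variables (L B : set (fock V)).
Hypothesis LE : forall f, L f <-> forall k, S (f k).
Implicit Types (f g : fock V) (c : nat -> K).

Let LS f k : L f -> S (f k). Proof. by move/LE. Qed.

Lemma hcong_agree n f g : L f -> L g -> hcong L n f g <-> forall k, (k < n)%N -> f k = g k.
Proof.
move=> Lf Lg; split=> [[e _ he] k kn|h].
  by apply/eqP; rewrite -subr_eq0 he /hshift kn.
exists (fun k => f (k + n)%N - g (k + n)%N).
  by apply/LE => k; rewrite -scaleN1r addrC; apply: SP; exact: LS.
move=> k; rewrite /hshift; case: ltnP => [kn|nk]; first by rewrite h // subrr.
by rewrite subnK.
Qed.

Lemma hcomplete_L : hcomplete L.
Proof.
move=> f Lf /choice [N hN].
have agree n p k : (N n <= p)%N -> (k < n)%N -> f p k = f (N n) k.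
  by move=> Np kn; have /(hcong_agree n (Lf _) (Lf _)) := hN n p (N n) Np (leqnn _); apply.
have Lg : L (fun k => f (N k.+1) k) by apply/LE => k; exact: LS.
exists (fun k => f (N k.+1) k) => // n; exists (\max_(k < n.+1) N k) => p Np.
apply/hcong_agree => // k kn; apply: agree (ltnSn k).
by apply: leq_trans Np; exact: (leq_bigmax (Ordinal (kn : k.+1 < n.+1)%N)).
Qed.

Lemma lincombE n (c : 'I_n -> nat -> K) (b : 'I_n -> fock V) k :
  (forall j l, (l < k)%N -> c j l = 0) -> lincomb c b k = \sum_(j < n) c j k *: b j 0%N.
Proof.
move=> h; apply: eq_bigr => j _; rewrite /sscale big_ord_recr /= subnn big1 ?add0r // => l _.
by rewrite h ?ltn_ord // scale0r.
Qed.

Lemma hspanD f g : hspan B f -> hspan B g -> hspan B (fun k => f k + g k).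
Proof.
move=> [m [c [b [hb ->]]]] [n [d [e [he ->]]]].
exists (m + n)%N, (fun j : 'I_(m + n) => match fintype.split j with inl j => c j | inr j => d j end),
  (fun j : 'I_(m + n) => match fintype.split j with inl j => b j | inr j => e j end); split.
  by move=> j; case: (fintype.split j) => l.
apply/funext => k; rewrite /lincomb big_split_ord; congr (_ + _); apply: eq_bigr => j _.
  by rewrite (fintype.unsplitK (inl j)).
by rewrite (fintype.unsplitK (inr j)).
Qed.

Lemma hspanZ a f : hspan B f -> hspan B (fun k => a *: f k).
Proof.
move=> [m [c [b [hb ->]]]]; exists m, (fun j k => a * c j k), b; split=> //.
apply/funext => k; rewrite /lincomb scaler_sumr; apply: eq_bigr => j _.
by rewrite /sscale scaler_sumr; apply: eq_bigr => l _; rewrite scalerA.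
Qed.

Lemma hspan_h f : hspan B f -> hspan B (hshift 1 f).
Proof.
move=> [m [c [b [hb ->]]]].
exists m, (fun j k => if k is k'.+1 then c j k' else 0), b; split=> //.
apply/funext => -[|k]; rewrite /lincomb /hshift /=.
  by rewrite big1 // => j _; rewrite /sscale big_ord1 scale0r.
rewrite subn1; apply: eq_bigr => j _.
by rewrite /sscale [RHS]big_ord_recl scale0r add0r; apply: eq_bigr => l _.
Qed.

Lemma hspan_gen b : B b -> exists2 f, hspan B f & f 0%N = b 0%N.
Proof.
move=> Bb; exists (lincomb (fun (_ : 'I_1) k => (k == 0)%N%:R) (fun=> b)).
  by exists 1%N, (fun _ k => (k == 0)%N%:R), (fun=> b).
by rewrite lincombE // big_ord1 scale1r.
Qed.

Lemma hspan0 : hspan B (fun=> 0).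
Proof.
exists 0%N, (fun _ _ => 0), (fun _ _ => 0); split=> [[] //|].
by apply/funext => k; rewrite /lincomb big_ord0.
Qed.

Hypothesis BL : B `<=` L.

Lemma hspan_L : hspan B `<=` L.
Proof.
move=> _ [n [c [b [hb ->]]]]; have SD u w : S u -> S w -> S (u + w).
  by move=> hu hw; rewrite -[u]scale1r; exact: SP.
apply/LE => k; apply: big_ind => // j _; apply: big_ind => // l _.
by rewrite -[_ *: _]addr0; apply: SP => //; apply/LS/BL.
Qed.

Hypothesis B_free : forall n (a : 'I_n -> K) (b : 'I_n -> fock V), injective b ->
  (forall j, B (b j)) -> \sum_(j < n) a j *: b j 0%N = 0 -> forall j, a j = 0.
Hypothesis B_span : forall v, S v -> in_span (fun w => exists2 b, B b & w = b 0%N) v.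

Lemma lin_indep_lift : lin_indep B.
Proof.
move=> n c b binj hb h0 j k; have [N] := ubnP k; elim: N j k => // N IH j k kN.
apply: (B_free (a := fun j => c j k) binj hb).
by rewrite -lincombE // => j' l lk; apply: IH; exact: leq_trans lk kN.
Qed.

(** After matching the constant term the error is divisible by [h]. *)
Lemma hspan_approx n f : L f -> exists2 g, hspan B g & forall k, (k < n)%N -> f k = g k.
Proof.
elim: n f => [|n IH] f Lf; first by exists (fun=> 0) => //; exact: hspan0.
have [g0 hg0 g0f] : exists2 g, hspan B g & g 0%N = f 0%N.
  apply: (B_span (LS 0%N Lf) (P := fun v => exists2 g, hspan B g & g 0%N = v)).
  - by exists (fun=> 0) => //; exact: hspan0.
  - move=> a _ _ [g hg <-] [g' hg' <-].
    by exists (fun k => a *: g k + g' k) => //; apply: hspanD => //; exact: hspanZ.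
  - by move=> _ [b Bb ->]; exact: hspan_gen.
have [|g hg gE] := IH (fun k => f k.+1 - g0 k.+1).
  apply/LE => k; rewrite -scaleN1r addrC; apply: SP; apply: LS => //; exact: hspan_L.
exists (fun k => g0 k + hshift 1 g k).
  by apply: hspanD => //; exact: hspan_h.
by case=> [|k] kn; rewrite /hshift /= ?g0f ?addr0 // subn1 -gE // addrC subrK.
Qed.

(** Independence and density are both tested one power of [h] at a time, so that they
    follow from the reduction modulo [h] mapping [B] bijectively to a basis of [S]. *)
Lemma topological_basis_lift : topological_basis L B.
Proof.
split=> //; [exact: hcomplete_L | exact: lin_indep_lift |] => f Lf n.
have [g hg gE] := hspan_approx n Lf; exists g => //.
by apply/hcong_agree => //; exact: hspan_L.
Qed.

End Lifting.

(** * The basis of an orbit *)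

Lemma modes_from_path (j l : nat) la : path leq l la ->
  path (fun r r' : int => (r' <= r - 2)%R) (- (l + 2 * j)%N%:Z - 1) (modes_from j.+1 la).
Proof.
elim: la j l => //= x la IH j l /andP[lx hla]; apply/andP; split; first by lia.
exact: IH.
Qed.

Lemma path_modes_from (j l : nat) (s : seq int) :
  path (fun r r' : int => (r' <= r - 2)%R) (- (l + 2 * j)%N%:Z - 1) s ->
  exists2 la, path leq l la & s = modes_from j.+1 la.
Proof.
elim: s j l => [|r s IH] j l /=; first by exists [::].
move=> /andP[hr hs]; pose x := `|(- r - 1 - (2 * j.+1)%N%:Z)%R|%N.
have rx : r = - (x + 2 * j.+1)%N%:Z - 1 by rewrite /x; lia.
rewrite rx in hs; have [la hla ->] := IH j.+1 x hs.
by exists (x :: la); [rewrite /= hla andbT /x; lia | rewrite /= -rx].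
Qed.

Lemma sorted_leading_zeros la : sorted leq la ->
  exists2 p : nat * seq nat, partition p.2 & la = nseq p.1 0%N ++ p.2.
Proof.
elim: la => [|[|l] la IH] hla; first by exists (0%N, [::]).
  by have [[z la'] h ->] := IH (path_sorted hla); exists (z.+1, la').
exists (0%N, l.+1 :: la) => //; rewrite /partition hla andbT /=.
by apply: sub_all (order_path_min leq_trans hla) => x; apply: leq_trans.
Qed.

Section MainTheorem.
Variables (K : numFieldType) (V : lmodType K) (F : fock_rep V) (D : DYops V).
Implicit Types (v w : V) (mu la : seq nat) (c d t : int) (f : fock V).

Notation shift := (shift F).
Notation vbeta := (vbeta F).
Notation parity := (parity F).

Definition vBW0 : set (fock V) :=
  [set f | exists s : seq int,
     [/\ (head (-1) s <= -1)%R, sorted (fun r r' : int => (r' <= r - 2)%R) s &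
         f = foldl (fun g r => happ (vXtilde F (- r - 1)) g) (vac F) s]].

Definition vBLsl c : set (fock V) := \bigcup_(m in [set: int])
  [set (fun k => shift (c + 2 * m) (b k)) | b in vBW0].

Definition vBLgl c : set (fock V) := [set happ A b | A in BH D & b in vBLsl c].

Lemma vBW0E f : vBW0 f <-> exists2 la, sorted leq la & f = vbeta la.
Proof.
split=> [[[|r s] [/= hr hs ->]]|[la hla ->]].
- by exists [::].
- pose x := `|(- r - 1)%R|%N; have rx : r = - (x + 2 * 0)%N%:Z - 1 by rewrite /x; lia.
  rewrite rx in hs; have [la hla e] := path_modes_from hs.
  by exists (x :: la) => //; rewrite /vbeta /part_modes /= -e -rx.
- exists (part_modes la); case: la hla => [|l la] hla; first by split.
  by split=> //; [rewrite /=; lia | exact: modes_from_path].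
Qed.

Lemma vbeta_zeros (z : nat) la k : vbeta (nseq z 0%N ++ la) k = shift (2 * z%:Z) (vbeta la k).
Proof.
elim: z => [|z IH]; first by rewrite mulr0 shift0.
rewrite /= -vbeta_cons0 IH shiftD; congr (shift _ _); lia.
Qed.

Lemma vBLslE c f : vBLsl c f <->
  exists d la, partition la /\ f = (fun k => shift (c + 2 * d) (vbeta la k)).
Proof.
split=> [[m _ [_ /vBW0E [la /sorted_leading_zeros [[z la'] h ->] ->] <-]]|[d [la [h ->]]]].
  exists (m + z%:Z), la'; split=> //; apply/funext => k.
  by rewrite vbeta_zeros shiftD /=; congr (shift _ _); ring.
exists d => //; exists (vbeta la) => //; apply/vBW0E; exists la => //.
by case/andP: h.
Qed.

Definition Evec mu t la : fock V :=
  happ (foldl (fun B r => hcomp (kappa D r) B) (@hone K V) mu) (fun k => shift t (vbeta la k)).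

Lemma vBLglE c f : vBLgl c f <->
  exists mu d la, [/\ partition mu, partition la & f = Evec mu (c + 2 * d) la].
Proof.
split=> [[_ [mu [h1 h2 ->]] [_ /vBLslE [d [la [hla ->]]] <-]]|[mu [d [la [/andP[h1 h2] hla ->]]]]].
  by exists mu, d, la; split=> //; apply/andP.
eexists; first by exists mu; split=> //.
by exists (fun k => shift (c + 2 * d) (vbeta la k)) => //; apply/vBLslE; exists d, la.
Qed.

Hypothesis DYt_linear : forall i j r k, linear (DYt D i j r k).
Hypothesis DYC_one : DYC D = @hone K V.
Hypotheses (Xplus_eq : fdivh (Xplus D) = vXalpha F)
  (Xminus_eq : fdivh (Xminus D) = vXmalpha F).
Hypotheses (k1plus_eq : k1 D true = vk1plus F) (k2plus_eq : k2 D true = vk2plus F).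
Hypotheses (k1minus_eq : k1 D false = vk1minus F) (k2minus_eq : k2 D false = vk2minus F).

Lemma Evec_h0 mu t la : partition mu -> Evec mu t la 0%N = Wvec F mu t la.
Proof.
case/andP => hmu _; rewrite /Evec /happ big_ord1 subnn /Wvec; move: (shift _ _) => v.
elim/last_ind: mu hmu => [|mu r IH] // hmu.
have /andP[r0 hmu'] : (0 < r)%N && all (leq 1) mu by rewrite -all_rcons.
rewrite foldl_rcons /hcomp big_ord1 (kappa_h0 DYt_linear k1minus_eq k2minus_eq) // subnn.
rewrite IH //; apply: (Cseq_perm F v (mu := r :: mu)); by rewrite perm_sym perm_rcons.
Qed.

Lemma Evec_same_parity mu c d la k : same_parity F c (Evec mu (c + 2 * d) la k).
Proof.
(* the involution whose fixed vectors are those of parity [c] *)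
pose sg : K := (-1) ^ c; pose g v := sg *: parity v.
have sg2 : sg * sg = 1 by rewrite -expfzMl mulrNN mulr1 exp1rz.
have lP := linear_parity F.
have gl : linear g by exact: linear_scale.
have gK : involutive g by move=> v; rewrite /g (linZ lP) parityK scalerA sg2 scale1r.
have gc : sum_compatible g by apply: sum_compatible_inj => //; exact: inv_inj.
have gP v : same_parity F c v <-> g v = v.
  rewrite /same_parity /g; split=> [->|{2}<-]; by rewrite scalerA sg2 scale1r.
have gT i j : twisted g 0 (DYT D false i j).
  move=> n l v; have lT := flin_DYT DYt_linear false i j.
  rewrite /g (linZ (lT n l)); congr (_ *: _); exact: twisted_DYT.
have gA : htwisted g (foldl (fun B r => hcomp (kappa D r) B) (@hone K V) mu).
  elim/last_ind: mu => [|mu r IH]; first exact: htwisted_hone.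
  rewrite foldl_rcons; apply: htwisted_hcomp => //; exact: htwisted_kappa.
apply/gP; rewrite /Evec -[LHS](congr1 (fun f => f k) (htwisted_happ gl _ gA)).
have -> // : (fun l => g (shift (c + 2 * d) (vbeta la l))) = (fun l => shift (c + 2 * d) (vbeta la l)).
apply/funext => l; rewrite /g parity_shift vbeta_parity scalerA /sg.
rewrite expfzDr ?oppr_eq0 ?oner_eq0 // mulrA sg2 mul1r -exprz_exp.
by rewrite [X in X ^ d](_ : _ = 1) ?exp1rz ?scale1r // -[LHS]/((-1) ^+ 2) sqrrN expr1n.
Qed.

Theorem level_one_basis c :
  topological_basis (DY_orbit D (hconst (fvec F (onecm _) c))) (vBLgl c).
Proof.
apply: (@topological_basis_lift K V (same_parity F c) (same_parity0 F c) (@same_parityP _ _ F c)).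
- exact: orbitE.
- move=> _ /vBLglE [mu [d [la [_ _ ->]]]]; apply/orbitE => // k; exact: Evec_same_parity.
- move=> n a b binj hb; have /choice [p hp] : forall j, exists q : seq nat * int * seq nat,
      [/\ partition q.1.1, partition q.2 & b j = Evec q.1.1 q.1.2 q.2].
    move=> j; have /vBLglE [mu [d [la [h1 h2 h3]]]] := hb j.
    by exists (mu, c + 2 * d, la).
  rewrite (eq_bigr (fun j => a j *: Wvec F (p j).1.1 (p j).1.2 (p j).2)); last first.
    by move=> j _; have [h1 _ ->] := hp j; rewrite Evec_h0.
  apply: Wvec_free => [i j e|j]; last by have [-> ->] := hp j.
  by apply: binj; have [_ _ ->] := hp i; have [_ _ ->] := hp j; rewrite e.
- move=> v /same_parity_span hv; refine (@span_sub _ _ _ _ _ _ hv) => _ [m [d ->]].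
  refine (@span_sub _ _ (Wset F (c + 2 * d)) _ _ _ (@Wvec_span _ _ F m (c + 2 * d))).
  move=> _ [mu [t [la [h1 h2 h3 ->]]]]; apply: span_gen; exists (Evec mu t la).
    apply/vBLglE; exists mu, (d - (size la)%:Z), la; split=> //; congr (Evec _ _ _); lia.
  by rewrite Evec_h0.
Qed.

End MainTheorem.

(** * The concrete Fock space *)

Section FockSpaceInstance.
Variable K : numFieldType.
Notation FVK := (FV K).
Implicit Types (m : heis_mon) (s : int).

Let e m s : FVK := << (m, s) >>.

Lemma FV_span (P : FVK -> Prop) : P 0 -> (forall c u w, P u -> P w -> P (c *: u + w)) ->
  (forall m s, P (e m s)) -> forall v, P v.
Proof. by move=> P0 PD Pe v; apply: malg_span => // -[m s] _; exact: Pe. Qed.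

Lemma FV_free (W : lmodType K) (f : heis_mon -> int -> W) :
  exists2 phi : FVK -> W, linear phi & forall m s, phi (e m s) = f m s.
Proof.
exists (mlin (fun b => f b.1 b.2)); first exact: linear_mlin.
by move=> m s; rewrite mlinU scale1r.
Qed.

Lemma linear_heis j n : linear (@heis K j n).
Proof. exact: linear_mlin. Qed.

Lemma heis_negU j r m s : heis j (Negz r) (e m s) = e (mulcm m (ucm (j, r))) s.
Proof.
pose phi (b : heis_mon * int) : FVK := << (mulcm b.1 (ucm (j, r)), b.2) >>.
by rewrite -[heis _ _]/(mlin phi) mlinU scale1r.
Qed.

Lemma heis_posU j (r : nat) m s : heis j r (e m s) =
  (r * m (j, r.-1))%:R *: e (divcm m (ucm (j, r.-1))) s.
Proof.
pose phi (b : heis_mon * int) : FVK :=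
  << (r * b.1 (j, r.-1))%:R *g (divcm b.1 (ucm (j, r.-1)), b.2) >>.
by rewrite -[heis _ _]/(mlin phi) mlinU scale1r; exact: monalgUZ.
Qed.

Lemma linear_ewt s : linear (@ewt K s).
Proof. exact: linear_mlin. Qed.

Lemma ewtU s m t : ewt s (e m t) = e m (t + s).
Proof.
pose phi (b : heis_mon * int) : FVK := << (b.1, b.2 + s) >>.
by rewrite -[ewt _]/(mlin phi) mlinU scale1r.
Qed.

Lemma linear_dfun b (g : rat -> K) : linear (dfun b g).
Proof. exact: linear_mlin. Qed.

Lemma dfunU b (g : rat -> K) m s : dfun b g (e m s) = g (form b (wt s)) *: e m s.
Proof.
pose phi (b' : heis_mon * int) : FVK := << g (form b (wt b'.2)) *g b' >>.
by rewrite -[dfun _ _]/(mlin phi) mlinU scale1r; exact: monalgUZ.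
Qed.

Definition FV_rep : fock_rep FVK :=
  FockRep FV_span FV_free linear_heis heis_negU heis_posU linear_ewt ewtU linear_dfun dfunU.

End FockSpaceInstance.

Theorem theorem3p20 (R : realType) (i : 'I_2) (D : DYops (FV R[i])) :
  DY_module D -> level_one D ->
  topological_basis (Lgl D i) (BLgl D i).
Proof.
move=> [[DYt_linear _] _ _ _] [C1 [Xp Xm] [k1p k2p] [k1m k2m]].
(* the operators over [FV_rep] are the given ones by conversion *)
exact: (@level_one_basis R[i] _ (FV_rep R[i]) D DYt_linear C1 Xp Xm k1p k2p k1m k2m i).
Qed.
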